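(* There is a polynomial-time $14$-approximation algorithm for Priority Knapsack Center with Outliers.
   Context: Priority Knapsack Center with Outliers: the input is a finite metric space $(X,d)$, a radius function $r:X\to\mathbb{R}_{>0}$, a weight function $w:X\to\mathbb{R}_{\ge 0}$, and parameters $B>0$ and $m\in\mathbb{N}$. The goal is to find $S\subseteq X$ with $w(S)=\sum_{u\in S}w(u)\le B$ minimizing $\alpha$ such that at least $m$ points $v\in X$ satisfy $d(v,S)\le\alpha\cdot r(v)$, where $d(v,S)=\min_{s\in S}d(v,s)$. A $\rho$-approximation algorithm outputs a feasible $S$ achieving value at most $\rho$ times the optimum value of $\alpha$. *)

(* Defs.v *)
From Corelib Require Import BinNums.
From mathcomp Require Import all_boot all_order all_algebra.
From mathcomp Require Import constructive_ereal.

Set Implicit Arguments.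
Unset Strict Implicit.
Unset Printing Implicit Defensive.

Import Order.TTheory GRing.Theory Num.Theory.

(** * Deterministic multi-tape Turing machines *)

(* Input/output alphabet: the two binary digits [Some b], and a separator
   [None]. *)
Definition symbol : finType := option bool.

Inductive direction := Left | Stay | Right.

(* A tape cell is blank ([None]) or holds an input/output symbol ([inl]) or a
   machine-specific work symbol ([inr]). *)
Record machine := Machine {
  states : finType;
  work : finType;
  extra_tapes : nat;
  start : states;
  final : pred states;
  transition : states ->
    {ffun 'I_extra_tapes.+1 -> option (symbol + work)} ->
    states * {ffun 'I_extra_tapes.+1 -> option (symbol + work) * direction}
}.

Section Machine.
Variable M : machine.

Definition cell : Type := option (symbol + work M).

(* A two-way infinite tape: the cells to the left of the head, nearest first,
   and the cells from the head rightwards; missing cells are blank. *)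
Definition tape : Type := (seq cell * seq cell)%type.

Definition scanned (t : tape) : cell := head None t.2.

Definition act_on (t : tape) (a : cell * direction) : tape :=
  let r := behead t.2 in
  match a.2 with
  | Left => (behead t.1, head None t.1 :: a.1 :: r)
  | Stay => (t.1, a.1 :: r)
  | Right => (a.1 :: t.1, r)
  end.

Definition config : Type :=
  (states M * {ffun 'I_(extra_tapes M).+1 -> tape})%type.

Definition halted (c : config) : bool := final c.1.

Definition step (c : config) : config :=
  if halted c then c else
  let qa := transition c.1 [ffun i => scanned (c.2 i)] in
  (qa.1, [ffun i => act_on (c.2 i) (qa.2 i)]).

(* The input is on tape 0, the head on its first symbol. *)
Definition init (x : seq symbol) : config :=
  (start M, [ffun i => if i == ord0
                       then ([::], [seq Some (inl s) | s <- x])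
                       else ([::], [::])]).

Definition run (x : seq symbol) (t : nat) : config := iter t step (init x).

(* The output of a halted machine is the word on tape 0 that starts at the
   head and ends before the first blank. *)
Definition outputs (x y : seq symbol) : Prop :=
  exists t, halted (run x t) /\
    forall i, i <= size y ->
      nth None ((run x t).2 ord0).2 i = omap inl (onth y i).

Definition polynomial_time (T : Type) (enc : T -> seq symbol) : Prop :=
  exists p : {poly nat}, forall x : T,
    halted (run (enc x) (p.[size (enc x)])%R).

End Machine.

(** * Priority Knapsack Center with Outliers *)

Local Open Scope ring_scope.

(* The numerical data are rational, so that instances are finite words. *)
Record instance := Instance {
  npoints : nat;
  dist : 'I_npoints -> 'I_npoints -> rat;
  radius : 'I_npoints -> rat;
  weight : 'I_npoints -> rat;
  budget : rat;
  quota : nat;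
  dist_ge0 : forall u v, 0 <= dist u v;
  dist_eq0 : forall u v, dist u v = 0 <-> u = v;
  dist_sym : forall u v, dist u v = dist v u;
  dist_triangle : forall u v x, dist u x <= dist u v + dist v x;
  radius_gt0 : forall v, 0 < radius v;
  weight_ge0 : forall v, 0 <= weight v;
  budget_gt0 : 0 < budget
}.

Section Problem.
Variable I : instance.
Implicit Type S : {set 'I_(npoints I)}.

(* The distance to the empty set is +oo. *)
Definition dist_set (v : 'I_(npoints I)) S : \bar rat :=
  \big[Order.min/+oo%E]_(s in S) (dist v s)%:E.

Definition feasible S : Prop := \sum_(u in S) weight u <= budget I.

(* Nonnegativity of [a] only matters when [quota I = 0]: every [a] would
   otherwise qualify, and there would be no least one. *)
Definition achieves S (a : rat) : Prop :=
  0 <= a /\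
  (quota I <= #|[set v | (dist_set v S <= (a * radius v)%:E)%O]|)%N.

Definition is_value S (a : rat) : Prop :=
  achieves S a /\ forall b, achieves S b -> a <= b.

Definition is_optimum (a : rat) : Prop :=
  (exists S, feasible S /\ is_value S a) /\
  forall S b, feasible S -> is_value S b -> a <= b.

(* When no feasible set serves [quota I] points, the optimum is infinite and
   only feasibility is asked for. *)
Definition approx_solution (rho : rat) S : Prop :=
  feasible S /\
  forall opt, is_optimum opt -> exists2 a, is_value S a & a <= rho * opt.

End Problem.

(** * Binary encoding *)

(* Least significant digit first. *)
Fixpoint bits_of_pos (p : positive) : seq bool :=
  match p with
  | xH => [:: true]
  | xO q => false :: bits_of_pos q
  | xI q => true :: bits_of_pos q
  end.

Definition encode_nat (n : nat) : seq symbol :=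
  rcons (if bin_of_nat n is Npos p then map Some (bits_of_pos p) else [::])
        None.

(* No sign is needed: all the rationals of an instance are nonnegative. *)
Definition encode_rat (q : rat) : seq symbol :=
  encode_nat `|numq q|%N ++ encode_nat `|denq q|%N.

Definition encode_instance (I : instance) : seq symbol :=
  let pts := enum 'I_(npoints I) in
  encode_nat (npoints I) ++ encode_nat (quota I) ++ encode_rat (budget I) ++
  flatten [seq encode_rat (weight v) | v <- pts] ++
  flatten [seq encode_rat (radius v) | v <- pts] ++
  flatten [seq encode_rat (dist u v) | u <- pts, v <- pts].

Definition encode_set (n : nat) (S : {set 'I_n}) : seq symbol :=
  [seq Some (i \in S) | i <- enum 'I_n].

Definition approximation_algorithm (rho : rat) (M : machine) : Prop :=
  forall I : instance,
    exists2 S, outputs M (encode_instance I) (encode_set S)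
             & approx_solution (I := I) rho S.

(* Main.v *)
Require Import Defs.
From mathcomp Require Import all_boot all_order all_algebra.
From mathcomp Require Import constructive_ereal zify ring.

(* Fix a candidate value alpha = d(x, y) / r(y) and rescale so that alpha = 1.
   Points are scanned by increasing load. A point is absorbed by an earlier
   representative that conflicts with it (their balls nearly meet) and has at
   most 4 times its radius; otherwise it becomes a representative itself.
   Conflicting representatives have radii more than a factor 4 apart and form a
   forest in which the representatives of the balls that contain a given point
   lie on one path towards the root. Opening a center near a node serves every
   ancestor u within 2 r(u), hence every point x absorbed by such a u within
   14 r(x). A knapsack over the forest finds, for each number of points, the
   cheapest set of nodes that serves it.

   If the knapsack fails, the load of each representative grows by the number
   of points that it absorbed. A solution of value 1 would then cover absorbed
   weight less than m in each round, while the ordering by load keeps the squared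
   norm of the centred loads below n^2 per round, so as in the perceptron
   algorithm there are at most n^3 failures. This replaces linear programming.

   Polynomial time is established for a class of functions on trees that is
   closed under composition, pairing, case analysis and size-bounded folds,
   where a function is computed by a structured program on four stacks, itself
   compiled to a Turing machine. *)

Set Implicit Arguments.
Unset Strict Implicit.
Unset Printing Implicit Defensive.

(** A set of value 1 covers at least m points, but the knapsack counts the points whose
    representative is covered, and after an unlucky clustering these may be far fewer. No single
    order of the points is safe; what is shown is that among n^3 + 1 adaptively chosen orders at
    least one is good. A point that represents many others gains load and comes later in subsequent
    rounds, so the role of representative moves to points of smaller load.

    A conflict means distance at most r(u) + r(v) + min(r(u), r(v)), and the factor 4 is used twice.
    If x conflicts with both u and v, then d(u, v) <= 4 r(x) + r(u) + r(v), so 4 r(x) <= min(r(u),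
    r(v)) makes u and v conflict in turn; this is what yields a forest. And a center within 2 r(x)
    of x is within 4 r(x) + r(y) <= 2 r(y) of the parent y of x. Absorption then costs 2 r(u) +
    (r(u) + 2 r(x)) <= 14 r(x), because r(u) <= 4 r(x). *)

Inductive reg := Main | RegA | RegB | RegC.

Definition tape_of (X : reg) : 'I_4 :=
  match X with
  | Main => ord0 | RegA => inord 1 | RegB => inord 2 | RegC => inord 3
  end.

Definition reg_eq (X Y : reg) : bool :=
  match X, Y with
  | Main, Main | RegA, RegA | RegB, RegB | RegC, RegC => true
  | _, _ => false
  end.

Lemma tape_of_eq X Y : (tape_of X == tape_of Y) = reg_eq X Y.
Proof. by case: X; case: Y; rewrite -val_eqE /= ?inordK. Qed.

Record store := Store {
  main : seq symbol; rega : seq symbol; regb : seq symbol; regc : seq symbol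
}.

Definition get (s : store) (X : reg) : seq symbol :=
  match X with
  | Main => main s | RegA => rega s | RegB => regb s | RegC => regc s
  end.

Definition set (s : store) (X : reg) (l : seq symbol) : store :=
  let: Store m a b c := s in
  match X with
  | Main => Store l a b c | RegA => Store m l b c
  | RegB => Store m a l c | RegC => Store m a b l
  end.

Lemma get_set s X l Y : get (set s X l) Y = if reg_eq X Y then l else get s Y.
Proof. by case: s => m a b c; case: X; case: Y. Qed.

(** * Structured programs over the four stacks, with exact running times *)

Definition test := option symbol -> bool.

Inductive cmd :=
  | Skip
  | Push of reg & symbol
  | Pop of reg
  | Seq of cmd & cmd
  | If of reg & test & cmd & cmd
  | While of reg & test & cmd.

Definition top (s : store) (X : reg) : option symbol := ohead (get s X).

(** The times are the exact step counts of the compiled code: a push moves and then writes, and the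
    first branch of an [If] pays for a jump in and a jump over the second branch, which itself pays
    only for the jump in. *)
Inductive exec : cmd -> store -> nat -> store -> Prop :=
  | exec_skip s : exec Skip s 0 s
  | exec_push X a s : exec (Push X a) s 2 (set s X (a :: get s X))
  | exec_pop X s : exec (Pop X) s 1 (set s X (behead (get s X)))
  | exec_seq c1 c2 s1 t1 s2 t2 s3 :
      exec c1 s1 t1 s2 -> exec c2 s2 t2 s3 -> exec (Seq c1 c2) s1 (t1 + t2) s3
  | exec_if_true X (p : test) c1 c2 s1 t s2 :
      p (top s1 X) -> exec c1 s1 t s2 -> exec (If X p c1 c2) s1 (t + 2) s2
  | exec_if_false X (p : test) c1 c2 s1 t s2 :
      ~~ p (top s1 X) -> exec c2 s1 t s2 -> exec (If X p c1 c2) s1 t.+1 s2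
  | exec_while_true X (p : test) c s1 t1 s2 t2 s3 :
      p (top s1 X) -> exec c s1 t1 s2 -> exec (While X p c) s2 t2 s3 ->
      exec (While X p c) s1 (t1 + t2 + 2) s3
  | exec_while_false X (p : test) c s :
      ~~ p (top s X) -> exec (While X p c) s 1 s.

(** * Compilation to a Turing machine *)

Inductive instr :=
  | Act of reg & (option symbol -> option symbol) & direction
  | Jump of reg & (option symbol -> nat).

Fixpoint code_size (c : cmd) : nat :=
  match c with
  | Skip => 0
  | Push _ _ => 2
  | Pop _ => 1
  | Seq c1 c2 => code_size c1 + code_size c2
  | If _ _ c1 c2 => code_size c1 + code_size c2 + 2
  | While _ _ c => code_size c + 2
  end.

(* Jump targets are absolute addresses; [o] is the address of the first
   instruction. A push moves left (keeping the scanned symbol), then writes. *)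
Fixpoint compile (o : nat) (c : cmd) : seq instr :=
  match c with
  | Skip => [::]
  | Push X a => [:: Act X id Left; Act X (fun=> Some a) Stay]
  | Pop X => [:: Act X (fun=> None) Right]
  | Seq c1 c2 => compile o c1 ++ compile (o + code_size c1) c2
  | If X p c1 c2 =>
      let o1 := o + code_size c1 + 2 in
      Jump X (fun a => if p a then o.+1 else o1) ::
      compile o.+1 c1 ++ Jump X (fun=> o1 + code_size c2) :: compile o1 c2
  | While X p c1 =>
      Jump X (fun a => if p a then o.+1 else o + code_size c1 + 2) ::
      rcons (compile o.+1 c1) (Jump X (fun=> o))
  end.

Lemma size_compile c o : size (compile o c) = code_size c.
Proof.
elim: c o => //= [c1 IH1 c2 IH2|X p c1 IH1 c2 IH2|X p c1 IH1] o.
- by rewrite size_cat IH1 IH2.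
- by rewrite size_cat /= IH1 IH2; lia.
- by rewrite size_rcons IH1; lia.
Qed.

Definition letter (a : option (symbol + void)) : option symbol :=
  if a is Some (inl s) then Some s else None.

Definition unletter (a : option symbol) : option (symbol + void) := omap inl a.

Lemma letterK a : unletter (letter a) = a.
Proof. by case: a => [[|[]]|]. Qed.

Lemma unletterK : cancel unletter letter.
Proof. by case. Qed.

(** A state is an instruction address. The address just past the code is the only halting state;
    there alone [nth] would return its default, and there no step is taken. *)
Definition code_machine (code : seq instr) : machine :=
  @Machine 'I_(size code).+1 void 3 ord0
    (fun q => nat_of_ord q == size code)
    (fun q v =>
       match nth (Jump Main (fun=> 0)) code q with
       | Act X f d =>
           (inord q.+1,
            [ffun j => if j == tape_of X then (unletter (f (letter (v j))), d)
                       else (v j, Stay)])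
       | Jump X f => (inord (f (letter (v (tape_of X)))),
                      [ffun j => (v j, Stay)])
       end).

(** The stack grows to the left: the head scans its top and everything further left is blank. Cells
    are compared pointwise because tapes that differ by trailing blanks hold the same stack. *)
Definition holds (t : seq (option (symbol + void)) * seq (option (symbol + void)))
    (l : seq symbol) : Prop :=
  (forall i, nth None t.1 i = None) /\
  (forall i, nth None t.2 i = unletter (onth l i)).

Lemma holds_top t l : holds t l -> head None t.2 = unletter (ohead l).
Proof. by case=> _ /(_ 0); case: t.2; case: l. Qed.

Section Simulation.
Variable code : seq instr.
Let M := code_machine code.

Definition agrees (c : config M) (o : nat) (s : store) : Prop :=
  nat_of_ord c.1 = o /\ forall X, holds (c.2 (tape_of X)) (get s X).

Definition code_at (o : nat) (l : seq instr) : Prop :=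
  exists l1 l2, code = l1 ++ l ++ l2 /\ size l1 = o.

Lemma code_at_cat o l1 l2 :
  code_at o (l1 ++ l2) -> code_at o l1 /\ code_at (o + size l1) l2.
Proof.
case=> a [b [cE <-]]; split.
  by exists a, (l2 ++ b); rewrite cE !catA.
by exists (a ++ l1), b; rewrite size_cat cE !catA.
Qed.

Lemma code_at_cons o i l :
  code_at o (i :: l) -> code_at o [:: i] /\ code_at o.+1 l.
Proof. by rewrite -cat1s => /code_at_cat; rewrite addn1. Qed.

Lemma code_at_nth o i :
  code_at o [:: i] -> (o < size code)%N /\ nth (Jump Main (fun=> 0)) code o = i.
Proof.
case=> a [b [-> <-]]; rewrite !size_cat /= nth_cat ltnn subnn; split=> //; lia.
Qed.

Lemma code_at_end o l : code_at o l -> (o + size l <= size code)%N.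
Proof. by case=> a [b [-> <-]]; rewrite !size_cat; lia. Qed.

Lemma holds_stay t l : holds t l -> holds (act_on (M := M) t (scanned (M := M) t, Stay)) l.
Proof.
case: t => [a r] [h1 h2]; split=> //= i; rewrite -h2.
by case: r {h1 h2} => [|b r]; case: i => //= i; rewrite !nth_nil.
Qed.

Lemma step_jump o X f c s :
  code_at o [:: Jump X f] -> agrees c o s -> (f (top s X) <= size code)%N ->
  agrees (Defs.step c) (f (top s X)) s.
Proof.
case: c => q tp /code_at_nth[lt_o nth_o] [/= qE tpE] le_f.
rewrite /Defs.step /halted /= qE ltn_eqF // nth_o; split=> /=.
  by rewrite ffunE /= /scanned (holds_top (tpE X)) unletterK inordK.
by move=> Y; rewrite !ffunE; apply: holds_stay.
Qed.

Lemma step_act o X f d c s l :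
  code_at o [:: Act X f d] -> agrees c o s ->
  (forall t, holds t (get s X) ->
     holds (act_on (M := M) t (unletter (f (top s X)), d)) l) ->
  agrees (Defs.step c) o.+1 (set s X l).
Proof.
case: c => q tp /code_at_nth[lt_o nth_o] [/= qE tpE] act.
rewrite /Defs.step /halted /= qE ltn_eqF // nth_o; split=> /=.
  by rewrite inordK.
move=> Y; rewrite !ffunE tape_of_eq get_set.
have -> : reg_eq Y X = reg_eq X Y by case: X {nth_o act}; case: Y.
case: ifP => [XY|_]; last exact: holds_stay.
have {Y XY}<- : X = Y by case: X XY {nth_o act}; case: Y.
by rewrite /scanned (holds_top (tpE X)) unletterK; apply: act.
Qed.

Lemma step_pop o X c s :
  code_at o [:: Act X (fun=> None) Right] -> agrees c o s ->
  agrees (Defs.step c) o.+1 (set s X (behead (get s X))).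
Proof.
move=> co ag; apply: step_act co ag _ => -[a b] [h1 h2].
split=> /= i; first by case: i.
by move: (h2 i.+1); case: (b) (get s X) => [|? ?] [|? ?]; rewrite /= ?nth_nil ?onth0n.
Qed.

Lemma step_push o X a c s :
  code_at o [:: Act X id Left; Act X (fun=> Some a) Stay] -> agrees c o s ->
  agrees (iter 2 (@Defs.step M) c) o.+2 (set s X (a :: get s X)).
Proof.
case: c => q tp /code_at_cons[/code_at_nth[lt_o nth_o] /code_at_nth[lt_o1 nth_o1]].
case=> /= qE tpE; rewrite /= {2}/Defs.step /halted /= qE ltn_eqF // nth_o.
rewrite /Defs.step /halted /= inordK // ltn_eqF // nth_o1.
split=> /=; first by rewrite inordK.
move=> Y; rewrite !ffunE tape_of_eq get_set.
have -> : reg_eq Y X = reg_eq X Y by case: X {nth_o nth_o1}; case: Y.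
case: ifP => [XY|_]; last by do 2!apply: holds_stay.
have {Y XY}<- : X = Y by case: X XY {nth_o nth_o1}; case: Y.
case: (tpE X) => h1 h2; rewrite /scanned letterK.
split=> /= i; first by move: (h1 i.+1); case: (_.1) => [|? ?] //=; rewrite nth_nil.
case: i => [|[|i]] //=; first by rewrite (holds_top (tpE X)); case: (get s X).
by move: (h2 i.+1); case: (_.2) (get s X) => [|? ?] [|? ?]; rewrite /= ?nth_nil ?onth0n.
Qed.

(** The induction is on the execution, not on the command, so that a [While] can refer to its own
    later iterations. The offset stays general because jump targets are absolute. *)
Lemma compile_sim c s1 t s2 : exec c s1 t s2 -> forall o k,
  code_at o (compile o c) -> agrees k o s1 ->
  agrees (iter t (@Defs.step M) k) (o + code_size c) s2.
Proof.
elim=> {c s1 t s2} /=.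
- by move=> s o k _ ag; rewrite addn0.
- by move=> X a s o k co ag; rewrite addn2; apply: step_push co ag.
- by move=> X s o k co ag; rewrite addn1; apply: step_pop co ag.
- move=> c1 c2 s1 t1 s2 t2 s3 _ IH1 _ IH2 o k /code_at_cat[].
  rewrite size_compile => co1 co2 ag; rewrite addnC iterD addnA.
  exact: IH2 co2 (IH1 _ _ co1 ag).
- move=> X p c1 c2 s1 t s2 pt _ IH o k co ag; have:= code_at_end co.
  case: (code_at_cons co) => coJ /code_at_cat[co1 /code_at_cons[coJ2 _]].
  rewrite /= size_cat /= !size_compile => sz.
  have -> : (t + 2 = 1 + (t + 1))%N by lia.
  rewrite !iterD.
  have := step_jump coJ ag; rewrite pt => /(_ ltac:(lia)) /(IH _ _ co1) ag1.
  rewrite addSn size_compile in ag1 coJ2.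
  have := step_jump coJ2 ag1 => /(_ ltac:(lia)).
  by congr (agrees _ _); lia.
- move=> X p c1 c2 s1 t s2 /negbTE pt _ IH o k co ag; have:= code_at_end co.
  case: (code_at_cons co) => coJ /code_at_cat[_ /code_at_cons[_ co2]].
  rewrite /= size_cat /= !size_compile => sz; rewrite -iterS iterSr.
  have := step_jump coJ ag; rewrite pt => /(_ ltac:(lia)) ag1.
  rewrite size_compile in co2.
  have e : (o.+1 + code_size c1).+1 = o + code_size c1 + 2 by lia.
  rewrite e in co2.
  by have := IH _ _ co2 ag1; congr (agrees _ _); lia.
- move=> X p c s1 t1 s2 t2 s3 pt _ IH1 _ IH2 o k co ag; have:= code_at_end co.
  case: (code_at_cons co); rewrite -cats1 => coJ /code_at_cat[co1 coJ2].
  rewrite /= size_cat !size_compile /= => sz.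
  have -> : (t1 + t2 + 2 = t2 + (1 + (t1 + 1)))%N by lia.
  rewrite !iterD; apply: IH2 => //.
  have := step_jump coJ ag; rewrite pt => /(_ ltac:(lia)) /(IH1 _ _ co1) ag1.
  rewrite size_compile in coJ2.
  by have := step_jump coJ2 ag1 => /(_ ltac:(lia)).
- move=> X p c s /negbTE pt o k co ag; have:= code_at_end co.
  case: (code_at_cons co) => coJ _; rewrite /= size_rcons size_compile => sz.
  by have := step_jump coJ ag; rewrite pt => /(_ ltac:(lia)); rewrite addnA.
Qed.

End Simulation.

Definition machine_of (c : cmd) : machine := code_machine (compile 0 c).

Lemma machine_of_run c (x : seq symbol) t s :
  exec c (Store x [::] [::] [::]) t s ->
  halted (run (machine_of c) x t) /\
  forall i, nth None ((run (machine_of c) x t).2 ord0).2 i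
            = omap inl (onth (main s) i).
Proof.
move=> ex; have co : code_at (compile 0 c) 0 (compile 0 c).
  by exists [::], [::]; rewrite cats0.
have ag : agrees (init (machine_of c) x) 0 (Store x [::] [::] [::]).
  split=> // X; rewrite ffunE (_ : ord0 = tape_of Main) // tape_of_eq.
  case: X => /=; split=> i; rewrite ?nth_nil ?onth0n //=.
  elim: x {ex co} i => [|a x IH] [|i] //=.
have [q tpE] := compile_sim ex co ag; split.
  by rewrite /halted /= q size_compile eqxx.
by move=> i; case: (tpE Main) => _ /(_ i).
Qed.

Lemma iter_step_halted (M : machine) (c : config M) t :
  halted c -> iter t (@Defs.step M) c = c.
Proof. by move=> hc; elim: t => //= t ->; rewrite /Defs.step hc. Qed.

Lemma run_halted (M : machine) x t u :
  (t <= u)%N -> halted (run M x t) -> halted (run M x u).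
Proof. by move=> /subnK <- h; rewrite /run iterD iter_step_halted. Qed.

Definition runs (c : cmd) (s : store) (n : nat) (s' : store) : Prop :=
  exists2 t, t <= n & exec c s t s'.

Lemma runs_weaken c s n n' s' : runs c s n s' -> n <= n' -> runs c s n' s'.
Proof. by case=> t le_t ex le_n; exists t => //; apply: leq_trans le_n. Qed.

Lemma runs_push X a s : runs (Push X a) s 2 (set s X (a :: get s X)).
Proof. by exists 2 => //; apply: exec_push. Qed.

Lemma runs_pop X s : runs (Pop X) s 1 (set s X (behead (get s X))).
Proof. by exists 1 => //; apply: exec_pop. Qed.

Lemma runs_seq c1 c2 s1 n1 s2 n2 s3 :
  runs c1 s1 n1 s2 -> runs c2 s2 n2 s3 -> runs (Seq c1 c2) s1 (n1 + n2) s3.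
Proof.
move=> [t1 le1 ex1] [t2 le2 ex2]; exists (t1 + t2); first exact: leq_add.
exact: exec_seq ex1 ex2.
Qed.

Lemma runs_if_true X (p : test) c1 c2 s1 n s2 :
  p (top s1 X) -> runs c1 s1 n s2 -> runs (If X p c1 c2) s1 (n + 2) s2.
Proof.
move=> pt [t le_t ex]; exists (t + 2); first by rewrite leq_add2r.
exact: exec_if_true.
Qed.

Lemma runs_if_false X (p : test) c1 c2 s1 n s2 :
  ~~ p (top s1 X) -> runs c2 s1 n s2 -> runs (If X p c1 c2) s1 (n + 2) s2.
Proof.
move=> pt [t le_t ex]; exists t.+1; first by lia.
exact: exec_if_false.
Qed.

Lemma runs_while_true X (p : test) c s1 n1 s2 n2 s3 :
  p (top s1 X) -> runs c s1 n1 s2 -> runs (While X p c) s2 n2 s3 ->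
  runs (While X p c) s1 (n2 + n1 + 2) s3.
Proof.
move=> pt [t1 le1 ex1] [t2 le2 ex2]; exists (t1 + t2 + 2); first by lia.
exact: exec_while_true pt ex1 ex2.
Qed.

Lemma runs_while_false X (p : test) c s :
  ~~ p (top s X) -> runs (While X p c) s 1 s.
Proof. by exists 1 => //; apply: exec_while_false. Qed.

Definition store_size (s : store) : nat :=
  size (main s) + size (rega s) + size (regb s) + size (regc s).

(** A unit of time adds at most one symbol. This is how a time bound also bounds the size of the
    output. *)
Lemma runs_size c s n s' : runs c s n s' -> store_size s' <= store_size s + n.
Proof.
case=> t le_t ex; apply: (@leq_trans (store_size s + t)); last by rewrite leq_add2l.
elim: ex {le_t} => {c s t s'}.
- by move=> s; rewrite addn0.
- by move=> X a s; case: X s => -[? ? ? ?]; rewrite /store_size /=; lia.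
- by move=> X s; case: X s => -[? ? ? ?]; rewrite /store_size /= size_behead; lia.
all: by intros; lia.
Qed.

(** * Trees on a stack, in prefix notation *)

Inductive tree := Leaf | Node of tree & tree.

Fixpoint tree_bits (t : tree) : seq bool :=
  if t is Node l r then true :: tree_bits l ++ tree_bits r else [:: false].

Definition tree_word (t : tree) : seq symbol := map Some (tree_bits t).

Lemma tree_word_node l r :
  tree_word (Node l r) = Some true :: tree_word l ++ tree_word r.
Proof. by rewrite /tree_word /= map_cat. Qed.

Definition tree_size (t : tree) : nat := size (tree_bits t).

Lemma size_tree_word t : size (tree_word t) = tree_size t.
Proof. by rewrite size_map. Qed.

Lemma tree_size_gt0 t : 0 < tree_size t.
Proof. by case: t. Qed.

Lemma tree_size_node l r : tree_size (Node l r) = (tree_size l + tree_size r).+1.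
Proof. by rewrite /tree_size /= size_cat. Qed.

Definition is_true_top : test := fun a => a == Some (Some true).
Definition nonempty : test := isSome.

Definition scratch (b : bool) : reg := if b then RegA else RegB.

Definition scratch_store (b : bool) m x y c : store :=
  if b then Store m x y c else Store m y x c.

(* Register C counts, in unary, the trees that remain to be moved. *)
Definition move_loop (b : bool) : cmd :=
  While RegC nonempty (If Main is_true_top
    (Seq (Pop Main) (Seq (Push (scratch b) (Some true)) (Push RegC (Some true))))
    (Seq (Pop Main) (Seq (Push (scratch b) (Some false)) (Pop RegC)))).

Definition move (b : bool) : cmd := Seq (Push RegC (Some true)) (move_loop b).

(** Stated with the rest of the loop as a hypothesis: the two subtrees of a node are moved within
    one and the same loop, with no exit between them, so the induction has to chain through whatever
    the loop does next. *)
Lemma runs_move_loop b t m x y c n s' :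
  runs (move_loop b) (scratch_store b m (catrev (tree_word t) x) y c) n s' ->
  runs (move_loop b)
    (scratch_store b (tree_word t ++ m) x y (Some true :: c))
    (n + 9 * tree_size t) s'.
Proof.
elim: t m x y c n s' => [|l IHl r IHr] m x y c n s' H.
  apply: (runs_weaken (n := n + (1 + (2 + 1) + 2) + 2)); last by rewrite mulnS; lia.
  apply: (runs_while_true _ _ H); first by case: (b).
  apply: runs_if_false; first by case: (b).
  apply: runs_seq (runs_pop _ _) _; apply: runs_seq (runs_push _ _ _) _.
  have := runs_pop RegC (scratch_store b m (Some false :: x) y (Some true :: c)).
  by case: (b).
rewrite tree_size_node tree_word_node.
apply: (runs_weaken
  (n := n + 9 * tree_size r + 9 * tree_size l + (1 + (2 + 2) + 2) + 2)); last by lia.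
apply: (runs_while_true (s2 := scratch_store b (tree_word l ++ tree_word r ++ m)
   (Some true :: x) y (Some true :: Some true :: c))); first by case: (b).
  apply: runs_if_true; first by case: (b).
  apply: runs_seq (runs_pop _ _) _; apply: runs_seq (runs_push _ _ _) _.
  have := runs_push RegC (Some true) (scratch_store b (tree_word l ++ tree_word r ++ m)
    (Some true :: x) y (Some true :: c)).
  by case: (b); rewrite /= ?catA.
apply: IHl; apply: IHr; rewrite tree_word_node /= in H.
by move: H; rewrite !catrevE rev_cat catA.
Qed.

Lemma runs_move b t m y :
  runs (move b) (scratch_store b (tree_word t ++ m) [::] y [::])
    (9 * tree_size t + 3) (scratch_store b m (rev (tree_word t)) y [::]).
Proof.
apply: (runs_weaken (n := 2 + (1 + 9 * tree_size t))); last by lia.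
apply: (runs_seq (s2 := scratch_store b (tree_word t ++ m) [::] y [:: Some true])).
  have := runs_push RegC (Some true) (scratch_store b (tree_word t ++ m) [::] y [::]).
  by case: (b).
by apply: runs_move_loop; apply: runs_while_false; case: (b).
Qed.

Definition drain (X : reg) (push : bool -> cmd) : cmd :=
  While X nonempty (Seq (If X is_true_top (push true) (push false)) (Pop X)).

(** [S x d] is the store in which [x] is still to be read from [X] and [d] has been accumulated,
    wherever [push] puts it. *)
Lemma runs_drain (X : reg) push k (S : seq symbol -> seq symbol -> store) :
  (forall x d, get (S x d) X = x) ->
  (forall a x d, runs (push a) (S x d) k (S x (Some a :: d))) ->
  (forall a x d, set (S (a :: x) d) X x = S x d) ->
  forall (w : seq bool) d,
  runs (drain X push) (S (map Some w) d) (size w * (k + 5) + 1)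
    (S [::] (catrev (map Some w) d)).
Proof.
move=> gS pS sS; elim=> [|a w IH] d.
  by apply: runs_while_false; rewrite /top gS.
apply: (runs_weaken (n := size w * (k + 5) + 1 + (k + 2 + 1) + 2)); last first.
  by rewrite /= mulSn; lia.
apply: runs_while_true (IH _); first by rewrite /top gS.
apply: (runs_seq (s2 := S (map Some (a :: w)) (Some a :: d))); last first.
  by have := runs_pop X (S (map Some (a :: w)) (Some a :: d)); rewrite gS /= sS.
by case: a; [apply: runs_if_true | apply: runs_if_false]; rewrite /top ?gS.
Qed.

Definition unmove (b : bool) : cmd :=
  drain (scratch b) (fun a => Push Main (Some a)).

Lemma runs_unmove b (w : seq bool) m y :
  runs (unmove b) (scratch_store b m (rev (map Some w)) y [::])
    (size w * 7 + 1) (scratch_store b (map Some w ++ m) [::] y [::]).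
Proof.
rewrite -map_rev -(size_rev w).
have -> : map Some w ++ m = catrev (map Some (rev w)) m.
  by rewrite catrevE -map_rev revK.
apply: (runs_drain (k := 2) (S := fun x d => scratch_store b d x y [::])).
- by case: (b).
- by move=> a x d; have := runs_push Main (Some a) (scratch_store b d x y [::]); case: (b).
- by case: (b).
Qed.

Definition st (m : seq symbol) : store := Store m [::] [::] [::].

Definition drop_tree : cmd := Seq (move true) (While RegA nonempty (Pop RegA)).

Lemma runs_drop t m :
  runs drop_tree (st (tree_word t ++ m)) (14 * tree_size t + 4) (st m).
Proof.
apply: (runs_weaken (n := 9 * tree_size t + 3 + (3 * tree_size t + 1))); last by lia.
apply: runs_seq (runs_move true t m [::]) _ => /=.
rewrite -size_tree_word -size_rev; elim: (rev _) => [|a w IH].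
  exact: runs_while_false.
apply: (runs_weaken (n := 3 * size w + 1 + 1 + 2)); last by rewrite /=; lia.
by apply: runs_while_true IH => //; apply: runs_pop.
Qed.

Definition swap_trees : cmd :=
  Seq (move true) (Seq (move false) (Seq (unmove true) (unmove false))).

Lemma runs_swap t u m :
  runs swap_trees (st (tree_word t ++ tree_word u ++ m))
    (16 * (tree_size t + tree_size u) + 8) (st (tree_word u ++ tree_word t ++ m)).
Proof.
apply: (runs_weaken (n := 9 * tree_size t + 3 + (9 * tree_size u + 3 +
  (tree_size t * 7 + 1 + (tree_size u * 7 + 1))))); last by lia.
apply: runs_seq (runs_move true t _ [::]) _ => /=.
apply: runs_seq (runs_move false u _ _) _ => /=.
apply: runs_seq (runs_unmove true _ _ _) _ => /=.
exact: (runs_unmove false).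
Qed.

(** Moving to register A reverses the word. Draining A restores the tree on [Main] and leaves an
    upright copy on B, which has to be reversed once more through A before it can be put on top. *)
Definition dup_tree : cmd :=
  Seq (move true)
  (Seq (drain RegA (fun a => Seq (Push Main (Some a)) (Push RegB (Some a))))
  (Seq (drain RegB (fun a => Push RegA (Some a))) (unmove true))).

Lemma runs_dup t m :
  runs dup_tree (st (tree_word t ++ m)) (32 * tree_size t + 6)
    (st (tree_word t ++ tree_word t ++ m)).
Proof.
apply: (runs_weaken (n := 9 * tree_size t + 3 + (tree_size t * (4 + 5) + 1 +
  (tree_size t * (2 + 5) + 1 + (tree_size t * 7 + 1))))); last by lia.
apply: runs_seq (runs_move true t _ [::]) _ => /=.
set w := tree_bits t; have sz : tree_size t = size (rev w) by rewrite size_rev.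
apply: (runs_seq (s2 := Store (tree_word t ++ m) [::] (tree_word t) [::])).
  rewrite {1}/tree_word -map_rev sz -/w.
  have -> : Store (tree_word t ++ m) [::] (tree_word t) [::]
    = Store (catrev (map Some (rev w)) [::] ++ m) [::]
            (catrev (map Some (rev w)) [::]) [::].
    by rewrite catrevE cats0 -map_rev revK.
  apply: (@runs_drain _ _ 4 (fun x d => Store (d ++ m) x d [::]) _ _ _ (rev w) [::]) => // a x d.
  exact: runs_seq (runs_push _ _ _) (runs_push _ _ _).
apply: (runs_seq (s2 := Store (tree_word t ++ m) (rev (tree_word t)) [::] [::])).
  apply: (@runs_drain _ _ 2 (fun x d => Store (tree_word t ++ m) d x [::])
    _ _ _ w [::]) => // a x d; exact: runs_push.
exact: (runs_unmove true).
Qed.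

(** * Polynomial-time functions *)

Class code (T : Type) := encode : T -> tree.
Arguments encode {T _} x.

#[global] Instance code_unit : code unit := fun=> Leaf.
#[global] Instance code_prod {T U} {cT : code T} {cU : code U} : code (T * U) :=
  fun p => Node (encode p.1) (encode p.2).
#[global] Instance code_seq {T} {cT : code T} : code (seq T) :=
  foldr (fun y t => Node (encode y) t) Leaf.
(** Unary, hence the encoding of a list of units. The type [nat] is for indices, counters and loads;
    the numerical data are kept as lists of bits. *)
#[global] Instance code_nat : code nat := fun n => iter n (Node Leaf) Leaf.
#[global] Instance code_bool : code bool :=
  fun b => if b then Node Leaf Leaf else Leaf.
#[global] Instance code_option {T} {cT : code T} : code (option T) :=
  fun o => if o is Some y then Node (encode y) Leaf else Leaf.

Definition esize {T} {cT : code T} (x : T) : nat := tree_size (encode x).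

Definition word {T} {cT : code T} (x : T) : seq symbol := tree_word (encode x).

Lemma esize_pair {X Y} {cX : code X} {cY : code Y} (x : X) (y : Y) :
  esize (x, y) = (esize x + esize y).+1.
Proof. exact: tree_size_node. Qed.

Lemma esize_cons {X} {cX : code X} (x : X) s :
  esize (x :: s) = (esize x + esize s).+1.
Proof. exact: tree_size_node. Qed.

Lemma word_pair {X Y} {cX : code X} {cY : code Y} (x : X) (y : Y) :
  word (x, y) = Some true :: word x ++ word y.
Proof. exact: tree_word_node. Qed.

(** The base is larger than 1, so a single exponent absorbs constants, sums and products. *)
Definition polyb {X} {cX : code X} (g : X -> nat) : Prop :=
  exists k, forall x, g x <= (esize x + 2) ^ k.

(** The rest [m] of the stack is arbitrary and survives, so intermediate results can wait below the
    argument; pairing and folding rest on this. *)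
Definition ptime {X Y} {cX : code X} {cY : code Y} (f : X -> Y) : Prop :=
  exists c, exists2 n, polyb n & forall x m,
    runs c (st (word x ++ m)) (n x) (st (word (f x) ++ m)).

Section Bounds.
Context {X : Type} {cX : code X}.
Implicit Types g h : X -> nat.

Lemma polyb_le g h : polyb h -> (forall x, g x <= h x) -> polyb g.
Proof. by case=> k hk le; exists k => x; apply: leq_trans (hk x). Qed.

Lemma polyb_const n : polyb (fun _ : X => n).
Proof.
exists n => x; apply: leq_trans (ltnW (ltn_expl n (ltnSn 1))) _.
by case: n => // n; rewrite leq_exp2r // leq_addl.
Qed.

Lemma polyb_esize : polyb (fun x : X => esize x).
Proof. by exists 1 => x; rewrite expn1 leq_addr. Qed.

Lemma polyb_mul g h : polyb g -> polyb h -> polyb (fun x => g x * h x).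
Proof.
by case=> k gk [l hl]; exists (k + l) => x; rewrite expnD leq_mul.
Qed.

Lemma polyb_add g h : polyb g -> polyb h -> polyb (fun x => g x + h x).
Proof.
case=> k gk [l hl]; exists (k + l).+1 => x; rewrite expnS.
have le1 : (esize x + 2) ^ k <= (esize x + 2) ^ (k + l) by rewrite leq_pexp2l ?addn2 ?leq_addr.
have le2 : (esize x + 2) ^ l <= (esize x + 2) ^ (k + l) by rewrite leq_pexp2l ?addn2 ?leq_addl.
apply: leq_trans (leq_add (leq_trans (gk x) le1) (leq_trans (hl x) le2)) _.
by rewrite addnn -mul2n leq_mul2r leq_addl orbT.
Qed.

Lemma polyb_exp g k : polyb g -> polyb (fun x => g x ^ k).
Proof.
case=> l gl; exists (l * k) => x; rewrite expnM.
by case: k => // k; rewrite leq_exp2r.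
Qed.

End Bounds.

Lemma polyb_size {X Y} {cX : code X} {cY : code Y} (f : X -> Y) :
  ptime f -> polyb (fun x => esize (f x)).
Proof.
case=> c [n nP run]; apply: polyb_le (polyb_add polyb_esize nP) _ => x.
have := runs_size (run x [::]).
by rewrite /store_size /= !addn0 !size_cat !addn0 !size_tree_word.
Qed.

Lemma polyb_comp {X Y} {cX : code X} {cY : code Y} (f : X -> Y) (g : Y -> nat) :
  polyb g -> ptime f -> polyb (fun x => g (f x)).
Proof.
case=> k gk /polyb_size fP.
exact: polyb_le (polyb_exp k (polyb_add fP (polyb_const 2))) (fun x => gk (f x)).
Qed.

Section Basic.
Context {X Y Z T : Type} {cX : code X} {cY : code Y} {cZ : code Z} {cT : code T}.

Lemma ptime_ext (f g : X -> Y) : ptime f -> f =1 g -> ptime g.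
Proof. by case=> c [n nP run] e; exists c, n => // x m; rewrite -e. Qed.

(** Changing the type without changing the encoding is free. Naturals, booleans and options thereby
    inherit the operations on lists. *)
Lemma ptime_recode (f : X -> Y) (g : X -> Z) :
  ptime f -> (forall x, encode (f x) = encode (g x)) -> ptime g.
Proof.
by case=> c [n nP run] e; exists c, n => // x m; have := run x m; rewrite /word e.
Qed.

Lemma ptime_id : ptime (fun x : X => x).
Proof.
exists Skip, (fun=> 0) => [|x m]; first exact: polyb_const.
by exists 0 => //; apply: exec_skip.
Qed.

Lemma ptime_comp (f : X -> Y) (g : Y -> Z) :
  ptime g -> ptime f -> ptime (fun x => g (f x)).
Proof.
move=> [d [n' nP' run']] fP; have [c [n nP run]] := fP.
exists (Seq c d), (fun x => n x + n' (f x)) => [|x m].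
  by apply: polyb_add => //; apply: polyb_comp fP.
exact: runs_seq (run x m) (run' (f x) m).
Qed.

Fixpoint push_word (w : seq bool) : cmd :=
  if w is a :: w' then Seq (push_word w') (Push Main (Some a)) else Skip.

Lemma runs_push_word w m :
  runs (push_word w) (st m) (2 * size w) (st (map Some w ++ m)).
Proof.
elim: w => [|a w IH]; first by exists 0 => //; apply: exec_skip.
by rewrite /= mulnS addnC; apply: runs_seq IH _; apply: runs_push.
Qed.

Lemma ptime_const (y : Y) : ptime (fun _ : X => y).
Proof.
exists (Seq drop_tree (push_word (tree_bits (encode y)))),
  (fun x => 14 * esize x + 4 + 2 * esize y) => [|x m].
  by do ![apply: polyb_add | apply: polyb_mul | apply: polyb_const | apply: polyb_esize].
exact: runs_seq (runs_drop _ _) (runs_push_word _ _).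
Qed.

Lemma ptime_pair (f : X -> Y) (g : X -> Z) :
  ptime f -> ptime g -> ptime (fun x => (f x, g x)).
Proof.
move=> fP gP; have [c [n nP run]] := fP; have [d [n' nP' run']] := gP.
exists (Seq dup_tree (Seq c (Seq swap_trees (Seq d (Seq swap_trees (Push Main (Some true))))))),
  (fun x => 32 * esize x + 6 + (n x + (16 * (esize (f x) + esize x) + 8 +
     (n' x + (16 * (esize (g x) + esize (f x)) + 8 + 2))))) => [|x m].
  by repeat first [apply: polyb_add | apply: polyb_mul | apply: polyb_const
    | apply: polyb_esize | apply: polyb_size fP | apply: polyb_size gP | done].
apply: runs_seq (runs_dup _ _) _; apply: runs_seq (run x _) _.
apply: runs_seq (runs_swap _ _ _) _; apply: runs_seq (run' x _) _.
apply: runs_seq (runs_swap _ _ _) _.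
by rewrite word_pair /= -catA; apply: runs_push.
Qed.

Lemma ptime_fst_aux : ptime (fun p : X * Y => p.1).
Proof.
exists (Seq (Pop Main) (Seq swap_trees drop_tree)),
  (fun p => 1 + (16 * (esize p + esize p) + 8 + (14 * esize p + 4))) => [|[x y] m].
  by do ![apply: polyb_add | apply: polyb_mul | apply: polyb_const | apply: polyb_esize].
rewrite word_pair /=; apply: runs_seq (runs_pop _ _) _ => /=.
rewrite -catA; apply: runs_weaken (runs_seq (runs_swap _ _ _) (runs_drop _ _)) _.
by rewrite esize_pair /esize /=; lia.
Qed.

Lemma ptime_snd_aux : ptime (fun p : X * Y => p.2).
Proof.
exists (Seq (Pop Main) drop_tree), (fun p => 1 + (14 * esize p + 4)) => [|[x y] m].
  by do ![apply: polyb_add | apply: polyb_mul | apply: polyb_const | apply: polyb_esize].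
rewrite word_pair /=; apply: runs_seq (runs_pop _ _) _ => /=.
rewrite -catA; apply: runs_weaken (runs_drop _ _) _.
by rewrite esize_pair /esize /=; lia.
Qed.

(** A nonempty list has the same encoding as the pair of its head and tail. Its first bit decides
    the case, and after a swap one more pushed bit forms the argument of [g]. *)
Lemma ptime_case (l : X -> seq Y) (f : X -> Z) (g : X * (Y * seq Y) -> Z) :
  ptime l -> ptime f -> ptime g ->
  ptime (fun x => if l x is y :: s then g (x, (y, s)) else f x).
Proof.
move=> lP; have [b [n0 nP0 run0]] := lP.
move=> [c [n nP run]] [d [n' [k n'k] run']].
exists (Seq dup_tree (Seq b (If Main is_true_top
   (Seq swap_trees (Seq (Push Main (Some true)) d)) (Seq (Pop Main) c)))),
  (fun x => 32 * esize x + 6 + (n0 x + (16 * (esize (l x) + esize x) + 8 +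
    (2 + (1 + esize x + esize (l x) + 2) ^ k) + (1 + n x) + 2))) => [|x m].
  by repeat first [apply: polyb_add | apply: polyb_mul | apply: polyb_const
    | apply: polyb_esize | apply: polyb_size lP | apply: polyb_exp | done].
apply: runs_seq (runs_dup _ _) _; apply: runs_seq (run0 x _) _.
case E: (l x) => [|y s] /=.
  apply: runs_if_false => //.
  apply: (runs_weaken (n := 1 + n x)); last by lia.
  apply: runs_seq (runs_pop _ _) _ => /=; exact: (run x m).
apply: runs_if_true => //.
apply: (runs_weaken (n := 16 * (esize (y :: s) + esize x) + 8 +
  (2 + n' (x, (y, s))))); last first.
  have := n'k (x, (y, s)).
  have -> : esize (x, (y, s)) = 1 + esize x + esize (y :: s).
    by rewrite esize_pair.
  lia.
apply: runs_seq (runs_swap (encode (y :: s)) _ _) _.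
apply: runs_seq (runs_push _ _ _) _ => /=.
by have := run' (x, (y, s)) m; rewrite word_pair /= -catA.
Qed.

End Basic.

Lemma ptime_fst {X Y Z} {cX : code X} {cY : code Y} {cZ : code Z} (f : X -> Y * Z) :
  ptime f -> ptime (fun x => (f x).1).
Proof. exact: (ptime_comp ptime_fst_aux). Qed.

Lemma ptime_snd {X Y Z} {cX : code X} {cY : code Y} {cZ : code Z} (f : X -> Y * Z) :
  ptime f -> ptime (fun x => (f x).2).
Proof. exact: (ptime_comp ptime_snd_aux). Qed.

Lemma size_le_esize {X} {cX : code X} (s : seq X) : size s <= esize s.
Proof. by elim: s => // x s IH; rewrite esize_cons /=; lia. Qed.

Section Fold.
Context {X Y A : Type} {cX : code X} {cY : code Y} {cA : code A}.
Variables (l : X -> seq Y) (a : X -> A) (F : X -> A -> Y -> A) (q : X -> nat).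

(** A step that is merely polynomial could square the accumulator each time, so a polynomial bound
    on every intermediate accumulator has to be supplied. *)
Lemma ptime_foldl :
  ptime l -> ptime a -> ptime (fun z : X * A * Y => F z.1.1 z.1.2 z.2) ->
  polyb q -> (forall x k, esize (foldl (F x) (a x) (take k (l x))) <= q x) ->
  ptime (fun x => foldl (F x) (a x) (l x)).
Proof.
move=> lP aP FP qP qF.
have [b [n0 nP0 run0]] := ptime_pair lP (ptime_pair aP ptime_id).
have [d [nd [k ndk] run']] : ptime (fun z : (Y * seq Y) * (A * X) =>
    (z.1.2, (F z.2.2 z.2.1 z.1.1, z.2.2))).
  apply: ptime_pair; first exact: ptime_snd (ptime_fst ptime_id).
  apply: ptime_pair; last exact: ptime_snd (ptime_snd ptime_id).
  apply: (ptime_comp (g := fun z : X * A * Y => F z.1.1 z.1.2 z.2)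
    (f := fun z : (Y * seq Y) * (A * X) => (z.2.2, z.2.1, z.1.1)) FP).
  apply: ptime_pair (ptime_fst (ptime_fst ptime_id)).
  exact: ptime_pair (ptime_snd (ptime_snd ptime_id)) (ptime_fst (ptime_snd ptime_id)).
have [e [ne [k' nek] run'']] := @ptime_fst_aux A X _ _.
(* The stack holds the remaining list above the pair of accumulator and parameter. Pushing a bit
   turns the two into the argument of [d], and popping the leading bit of its result restores this
   shape. *)
pose body := Seq (Push Main (Some true)) (Seq d (Pop Main)).
pose (bound := fun x : X => (esize (l x) + q x + esize x + 4) ^ k).
pose (bound' := fun x : X => (q x + esize x + 4) ^ k').
exists (Seq b (Seq (Pop Main) (Seq (While Main is_true_top body) (Seq (Pop Main) e)))),
  (fun x => n0 x + (1 + (esize (l x) * (bound x + 5) + 1 + (1 + bound' x)))) => [|x m].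
  have lP' := polyb_size lP.
  by repeat first [apply: polyb_add | apply: polyb_mul | apply: polyb_const
    | apply: polyb_esize | apply: polyb_exp | done].
apply: runs_seq (run0 x m) _; rewrite word_pair.
apply: runs_seq (runs_pop _ _) _ => /=.
set r := foldl _ _ _.
apply: (runs_seq (s2 := st (word ([::] : seq Y) ++ word (r, x) ++ m))); last first.
  apply: runs_seq (runs_pop _ _) _; apply: runs_weaken (run'' (r, x) m) _.
  apply: leq_trans (nek _) _; rewrite /bound' esize_pair.
  have := qF x (size (l x)); rewrite take_size -/r => le_q.
  by case: (k') => // k1; rewrite leq_exp2r //; lia.
apply: (runs_weaken (n := size (l x) * (bound x + 5) + 1)); last first.
  by rewrite leq_add2r leq_mul2r size_le_esize orbT.
rewrite -catA; have loop s s0 : l x = s0 ++ s ->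
    runs (While Main is_true_top body)
      (st (word s ++ word (foldl (F x) (a x) s0, x) ++ m))
      (size s * (bound x + 5) + 1) (st (word ([::] : seq Y) ++ word (r, x) ++ m)).
  2: exact: (loop (l x) [::] erefl).
elim: s s0 => [|y s IH] s0 def_l.
  by rewrite /r def_l cats0; apply: runs_while_false.
apply: (runs_weaken (n := size s * (bound x + 5) + 1 + (2 + (bound x + 1)) + 2)).
  apply: runs_while_true => //; last first.
    by have := IH (rcons s0 y); rewrite cat_rcons foldl_rcons; apply.
  apply: runs_seq (runs_push _ _ _) _ => /=.
  set z := foldl (F x) (a x) s0.
  apply: (runs_seq (s2 := st (word (s, (F x z y, x)) ++ m))); last first.
    by rewrite word_pair /= -catA; apply: runs_pop.
  have := run' ((y, s), (z, x)) m; rewrite word_pair /= -catA => run1; apply: runs_weaken run1 _.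
  apply: leq_trans (ndk _) _; rewrite /bound !esize_pair.
  have le_q : esize z <= q x.
    by have := qF x (size s0); rewrite def_l take_size_cat.
  have : esize (y :: s) <= esize (l x).
    rewrite def_l; elim: (s0) => //= y' s' le_s; rewrite (leq_trans le_s) //.
    by rewrite esize_cons; lia.
  rewrite esize_cons => le_l.
  by case: (k) => // k1; rewrite leq_exp2r //; lia.
by rewrite /= mulSn; lia.
Qed.

End Fold.

(** * Polynomial-time list processing *)

Lemma encode_nat_nseq (n : nat) : encode n = encode (nseq n tt).
Proof. by elim: n => //= n IH; congr Node. Qed.

Lemma encode_bool_nseq (b : bool) : encode b = encode (nseq b tt).
Proof. by case: b. Qed.

Lemma esize_nat (n : nat) : esize n = n.*2.+1.
Proof.
elim: n => // n IH; rewrite -[LHS]/(tree_size (Node Leaf (encode n))).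
by rewrite tree_size_node -/(esize n) IH doubleS.
Qed.

Lemma esize_bool (b : bool) : esize b <= 3.
Proof. by case: b. Qed.

Lemma esize_gt0 {X} {cX : code X} (x : X) : 0 < esize x.
Proof. exact: tree_size_gt0. Qed.

Lemma esize_nil {X} {cX : code X} : esize ([::] : seq X) = 1.
Proof. by []. Qed.

Lemma esize_cat {X} {cX : code X} (s t : seq X) :
  esize (s ++ t) + 1 = esize s + esize t.
Proof. by elim: s => [|x s IH]; rewrite ?cat0s ?cat_cons ?esize_nil ?esize_cons; lia. Qed.

Lemma esize_rcons {X} {cX : code X} (s : seq X) x :
  esize (rcons s x) = (esize s + esize x).+1.
Proof. by apply: (@addIn 1); rewrite -cats1 esize_cat esize_cons esize_nil; lia. Qed.

Lemma esize_take {X} {cX : code X} k (s : seq X) : esize (take k s) <= esize s.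
Proof. by elim: s k => // x s IH [|k] //=; rewrite !esize_cons ?esize_nil ?ltnS ?leq_add. Qed.

Lemma esize_drop {X} {cX : code X} k (s : seq X) : esize (drop k s) <= esize s.
Proof. by elim: s k => // x s IH [|k] //=; rewrite esize_cons (leq_trans (IH k)) //; lia. Qed.

Lemma esize_behead {X} {cX : code X} (s : seq X) : esize (behead s) <= esize s.
Proof. by rewrite -drop1 esize_drop. Qed.

Lemma esize_if {X} {cX : code X} (b : bool) (x y : X) :
  esize (if b then x else y) <= esize x + esize y.
Proof. by case: b; lia. Qed.

Section FoldAdd.
Context {X Y A : Type} {cX : code X} {cY : code Y} {cA : code A}.
Variables (l : X -> seq Y) (a : X -> A) (F : X -> A -> Y -> A) (q : X * Y -> nat).

(** The growth per step depends on the parameter and the current entry but not on the accumulator,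
    so it accumulates only linearly in the length of the list. *)
Lemma ptime_foldl_add :
  ptime (fun z : X * A * Y => F z.1.1 z.1.2 z.2) -> ptime l -> ptime a ->
  polyb q -> (forall x b y, esize (F x b y) <= esize b + q (x, y)) ->
  ptime (fun x => foldl (F x) (a x) (l x)).
Proof.
move=> FP lP aP [k qk] Fq.
apply: (ptime_foldl (q := fun x =>
  esize (a x) + esize (l x) * (esize x + esize (l x) + 3) ^ k)) => //.
  have lP' := polyb_size lP; have aP' := polyb_size aP.
  by repeat first [apply: polyb_add | apply: polyb_mul | apply: polyb_const
    | apply: polyb_esize | apply: polyb_exp | done].
move=> x j; set m := _ ^ k.
have qm y s t : l x = s ++ y :: t -> q (x, y) <= m.
  move=> def_l; apply: leq_trans (qk _) _; rewrite /m.
  have sz : esize (l x) + 1 = esize s + (esize y + esize t).+1.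
    by rewrite def_l esize_cat esize_cons.
  have s0 : 0 < esize s by exact: esize_gt0.
  rewrite esize_pair.
  by case: (k) => // k1; rewrite leq_exp2r //; lia.
have le_m s t : l x = s ++ t -> esize (foldl (F x) (a x) s) <= esize (a x) + size s * m.
  elim/last_ind: s t => [|s y IH] t def_l; first by rewrite addn0.
  rewrite cat_rcons in def_l; rewrite foldl_rcons size_rcons mulSn.
  have := IH _ def_l; have := qm _ _ _ def_l; have := Fq x (foldl (F x) (a x) s) y.
  lia.
apply: leq_trans (le_m _ _ (esym (cat_take_drop j (l x)))) _.
rewrite leq_add2l leq_mul2r; apply/orP; right.
exact: leq_trans (size_le_esize _) (esize_take _ _).
Qed.

End FoldAdd.

Section Lib.
Context {X : Type} {cX : code X}.

Lemma ptime_case' {Y Z} {cY : code Y} {cZ : code Z} (l : X -> seq Y) (f : X -> Z)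
    (g : X -> Y -> seq Y -> Z) :
  ptime l -> ptime f -> ptime (fun z : X * (Y * seq Y) => g z.1 z.2.1 z.2.2) ->
  ptime (fun x => match l x with [::] => f x | y :: s => g x y s end).
Proof. exact: ptime_case. Qed.

Lemma ptime_if {Z} {cZ : code Z} (b : X -> bool) (f g : X -> Z) :
  ptime b -> ptime f -> ptime g -> ptime (fun x => if b x then f x else g x).
Proof.
move=> bP fP gP.
apply: (ptime_ext (f := fun x => if nseq (b x) tt is _ :: _ then f x else g x)).
  apply: ptime_case' => //; last exact: ptime_comp fP (ptime_fst ptime_id).
  by apply: ptime_recode bP _ => x; apply: encode_bool_nseq.
by move=> x; case: (b x).
Qed.

Lemma ptime_cons {Y} {cY : code Y} (f : X -> Y) (g : X -> seq Y) :
  ptime f -> ptime g -> ptime (fun x => f x :: g x).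
Proof. by move=> fP gP; apply: ptime_recode (ptime_pair fP gP) _. Qed.

Lemma ptime_head {Y} {cY : code Y} (d : X -> Y) (l : X -> seq Y) :
  ptime d -> ptime l -> ptime (fun x => head (d x) (l x)).
Proof.
move=> dP lP; apply: (ptime_case' (g := fun _ y _ => y)) => //.
exact: ptime_fst (ptime_snd ptime_id).
Qed.

Lemma ptime_behead {Y} {cY : code Y} (l : X -> seq Y) :
  ptime l -> ptime (fun x => behead (l x)).
Proof.
move=> lP; apply: (ptime_ext (f := fun x => match l x with [::] => [::] | _ :: s => s end)).
  apply: (ptime_case' (g := fun _ _ s => s)) => //; first exact: ptime_const.
  exact: ptime_snd (ptime_snd ptime_id).
by move=> x; case: (l x).
Qed.

Lemma ptime_nseq (n : X -> nat) : ptime n -> ptime (fun x => nseq (n x) tt).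
Proof. by move=> nP; apply: ptime_recode nP _ => x; rewrite encode_nat_nseq. Qed.

Lemma ptime_S (n : X -> nat) : ptime n -> ptime (fun x => (n x).+1).
Proof.
move=> nP; apply: ptime_recode (ptime_cons (ptime_const tt) (ptime_nseq nP)) _ => x.
by rewrite (encode_nat_nseq (n x).+1).
Qed.

Lemma ptime_pred (n : X -> nat) : ptime n -> ptime (fun x => (n x).-1).
Proof.
move=> nP; apply: ptime_recode (ptime_behead (ptime_nseq nP)) _ => x.
by rewrite (encode_nat_nseq (n x).-1); case: (n x).
Qed.

Lemma ptime_eq0 (n : X -> nat) : ptime n -> ptime (fun x => n x == 0).
Proof.
move=> nP; apply: (ptime_ext (f := fun x => if nseq (n x) tt is _ :: _ then false else true)).
  by apply: (ptime_case' (g := fun _ _ _ => false)); [exact: ptime_nseq | exact: ptime_const..].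
by move=> x; case: (n x).
Qed.

Lemma ptime_and (b c : X -> bool) :
  ptime b -> ptime c -> ptime (fun x => b x && c x).
Proof. by move=> bP cP; apply: ptime_if => //; apply: ptime_const. Qed.

Lemma ptime_or (b c : X -> bool) :
  ptime b -> ptime c -> ptime (fun x => b x || c x).
Proof. by move=> bP cP; apply: ptime_if => //; apply: ptime_const. Qed.

Lemma ptime_neg (b : X -> bool) : ptime b -> ptime (fun x => ~~ b x).
Proof. by move=> bP; apply: ptime_if => //; apply: ptime_const. Qed.

Lemma ptime_eqb (b c : X -> bool) : ptime b -> ptime c -> ptime (fun x => b x == c x).
Proof.
move=> bP cP; apply: (ptime_ext (f := fun x => if b x then c x else ~~ c x)).
  by apply: ptime_if => //; apply: ptime_neg.
by move=> x; case: (b x); case: (c x).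
Qed.

Lemma ptime_addb (b c : X -> bool) : ptime b -> ptime c -> ptime (fun x => b x (+) c x).
Proof.
move=> bP cP; apply: (ptime_ext (f := fun x => if b x then ~~ c x else c x)).
  by apply: ptime_if => //; apply: ptime_neg.
by move=> x; case: (b x); case: (c x).
Qed.

End Lib.

Ltac pt_user := fail.

(* Dispatch on the head symbol: blind [apply] would unfold definitions. *)
Ltac pt_step :=
  cbv beta;
  try lazymatch goal with
    | |- ptime (fun _ => _) => fail
    | |- @ptime ?X ?Y ?cX ?cY ?f => change (@ptime X Y cX cY (fun x => f x))
    end;
  first
  [ eassumption
  | match goal with
    | H : @ptime _ _ _ _ ?z |- @ptime _ _ _ _ (fun w => ?z _) => apply: (ptime_comp H)
    end
  | simple apply ptime_const
  | simple apply polyb_const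
  | pt_user
  | lazymatch goal with
    | |- ptime (fun x => x) => exact: ptime_id
    | |- ptime (fun _ => fst _) => apply: ptime_fst
    | |- ptime (fun _ => snd _) => apply: ptime_snd
    | |- ptime (fun _ => pair _ _) => apply: ptime_pair
    | |- ptime (fun _ => cons _ _) => apply: ptime_cons
    | |- ptime (fun _ => head _ _) => apply: ptime_head
    | |- ptime (fun _ => behead _) => apply: ptime_behead
    | |- ptime (fun _ => nseq _ tt) => apply: ptime_nseq
    | |- ptime (fun _ => S _) => apply: ptime_S
    | |- ptime (fun _ => predn _) => apply: ptime_pred
    | |- ptime (fun _ => andb _ _) => apply: ptime_and
    | |- ptime (fun _ => orb _ _) => apply: ptime_or
    | |- ptime (fun _ => negb _) => apply: ptime_neg
    | |- ptime (fun _ => addb _ _) => apply: ptime_addb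
    | |- ptime (fun _ => if _ then _ else _) => apply: ptime_if
    | |- polyb (fun _ => addn _ _) => apply: polyb_add
    | |- polyb (fun _ => muln _ _) => apply: polyb_mul
    | |- polyb (fun _ => esize _) => apply: polyb_size
    end ].
Ltac pt := repeat pt_step.

Lemma ptime_rev {X} {cX : code X} {Y} {cY : code Y} (l : X -> seq Y) :
  ptime l -> ptime (fun x => rev (l x)).
Proof.
move=> lP; apply: (ptime_ext (f := fun x => foldl (fun s y => y :: s) [::] (l x))).
  apply: (ptime_foldl_add (q := fun z => esize z.2 + 1)); try by pt.
  by move=> x s y; rewrite esize_cons /=; lia.
by move=> x; rewrite /rev; elim: (l x) [::] => //=.
Qed.

Lemma ptime_map {X} {cX : code X} {Y Z} {cY : code Y} {cZ : code Z} (l : X -> seq Y) (F : X -> Y -> Z) :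
  ptime (fun z : X * Y => F z.1 z.2) -> ptime l ->
  ptime (fun x => [seq F x y | y <- l x]).
Proof.
move=> FP lP; apply: (ptime_ext (f := fun x => rev (foldl (fun s y => F x y :: s) [::] (l x)))).
  apply: ptime_rev; apply: (ptime_foldl_add (q := fun z => esize (F z.1 z.2) + 1)); try by pt.
    apply: ptime_cons; last by pt.
    by apply: (ptime_comp (g := fun z => F z.1 z.2) (f := fun z => (z.1.1, z.2))); pt.
  by move=> x s y; rewrite esize_cons /=; lia.
move=> x; rewrite -[RHS]cats0 -[RHS]revK; congr rev.
rewrite cats0 -[RHS]cats0; elim: (l x) [::] => //= y s IH t.
by rewrite IH rev_cons cat_rcons.
Qed.

Lemma ptime_filter {X} {cX : code X} {Y} {cY : code Y} (l : X -> seq Y) (P : X -> Y -> bool) :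
  ptime (fun z : X * Y => P z.1 z.2) -> ptime l ->
  ptime (fun x => [seq y <- l x | P x y]).
Proof.
move=> PP lP; apply: (ptime_ext (f := fun x =>
    rev (foldl (fun s y => if P x y then y :: s else s) [::] (l x)))).
  apply: ptime_rev; apply: (ptime_foldl_add (q := fun z => esize z.2 + 1)); try by pt.
    apply: ptime_if; try by pt.
    by apply: (ptime_comp (g := fun z => P z.1 z.2) (f := fun z => (z.1.1, z.2))); pt.
  by move=> x s y; case: ifP => _; rewrite ?esize_cons /=; lia.
move=> x; rewrite -[RHS]cats0 -[RHS]revK; congr rev.
rewrite cats0 -[RHS]cats0; elim: (l x) [::] => //= y s IH t.
by case: ifP => _; rewrite IH ?rev_cons ?cat_rcons.
Qed.

Lemma ptime_flatten {X} {cX : code X} {Y} {cY : code Y} (l : X -> seq (seq Y)) :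
  ptime l -> ptime (fun x => flatten (l x)).
Proof.
move=> lP; have catP : ptime (fun z : seq Y * seq Y => z.1 ++ z.2).
  apply: (ptime_ext (f := fun z => foldl (fun s y => y :: s) z.2 (rev z.1))).
    apply: (ptime_foldl_add (q := fun z => esize z.2 + 1)); try by pt.
      by apply: ptime_rev; pt.
    by move=> x s y; rewrite esize_cons /=; lia.
  move=> [s t] /=; rewrite foldl_rev.
  by elim: s => //= y s ->.
apply: (ptime_ext (f := fun x => foldl (fun s y => y ++ s) [::] (rev (l x)))).
  apply: (ptime_foldl_add (q := fun z => esize z.2)); try by pt.
  - by apply: (ptime_comp (f := fun z => (z.2, z.1.2)) catP); pt.
  - by apply: ptime_rev; pt.
  - move=> x s y /=; rewrite -ltnS -addn1 esize_cat; lia.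
by move=> x; rewrite foldl_rev.
Qed.

Lemma ptime_cat {X} {cX : code X} {Y} {cY : code Y} (l l' : X -> seq Y) :
  ptime l -> ptime l' -> ptime (fun x => l x ++ l' x).
Proof.
move=> lP lP'; apply: (ptime_ext (f := fun x => flatten [:: l x; l' x])).
  by apply: ptime_flatten; pt.
by move=> x; rewrite /= cats0.
Qed.

Lemma ptime_size {X} {cX : code X} {Y} {cY : code Y} (l : X -> seq Y) :
  ptime l -> ptime (fun x => size (l x)).
Proof.
move=> lP; apply: (ptime_ext (f := fun x => foldl (fun n _ => n.+1) 0 (l x))).
  apply: (ptime_foldl_add (q := fun=> 2)); try by pt.
  by move=> x n y; rewrite !esize_nat; lia.
move=> x; rewrite -[size _]addn0; elim: (l x) (0) => //= y s IH n.
by rewrite IH addnS.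
Qed.

Lemma ptime_count {X} {cX : code X} {Y} {cY : code Y} (l : X -> seq Y) (P : X -> Y -> bool) :
  ptime (fun z : X * Y => P z.1 z.2) -> ptime l ->
  ptime (fun x => count (P x) (l x)).
Proof.
move=> PP lP; apply: (ptime_ext (f := fun x => size [seq y <- l x | P x y])).
  exact/ptime_size/ptime_filter.
by move=> x; rewrite size_filter.
Qed.

Lemma ptime_has {X} {cX : code X} {Y} {cY : code Y} (l : X -> seq Y) (P : X -> Y -> bool) :
  ptime (fun z : X * Y => P z.1 z.2) -> ptime l -> ptime (fun x => has (P x) (l x)).
Proof.
move=> PP lP; apply: (ptime_ext (f := fun x => ~~ (count (P x) (l x) == 0))).
  exact/ptime_neg/ptime_eq0/ptime_count.
by move=> x; rewrite has_count lt0n.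
Qed.

Lemma ptime_addn {X} {cX : code X} (m n : X -> nat) : ptime m -> ptime n -> ptime (fun x => m x + n x).
Proof.
move=> mP nP; apply: (ptime_ext (f := fun x => foldl (fun k _ => k.+1) (m x) (nseq (n x) tt))).
  apply: (ptime_foldl_add (q := fun=> 2)); try by pt.
  by move=> x k y; rewrite !esize_nat; lia.
by move=> x; elim: (n x) (m x) => [|k IH] i /=; rewrite ?addn0 // IH addSnnS.
Qed.

Lemma ptime_subn {X} {cX : code X} (m n : X -> nat) : ptime m -> ptime n -> ptime (fun x => m x - n x).
Proof.
move=> mP nP; apply: (ptime_ext (f := fun x => foldl (fun k _ => k.-1) (m x) (nseq (n x) tt))).
  apply: (ptime_foldl_add (q := fun=> 0)); try by pt.
  by move=> x k y; rewrite !esize_nat; lia.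
by move=> x; elim: (n x) (m x) => [|k IH] i /=; rewrite ?subn0 // IH; lia.
Qed.

Lemma ptime_leq {X} {cX : code X} (m n : X -> nat) : ptime m -> ptime n -> ptime (fun x => m x <= n x).
Proof. by move=> mP nP; apply: ptime_eq0; apply: ptime_subn. Qed.

Lemma ptime_eqn {X} {cX : code X} (m n : X -> nat) : ptime m -> ptime n -> ptime (fun x => m x == n x).
Proof.
move=> mP nP; apply: (ptime_ext (f := fun x => (m x <= n x) && (n x <= m x))).
  by apply: ptime_and; apply: ptime_leq.
by move=> x; rewrite eqn_leq.
Qed.

Lemma ptime_minn {X} {cX : code X} (m n : X -> nat) : ptime m -> ptime n -> ptime (fun x => minn (m x) (n x)).
Proof.
move=> mP nP; apply: (ptime_ext (f := fun x => m x - (m x - n x))).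
  by apply: ptime_subn => //; apply: ptime_subn.
by move=> x; rewrite minnE.
Qed.

Lemma ptime_muln {X} {cX : code X} (m n : X -> nat) : ptime m -> ptime n -> ptime (fun x => m x * n x).
Proof.
move=> mP nP; apply: (ptime_ext (f := fun x =>
    foldl (fun k _ => k + n x) 0 (nseq (m x) tt))).
  apply: (ptime_foldl_add (q := fun z => esize (n z.1))); try by pt.
  - by apply: ptime_addn; pt.
  - by move=> x k y; rewrite !esize_nat /=; lia.
move=> x; rewrite -[RHS]add0n; elim: (m x) (0) => [|k IH] i /=; first by rewrite mul0n addn0.
by rewrite IH mulSn addnA.
Qed.

Lemma ptime_iota {X} {cX : code X} (n : X -> nat) : ptime n -> ptime (fun x => iota 0 (n x)).
Proof.
move=> nP; apply: (ptime_ext (f := fun x =>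
    foldl (fun s _ => (n x - size s).-1 :: s) [::] (nseq (n x) tt))).
  apply: (ptime_foldl_add (q := fun z => esize (n z.1) + 1)); try by pt.
  - apply: ptime_cons; last by pt.
    by apply: ptime_pred; apply: ptime_subn; [pt | apply: ptime_size; pt].
  - by move=> x k y; rewrite esize_cons !esize_nat /=; lia.
move=> x; suff loop k j : k + j = n x ->
    foldl (fun s _ => (n x - size s).-1 :: s) (iota k j) (nseq k tt) = iota 0 (n x).
  exact: loop (addn0 _).
elim: k j => [|k IH] j /= kj; first by rewrite -kj add0n.
have -> : (n x - size (iota k.+1 j)).-1 = k by rewrite size_iota; lia.
by apply: (IH j.+1); lia.
Qed.

Lemma ptime_drop {X} {cX : code X} {Y} {cY : code Y} (n : X -> nat) (l : X -> seq Y) :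
  ptime n -> ptime l -> ptime (fun x => drop (n x) (l x)).
Proof.
move=> nP lP; apply: (ptime_ext (f := fun x => foldl (fun s _ => behead s) (l x) (nseq (n x) tt))).
  apply: (ptime_foldl_add (q := fun=> 0)); try by pt.
  by move=> x s y; rewrite addn0 esize_behead.
by move=> x; elim: (n x) (l x) => [|k IH] [|y s] //=; rewrite IH ?drop0.
Qed.

Lemma ptime_nth {X} {cX : code X} {Y} {cY : code Y} (d : X -> Y) (l : X -> seq Y) (n : X -> nat) :
  ptime d -> ptime l -> ptime n -> ptime (fun x => nth (d x) (l x) (n x)).
Proof.
move=> dP lP nP; apply: (ptime_ext (f := fun x => head (d x) (drop (n x) (l x)))).
  by apply: ptime_head => //; apply: ptime_drop.
by move=> x; rewrite -nth0 nth_drop addn0.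
Qed.

Lemma ptime_take {X} {cX : code X} {Y} {cY : code Y} (n : X -> nat) (l : X -> seq Y) :
  ptime n -> ptime l -> ptime (fun x => take (n x) (l x)).
Proof.
move=> nP lP; apply: (ptime_ext (f := fun x => rev (drop (size (l x) - n x) (rev (l x))))).
  apply: ptime_rev; apply: ptime_drop; last exact: ptime_rev.
  by apply: ptime_subn => //; apply: ptime_size.
move=> x; rewrite drop_rev revK; case: (leqP (n x) (size (l x))) => [/subKn -> //|lt].
have -> : size (l x) - (size (l x) - n x) = size (l x) by lia.
by rewrite take_size take_oversize // ltnW.
Qed.

Lemma ptime_find {X} {cX : code X} {Y} {cY : code Y} (l : X -> seq Y) (P : X -> Y -> bool) :
  ptime (fun z : X * Y => P z.1 z.2) -> ptime l -> ptime (fun x => find (P x) (l x)).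
Proof.
move=> PP lP; apply: (ptime_ext (f := fun x =>
    (foldl (fun s y => if s.1 then s else if P x y then (true, s.2) else (false, s.2.+1))
       (false, 0) (l x)).2)).
  apply: ptime_snd; apply: (ptime_foldl_add (q := fun=> 4)); try by pt.
    do 2![apply: ptime_if; try by pt].
    by apply: (ptime_comp (g := fun z => P z.1 z.2) (f := fun z => (z.1.1, z.2))); pt.
  have e1 : esize true = 3 by []. have e0 : esize false = 1 by [].
  move=> x [[] n] y /=; first by lia.
  by case: ifP => _; rewrite !esize_pair ?esize_nat ?e1 ?e0; lia.
move=> x; rewrite -[RHS]add0n; elim: (l x) 0 => [|y s IH] n /=; first by rewrite addn0.
case: ifP => _; last by rewrite IH addSnnS.
by rewrite addn0; elim: s {IH}.
Qed.

Lemma ptime_mem {X} {cX : code X} (m : X -> nat) (l : X -> seq nat) :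
  ptime m -> ptime l -> ptime (fun x => m x \in l x).
Proof.
move=> mP lP; apply: (ptime_ext (f := fun x => has (fun y => y == m x) (l x))).
  by apply: ptime_has => //; apply: ptime_eqn; pt.
by move=> x; rewrite -has_pred1.
Qed.

Section FoldMeasure.
Context {X Y A : Type} {cX : code X} {cY : code Y} {cA : code A}.
Variables (l : X -> seq Y) (a : X -> A) (F : X -> A -> Y -> A).
Variables (q : X * Y -> nat) (mu : A -> nat) (c : nat).

(** Meant for binary numbers: digits have encodings of different sizes, so [esize] may change by a
    constant factor when digits flip, whereas the number of digits grows additively. *)
Lemma ptime_foldl_measure :
  ptime (fun z : X * A * Y => F z.1.1 z.1.2 z.2) -> ptime l -> ptime a ->
  polyb q -> (forall b, esize b <= c * mu b + c) -> (forall b, mu b <= esize b) ->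
  (forall x b y, mu (F x b y) <= mu b + q (x, y)) ->
  ptime (fun x => foldl (F x) (a x) (l x)).
Proof.
move=> FP lP aP [k qk] szmu musz Fq.
apply: (ptime_foldl (q := fun x =>
  c * (esize (a x) + esize (l x) * (esize x + esize (l x) + 3) ^ k) + c)) => //.
  have lP' := polyb_size lP; have aP' := polyb_size aP.
  by repeat first [apply: polyb_add | apply: polyb_mul | apply: polyb_const
    | apply: polyb_esize | apply: polyb_exp | done].
move=> x j; set m := _ ^ k.
have qm y s t : l x = s ++ y :: t -> q (x, y) <= m.
  move=> def_l; apply: leq_trans (qk _) _; rewrite /m.
  have sz : esize (l x) + 1 = esize s + (esize y + esize t).+1.
    by rewrite def_l esize_cat esize_cons.
  have s0 : 0 < esize s by exact: esize_gt0.
  rewrite esize_pair.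
  by case: (k) => // k1; rewrite leq_exp2r //; lia.
have le_m s t : l x = s ++ t -> mu (foldl (F x) (a x) s) <= esize (a x) + size s * m.
  elim/last_ind: s t => [|s y IH] t def_l; first by rewrite addn0 musz.
  rewrite cat_rcons in def_l; rewrite foldl_rcons size_rcons mulSn.
  have := IH _ def_l; have := qm _ _ _ def_l; have := Fq x (foldl (F x) (a x) s) y.
  lia.
apply: leq_trans (szmu _) _; rewrite leq_add2r leq_mul2l; apply/orP; right.
apply: leq_trans (le_m _ _ (esym (cat_take_drop j (l x)))) _.
rewrite leq_add2l leq_mul2r; apply/orP; right.
exact: leq_trans (size_le_esize _) (esize_take _ _).
Qed.

End FoldMeasure.

Ltac pt_lib :=
  lazymatch goal with
  | |- ptime (fun _ => rev _) => apply: ptime_rev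
  | |- ptime (fun _ => map _ _) => apply: ptime_map
  | |- ptime (fun _ => filter _ _) => apply: ptime_filter
  | |- ptime (fun _ => flatten _) => apply: ptime_flatten
  | |- ptime (fun _ => cat _ _) => apply: ptime_cat
  | |- ptime (fun _ => size _) => apply: ptime_size
  | |- ptime (fun _ => count _ _) => apply: ptime_count
  | |- ptime (fun _ => has _ _) => apply: ptime_has
  | |- ptime (fun _ => addn _ _) => apply: ptime_addn
  | |- ptime (fun _ => subn _ _) => apply: ptime_subn
  | |- ptime (fun _ => leq _ _) => apply: ptime_leq
  | |- ptime (fun _ => @eq_op _ _ _) => first [apply: ptime_eqn | apply: ptime_eqb]
  | |- ptime (fun _ => minn _ _) => apply: ptime_minn
  | |- ptime (fun _ => muln _ _) => apply: ptime_muln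
  | |- ptime (fun _ => iota 0 _) => apply: ptime_iota
  | |- ptime (fun _ => drop _ _) => apply: ptime_drop
  | |- ptime (fun _ => take _ _) => apply: ptime_take
  | |- ptime (fun _ => nth _ _ _) => apply: ptime_nth
  | |- ptime (fun _ => find _ _) => apply: ptime_find
  | |- ptime (fun _ => in_mem _ (mem _)) => apply: ptime_mem
  end.
Ltac pt_user ::= pt_lib.

(** * Binary arithmetic *)

(* Least significant digit first, leading zeros allowed. *)
Notation num := (seq bool).

Definition num_val (s : num) : nat := foldr (fun (b : bool) v => b + v.*2) 0 s.

Lemma num_val_cat s t : num_val (s ++ t) = num_val s + 2 ^ size s * num_val t.
Proof.
elim: s => [|b s IH] /=; first by rewrite mul1n.
by rewrite IH expnS doubleD -addnA -!mul2n mulnA.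
Qed.

Lemma num_val_head_behead s : num_val s = head false s + (num_val (behead s)).*2.
Proof. by case: s. Qed.

Lemma esize_num (s : num) : esize s <= 4 * size s + 4.
Proof.
elim: s => // b s IH; rewrite esize_cons /=.
by have : esize b <= 3 by [case: b]; lia.
Qed.

Definition num_add_step (s : num * (num * (bool * num))) (_ : bool) :=
  let a := head false s.1 in
  let b := head false s.2.1 in
  let c := s.2.2.1 in
  (behead s.1, (behead s.2.1,
    (if a then b || c else b && c, (a (+) b (+) c) :: s.2.2.2))).

(** The longer operand serves only as a clock, each tick consuming a digit of both. The last carry
    becomes the leading digit. *)
Definition num_add (a b : num) : num :=
  let r := (foldl num_add_step (a, (b, (false, [::])))
             (if size a <= size b then b else a)).2.2 in
  rev (r.1 :: r.2).

Lemma val_num_add a b : num_val (num_add a b) = num_val a + num_val b.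
Proof.
rewrite /num_add; set clock := if _ then _ else _.
suff loop k c out : size a <= size k -> size b <= size k ->
    let r := (foldl num_add_step (a, (b, (c, out))) k).2.2 in
    num_val (rev (r.1 :: r.2)) = num_val (rev out) + 2 ^ size out * (c + num_val a + num_val b).
  have [sa sb] : size a <= size clock /\ size b <= size clock.
    by rewrite /clock; case: (leqP (size a) (size b)) => lt; split=> //; apply: ltnW.
  by rewrite (loop clock false [::]) // mul1n.
elim: k a b c out {clock} => [|x k IH] a b c out /=.
  rewrite !leqn0 !size_eq0 => /eqP-> /eqP->; rewrite rev_cons -cats1 num_val_cat /=.
  by rewrite size_rev !addn0.
move=> sa sb; rewrite IH ?size_behead; [|by move=> /=; lia..].
rewrite /= rev_cons -cats1 num_val_cat /= size_rev addn0 expnSr -!addnA; congr (_ + _).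
rewrite -mulnA -mulnDr (num_val_head_behead a) (num_val_head_behead b); congr (_ * _).
by case: (head false a); case: (head false b); case: c; rewrite /= -?mul2n; lia.
Qed.

Lemma size_num_add a b : size (num_add a b) = (maxn (size a) (size b)).+1.
Proof.
rewrite /num_add size_rev /=; set clock := if _ then _ else _.
have loop k s : size (foldl num_add_step s k).2.2.2 = size s.2.2.2 + size k.
  by elim: k s => [|x k IH] s /=; rewrite ?addn0 // IH /=; lia.
by rewrite loop /= /clock maxnC /maxn; case: ltngtP => //; lia.
Qed.

Lemma ptime_num_add {X} {cX : code X} (a b : X -> num) :
  ptime a -> ptime b -> ptime (fun x => num_add (a x) (b x)).
Proof.
move=> aP bP; rewrite /num_add.
pose (l := fun x => if size (a x) <= size (b x) then b x else a x).
have P : ptime (fun x => foldl num_add_step (a x, (b x, (false, [::]))) (l x)).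
  apply: (ptime_foldl_add (q := fun=> 6)); rewrite /l; try by pt.
    by rewrite /num_add_step; pt.
  move=> x [u [v [c o]]] y; rewrite /num_add_step !esize_pair esize_cons /=.
  pose proof (esize_behead u); pose proof (esize_behead v); pose proof (esize_gt0 c).
  set d := if _ then _ else _; set e := _ (+) c.
  have := esize_bool d; have := esize_bool e.
  lia.
by pt; apply: P.
Qed.

(** Digits are read from the least significant one, so every later difference overrides the verdict
    so far. *)
Definition num_le (a b : num) : bool :=
  (foldl (fun (s : num * (num * bool)) (_ : bool) =>
     let x := head false s.1 in let y := head false s.2.1 in
     (behead s.1, (behead s.2.1, if x == y then s.2.2 else y)))
   (a, (b, true)) (a ++ b)).2.2.

Lemma num_leE a b : num_le a b = (num_val a <= num_val b).
Proof.
rewrite /num_le; set F := fun s _ => _.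
suff loop k r : size a <= size k -> size b <= size k ->
    (foldl F (a, (b, r)) k).2.2 = (num_val a < num_val b) || (num_val a == num_val b) && r.
  by rewrite loop ?size_cat ?leq_addr ?leq_addl // andbT orbC -leq_eqVlt.
elim: k a b r => [|x k IH] a b r /=.
  by rewrite !leqn0 !size_eq0 => /eqP-> /eqP->.
move=> sa sb; rewrite IH ?size_behead; [|by move=> /=; lia..].
rewrite (num_val_head_behead a) (num_val_head_behead b).
by case: (head false a); case: (head false b) => /=; case: r; lia.
Qed.

Lemma ptime_num_le {X} {cX : code X} (a b : X -> num) :
  ptime a -> ptime b -> ptime (fun x => num_le (a x) (b x)).
Proof.
move=> aP bP; rewrite /num_le; do 2!apply: ptime_snd.
apply: (ptime_foldl_add (q := fun=> 3)); try by pt.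
move=> x [u [v r]] y; rewrite !esize_pair /=.
pose proof (esize_behead u); pose proof (esize_behead v).
set d := if _ then _ else _; have := esize_bool d; lia.
Qed.

Definition num_mul (a b : num) : num :=
  foldl (fun s (x : bool) => if x then num_add (false :: s) b else false :: s)
    [::] (rev a).

Lemma val_num_mul a b : num_val (num_mul a b) = num_val a * num_val b.
Proof.
rewrite /num_mul foldl_rev; elim: a => //= x a IH.
by case: x => /=; rewrite ?val_num_add /= IH mulnDl -doubleMl ?mul1n // addnC.
Qed.

Lemma size_num_mul a b : size (num_mul a b) <= size b + (size a).*2.
Proof.
rewrite /num_mul foldl_rev; elim: a => //= x a IH.
by case: x => /=; rewrite ?size_num_add /=; lia.
Qed.

Lemma ptime_num_mul {X} {cX : code X} (a b : X -> num) :
  ptime a -> ptime b -> ptime (fun x => num_mul (a x) (b x)).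
Proof.
move=> aP bP; apply: (ptime_foldl_measure (q := fun z => size (b z.1) + 2)
  (mu := size) (c := 4)); try by pt.
- apply: ptime_if; try by pt.
  by apply: ptime_num_add; pt.
- apply: polyb_add (polyb_const 2).
  apply: (polyb_le (h := fun z => esize (b z.1))) => [|z]; last exact: size_le_esize.
  by pt.
- exact: esize_num.
- by move=> s; apply: size_le_esize.
- by move=> x s []; rewrite ?size_num_add /=; lia.
Qed.

Definition num_sum (l : seq num) : num := foldl num_add [::] l.

Lemma val_num_sum l : num_val (num_sum l) = \sum_(x <- l) num_val x.
Proof.
suff gen s : num_val (foldl num_add s l) = num_val s + \sum_(x <- l) num_val x by apply: gen.
elim: l s => [|x l IH] s; first by rewrite big_nil addn0.
by rewrite big_cons /= IH val_num_add addnA.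
Qed.

Definition num_prod (l : seq num) : num := foldl (fun s x => num_mul x s) [:: true] l.

Lemma val_num_prod l : num_val (num_prod l) = \prod_(x <- l) num_val x.
Proof.
suff gen s : num_val (foldl (fun s x => num_mul x s) s l) = num_val s * \prod_(x <- l) num_val x.
  by rewrite /num_prod gen mul1n.
elim: l s => [|x l IH] s; first by rewrite big_nil muln1.
by rewrite big_cons /= IH val_num_mul mulnA [num_val s * _]mulnC.
Qed.

Definition num_of_nat (n : nat) : num :=
  foldl (fun s _ => num_add s [:: true]) [::] (nseq n tt).

Lemma val_num_of_nat n : num_val (num_of_nat n) = n.
Proof.
suff gen s : num_val (foldl (fun s _ => num_add s [:: true]) s (nseq n tt)) = num_val s + n.
  exact: gen.
elim: n s => [|n IH] s /=; first by rewrite addn0.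
by rewrite IH val_num_add /= addn1 addSnnS.
Qed.

Lemma polyb_size_seq {X Y} {cX : code X} {cY : code Y} (f : X -> seq Y) :
  ptime f -> polyb (fun x => size (f x)).
Proof. by move=> /polyb_size/polyb_le; apply=> x; apply: size_le_esize. Qed.

Lemma ptime_num_sum {X} {cX : code X} (l : X -> seq num) :
  ptime l -> ptime (fun x => num_sum (l x)).
Proof.
move=> lP; apply: (ptime_foldl_measure (q := fun z => size z.2 + 1)
  (mu := size) (c := 4)); try by pt.
- by apply: ptime_num_add; pt.
- by apply: polyb_add (polyb_const 1); apply: polyb_size_seq; pt.
- exact: esize_num.
- by move=> s; apply: size_le_esize.
- by move=> x s y; rewrite size_num_add /=; lia.
Qed.

Lemma ptime_num_prod {X} {cX : code X} (l : X -> seq num) :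
  ptime l -> ptime (fun x => num_prod (l x)).
Proof.
move=> lP; apply: (ptime_foldl_measure (q := fun z => 2 * size z.2)
  (mu := size) (c := 4)); try by pt.
- by apply: ptime_num_mul; pt.
- by apply: polyb_mul (polyb_const 2) _; apply: polyb_size_seq; pt.
- exact: esize_num.
- by move=> s; apply: size_le_esize.
- by move=> x s y; have := size_num_mul y s; rewrite -mul2n /=; lia.
Qed.

Lemma ptime_num_of_nat {X} {cX : code X} (n : X -> nat) :
  ptime n -> ptime (fun x => num_of_nat (n x)).
Proof.
move=> nP; apply: (ptime_foldl_measure (q := fun=> 2) (mu := size) (c := 4)); try by pt.
- by apply: ptime_num_add; pt.
- exact: esize_num.
- by move=> s; apply: size_le_esize.
- by move=> x s y; rewrite size_num_add /=; lia.
Qed.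

Ltac pt_num :=
  lazymatch goal with
  | |- ptime (fun _ => num_add _ _) => apply: ptime_num_add
  | |- ptime (fun _ => num_mul _ _) => apply: ptime_num_mul
  | |- ptime (fun _ => num_le _ _) => apply: ptime_num_le
  | |- ptime (fun _ => num_sum _) => apply: ptime_num_sum
  | |- ptime (fun _ => num_prod _) => apply: ptime_num_prod
  | |- ptime (fun _ => num_of_nat _) => apply: ptime_num_of_nat
  end.
Ltac pt_user ::= first [pt_lib | pt_num].

(** * The algorithm *)

(* Number of points, quota, budget, weights, radii, and the rows of the
   distance matrix, one after the other. *)
Definition data : Type := (nat * num * num * seq num * seq num * seq num)%type.

Definition points (z : data) : nat := z.1.1.1.1.1.
Definition goal (z : data) : num := z.1.1.1.1.2.
Definition bound (z : data) : num := z.1.1.1.2.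
Definition wgt (z : data) (v : nat) : num := nth [::] z.1.1.2 v.
Definition rad (z : data) (v : nat) : num := nth [::] z.1.2 v.
Definition dst (z : data) (u v : nat) : num := nth [::] z.2 (u * points z + v).

Definition conflict (z : data) (u v : nat) : bool :=
  num_le (dst z u v) (num_add (num_add (rad z u) (rad z u)) (rad z v)) &&
  num_le (dst z u v) (num_add (rad z u) (num_add (rad z v) (rad z v))).

Definition absorbs (z : data) (u x : nat) : bool :=
  conflict z u x &&
  num_le (rad z u) (num_add (num_add (rad z x) (rad z x)) (num_add (rad z x) (rad z x))).

(* A forest is listed in reverse preorder; each node is given by the path that
   leads from it to its root. A new node becomes a child of the first
   conflicting node, or a new root if there is none. *)
Definition forest : Type := seq (seq nat).

Definition insert (z : data) (x : nat) (M : forest) : forest :=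
  let k := find (fun p => conflict z x (head 0 p)) M in
  take k M ++ (x :: nth [::] M k) :: drop k M.

Definition cluster_step (z : data) (s : forest * seq (nat * nat)) (x : nat) :
    forest * seq (nat * nat) :=
  match [seq p <- s.1 | absorbs z (head 0 p) x] with
  | [::] => (insert z x s.1, (x, x) :: s.2)
  | p :: _ => (s.1, (x, head 0 p) :: s.2)
  end.

Definition clusters (z : data) (order : seq nat) : forest * seq (nat * nat) :=
  foldl (cluster_step z) ([::], [::]) order.

Definition by_load (C : seq nat) (l : seq nat) (x : nat) : seq nat :=
  [seq y <- l | nth 0 C y < nth 0 C x] ++
  x :: [seq y <- l | ~~ (nth 0 C y < nth 0 C x)].

Definition load_order (C : seq nat) (n : nat) : seq nat :=
  foldl (by_load C) [::] (iota 0 n).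

Definition center (z : data) (v : nat) : nat :=
  foldl (fun b s => if num_le (dst z s v) (rad z v) && ~~ num_le (wgt z b) (wgt z s)
                    then s else b) v (iota 0 (points z)).

Definition total_cost (z : data) (T : forest) : num :=
  num_sum [seq wgt z (center z (head 0 p)) | p <- T].

(** A chosen path stands for a center opened near its first node, and it serves the representatives
    on the whole path. The count is of the points absorbed by these, not of the points actually
    covered. *)
Definition served (A : seq (nat * nat)) (T : forest) : nat :=
  count (fun a => has (fun p => a.2 \in p) T) A.

(* A list of at most one element stands for an option. *)
Definition cheapest (z : data) (l : seq forest) : seq forest :=
  foldl (fun b T => match b with
    | [::] => [:: T]
    | T' :: _ => if num_le (total_cost z T') (total_cost z T) then b else [:: T]
    end) [::] l.

(** A state of the dynamic program consists of the latest chosen path and the number of points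
    served; one cheapest choice is kept for each state. *)
Definition knapsack_step (z : data) (A : seq (nat * nat)) (E : seq forest) (p : seq nat) :
    seq forest :=
  E ++ flatten [seq cheapest z [seq T <- [seq p :: T | T <- E] | served A T == j]
               | j <- iota 0 (size A).+1].

Definition knapsack (z : data) (A : seq (nat * nat)) (M : forest) : seq forest :=
  foldl (knapsack_step z A) [:: [::]] M.

Definition mask (z : data) (T : forest) : seq bool :=
  [seq v \in [seq center z (head 0 p) | p <- T] | v <- iota 0 (points z)].

Definition solutions (z : data) (M : forest) (A : seq (nat * nat)) : seq (seq bool) :=
  [seq mask z T | T <- [seq T <- knapsack z A M |
     num_le (goal z) (num_of_nat (served A T)) && num_le (total_cost z T) (bound z)]].

Definition new_load (n : nat) (C : seq nat) (A : seq (nat * nat)) : seq nat :=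
  [seq nth 0 C v + count (fun a => a.2 == v) A | v <- iota 0 n].

Definition round (z : data) (s : seq nat * seq (seq bool)) : seq nat * seq (seq bool) :=
  let: c := clusters z (load_order s.1 (points z)) in
  (new_load (points z) s.1 c.2,
   if s.2 is _ :: _ then s.2 else take 1 (solutions z c.1 c.2)).

(** One round more than can fail. The empty list of loads stands for zero loads, through the default
    value of [nth]. *)
Definition search (z : data) : seq (seq bool) :=
  (foldl (fun s _ => round z s) ([::], [::])
     (nseq (points z * points z * points z).+1 tt)).2.

(** Cross-multiplied so as to stay within the naturals: a scaled distance is at most a scaled radius
    exactly when the original ratio is at most d(x, y) / r(y). The candidate 0 makes all radii
    zero. *)
Definition scale (z : data) (x y : nat) : data :=
  (z.1.1, [seq num_mul (dst z x y) r | r <- z.1.2], [seq num_mul (rad z y) d | d <- z.2]).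

Definition better (z : data) (b : seq (num * num * seq bool)) (x y : nat) :
    seq (num * num * seq bool) :=
  match search (scale z x y) with
  | [::] => b
  | sol :: _ => match b with
    | [::] => [:: (dst z x y, rad z y, sol)]
    | a :: _ => if num_le (num_mul a.1.1 (rad z y)) (num_mul (dst z x y) a.1.2) then b
                else [:: (dst z x y, rad z y, sol)]
    end
  end.

Definition all_pairs (n : nat) : seq (nat * nat) :=
  flatten [seq [seq (x, y) | y <- iota 0 n] | x <- iota 0 n].

Definition solve (z : data) : seq bool :=
  match foldl (fun b p => better z b p.1 p.2) [::] (all_pairs (points z)) with
  | [::] => [seq false | _ <- iota 0 (points z)]
  | a :: _ => a.2
  end.

Definition split_word (w : seq symbol) : seq num :=
  rev (foldl (fun (s : num * seq num) (a : symbol) =>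
    match a with
    | Some b => (b :: s.1, s.2)
    | None => ([::], rev s.1 :: s.2)
    end) ([::], [::]) w).2.

(* Converts to unary, with a cap that keeps the size polynomial. *)
Definition unary (s : num) (cap : nat) : nat :=
  foldl (fun n (b : bool) => minn (if b then (n + n).+1 else n + n) cap) 0 (rev s).

(* The product of all the denominators is the common scale that turns the
   rationals of the instance into natural numbers. *)
Definition cleared (l : seq num) (m k : nat) : num :=
  num_mul (nth [::] l (k * 2 + 2))
    (num_prod [seq nth [::] l (i * 2 + 3) | i <- [seq i <- iota 0 m | ~~ (i == k)]]).

(** After the number of points and the quota come [m] fractions, numerator before denominator: the
    budget, then the weights, radii and distances. A valid word has more numerals than points, so
    the cap on [n] does not bite there. *)
Definition parse (w : seq symbol) : data :=
  let l := split_word w in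
  let n := unary (nth [::] l 0) (size l) in
  let m := (n + n + n * n).+1 in
  (n, nth [::] l 1, cleared l m 0,
   [seq cleared l m v.+1 | v <- iota 0 n],
   [seq cleared l m (n + v).+1 | v <- iota 0 n],
   [seq cleared l m (n + n + i).+1 | i <- iota 0 (n * n)]).

Definition algorithm (w : seq symbol) : seq bool := solve (parse w).

(** * The algorithm runs in polynomial time *)

Lemma ptime_points {X} {cX : code X} (z : X -> data) :
  ptime z -> ptime (fun x => points (z x)).
Proof. by move=> zP; rewrite /points; pt. Qed.

Lemma ptime_goal {X} {cX : code X} (z : X -> data) :
  ptime z -> ptime (fun x => goal (z x)).
Proof. by move=> zP; rewrite /goal; pt. Qed.

Lemma ptime_bound {X} {cX : code X} (z : X -> data) :
  ptime z -> ptime (fun x => bound (z x)).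
Proof. by move=> zP; rewrite /bound; pt. Qed.

Lemma ptime_wgt {X} {cX : code X} (z : X -> data) (v : X -> nat) :
  ptime z -> ptime v -> ptime (fun x => wgt (z x) (v x)).
Proof. by move=> zP vP; rewrite /wgt; pt. Qed.

Lemma ptime_rad {X} {cX : code X} (z : X -> data) (v : X -> nat) :
  ptime z -> ptime v -> ptime (fun x => rad (z x) (v x)).
Proof. by move=> zP vP; rewrite /rad; pt. Qed.

Lemma ptime_dst {X} {cX : code X} (z : X -> data) (u v : X -> nat) :
  ptime z -> ptime u -> ptime v -> ptime (fun x => dst (z x) (u x) (v x)).
Proof. by move=> zP uP vP; rewrite /dst /points; pt. Qed.

Ltac pt_data :=
  lazymatch goal with
  | |- ptime (fun _ => points _) => apply: ptime_points
  | |- ptime (fun _ => goal _) => apply: ptime_goal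
  | |- ptime (fun _ => bound _) => apply: ptime_bound
  | |- ptime (fun _ => wgt _ _) => apply: ptime_wgt
  | |- ptime (fun _ => rad _ _) => apply: ptime_rad
  | |- ptime (fun _ => dst _ _ _) => apply: ptime_dst
  end.
Ltac pt_user ::= first [pt_lib | pt_num | pt_data].

Lemma ptime_conflict {X} {cX : code X} (z : X -> data) (u v : X -> nat) :
  ptime z -> ptime u -> ptime v -> ptime (fun x => conflict (z x) (u x) (v x)).
Proof. by move=> zP uP vP; rewrite /conflict; pt. Qed.

Ltac pt_conflict :=
  lazymatch goal with
  | |- ptime (fun _ => conflict _ _ _) => apply: ptime_conflict
  end.
Ltac pt_user ::= first [pt_lib | pt_num | pt_data | pt_conflict].

Lemma ptime_absorbs {X} {cX : code X} (z : X -> data) (u v : X -> nat) :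
  ptime z -> ptime u -> ptime v -> ptime (fun x => absorbs (z x) (u x) (v x)).
Proof. by move=> zP uP vP; rewrite /absorbs; pt. Qed.

Lemma ptime_insert {X} {cX : code X} (z : X -> data) (u : X -> nat) (M : X -> forest) :
  ptime z -> ptime u -> ptime M -> ptime (fun x => insert (z x) (u x) (M x)).
Proof. by move=> zP uP MP; rewrite /insert /forest; pt. Qed.

Ltac pt_insert :=
  lazymatch goal with
  | |- ptime (fun _ => absorbs _ _ _) => apply: ptime_absorbs
  | |- ptime (fun _ => insert _ _ _) => apply: ptime_insert
  | |- ptime (fun _ => match _ with nil => _ | cons _ _ => _ end) => apply: ptime_case'
  end.
Ltac pt_user ::= first [pt_lib | pt_num | pt_data | pt_conflict | pt_insert].

Lemma ptime_cluster_step {X} {cX : code X} (z : X -> data)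
    (s : X -> forest * seq (nat * nat)) (u : X -> nat) :
  ptime z -> ptime s -> ptime u -> ptime (fun x => cluster_step (z x) (s x) (u x)).
Proof. by move=> zP uP MP; rewrite /cluster_step /forest; pt. Qed.

Lemma esize_all {X} {cX : code X} (s : seq X) m :
  (forall x, List.In x s -> esize x <= m) -> esize s <= size s * m.+1 + 1.
Proof.
elim: s => // x s IH H; rewrite esize_cons /= mulSn.
have le_x : esize x <= m by apply: H; left.
have := IH (fun y ys => H y (or_intror ys)); lia.
Qed.

(** An insertion copies a whole path, so its growth is not controlled by the new point alone. But a
    new path is an old one with one new point, hence never larger than the list read so far. *)
Lemma clusters_size z l :
  let s := clusters z l in
  [/\ forall p, p \in s.1 -> esize p <= esize l,
      forall a, a \in s.2 -> esize a <= 2 * esize l + 1,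
      size s.1 <= size l & size s.2 = size l].
Proof.
rewrite /clusters /=; elim/last_ind: l => [|l x] //=.
rewrite foldl_rcons; set s := foldl _ _ l => -[IH1 IH2 IH3 IH4].
have hd p : esize (head 0 p) <= esize p.
  by case: p => [|y p] //; rewrite esize_cons /=; lia.
rewrite size_rcons !esize_rcons /cluster_step.
case F: [seq p <- s.1 | _] => [|p t]; split=> /=.
- move=> p; rewrite /insert mem_cat inE => /or3P[/mem_take| |/mem_drop].
  + by move/IH1; lia.
  + move=> /eqP->; rewrite esize_cons; set k := find _ _.
    have le_nth : esize (nth [::] s.1 k) <= esize l; last by lia.
    have [lt_k|ge_k] := ltnP k (size s.1); first by apply: IH1; rewrite mem_nth.
    by rewrite nth_default // esize_gt0.
  + by move/IH1; lia.
- move=> a; rewrite inE => /orP[/eqP->|/IH2]; last by lia.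
  by rewrite esize_pair; lia.
- rewrite size_cat /= addnS -size_cat cat_take_drop; lia.
- by rewrite IH4.
- by move=> q /IH1; lia.
- move=> a; rewrite inE => /orP[/eqP->|/IH2]; last by lia.
  have : p \in [seq p <- s.1 | absorbs z (head 0 p) x] by rewrite F mem_head.
  rewrite mem_filter => /andP[_ /IH1 le_p].
  by have := hd p; rewrite esize_pair; lia.
- by lia.
- by rewrite IH4.
Qed.

Lemma In_mem (X : eqType) (x : X) s : List.In x s -> x \in s.
Proof.
by elim: s => //= y s IH; rewrite inE => -[->|/IH->]; rewrite ?eqxx ?orbT.
Qed.

Lemma ptime_clusters {X} {cX : code X} (z : X -> data) (l : X -> seq nat) :
  ptime z -> ptime l -> ptime (fun x => clusters (z x) (l x)).
Proof.
move=> zP lP; rewrite /clusters; apply: (ptime_foldl (q := fun x =>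
  (esize (l x) * (esize (l x) + 1) + 1) +
  (esize (l x) * (2 * esize (l x) + 1 + 1) + 1) + 1)); try by pt.
  by apply: ptime_cluster_step; pt.
move=> x k; have [] := clusters_size (z x) (take k (l x)); rewrite /clusters.
case: (foldl _ _ _) => M A /= H1 H2 H3 H4; rewrite esize_pair.
pose proof (esize_take k (l x)) as le_k.
pose proof (size_le_esize (take k (l x))) as sz_k.
pose proof (esize_all (fun p pM => H1 p (In_mem pM))) as szM.
pose proof (esize_all (fun a aA => H2 a (In_mem aA))) as szA.
rewrite addn1 ltnS; apply: leq_add.
  by apply: leq_trans szM _; rewrite leq_add2r; apply: leq_mul; lia.
by apply: leq_trans szA _; rewrite leq_add2r; apply: leq_mul; lia.
Qed.

Lemma esize_filterC {X} {cX : code X} (P : pred X) s :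
  esize (filter P s) + esize [seq y <- s | ~~ P y] = esize s + 1.
Proof. by elim: s => //= y s IH; case: (P y) => /=; rewrite !esize_cons; lia. Qed.

Lemma ptime_load_order {X} {cX : code X} (C : X -> seq nat) (n : X -> nat) :
  ptime C -> ptime n -> ptime (fun x => load_order (C x) (n x)).
Proof.
move=> CP nP; rewrite /load_order; apply: (ptime_foldl_add (q := fun z => esize z.2 + 1)).
- by rewrite /by_load; pt.
- by pt.
- by pt.
- by pt.
move=> x b y; rewrite /by_load.
rewrite -(leq_add2r 1) esize_cat esize_cons /=.
pose proof (esize_filterC (fun i => nth 0 (C x) i < nth 0 (C x) y) b); lia.
Qed.

Lemma ptime_center {X} {cX : code X} (z : X -> data) (v : X -> nat) :
  ptime z -> ptime v -> ptime (fun x => center (z x) (v x)).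
Proof.
move=> zP vP; rewrite /center; apply: (ptime_foldl_add (q := fun z => esize z.2)); try by pt.
by move=> x b s; rewrite addnC; apply: esize_if.
Qed.

Ltac pt_center :=
  lazymatch goal with
  | |- ptime (fun _ => center _ _) => apply: ptime_center
  | |- ptime (fun _ => clusters _ _) => apply: ptime_clusters
  | |- ptime (fun _ => load_order _ _) => apply: ptime_load_order
  end.
Ltac pt_user ::= first [pt_lib | pt_num | pt_data | pt_conflict | pt_insert | pt_center].

Lemma ptime_total_cost {X} {cX : code X} (z : X -> data) (T : X -> forest) :
  ptime z -> ptime T -> ptime (fun x => total_cost (z x) (T x)).
Proof. by move=> zP TP; rewrite /total_cost /forest; pt. Qed.

Lemma ptime_served {X} {cX : code X} (A : X -> seq (nat * nat)) (T : X -> forest) :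
  ptime A -> ptime T -> ptime (fun x => served (A x) (T x)).
Proof. by move=> AP TP; rewrite /served /forest; pt. Qed.

Ltac pt_cost :=
  lazymatch goal with
  | |- ptime (fun _ => total_cost _ _) => apply: ptime_total_cost
  | |- ptime (fun _ => served _ _) => apply: ptime_served
  end.
Ltac pt_user ::= first [pt_lib | pt_num | pt_data | pt_conflict | pt_insert | pt_center
  | pt_cost].

Lemma ptime_cheapest {X} {cX : code X} (z : X -> data) (l : X -> seq forest) :
  ptime z -> ptime l -> ptime (fun x => cheapest (z x) (l x)).
Proof.
move=> zP lP; apply: (ptime_foldl_add (q := fun z => esize z.2 + 2)); try by pt.
move=> x [|T' b] T; first by rewrite esize_cons /= !esize_nil; lia.
case: ifP => _; first by lia.
by rewrite [esize [:: T]]esize_cons esize_nil /=; lia.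
Qed.

Lemma ptime_knapsack_step {X} {cX : code X} (z : X -> data) (A : X -> seq (nat * nat))
    (E : X -> seq forest) (p : X -> seq nat) :
  ptime z -> ptime A -> ptime E -> ptime p ->
  ptime (fun x => knapsack_step (z x) (A x) (E x) (p x)).
Proof.
move=> zP AP EP pP; rewrite /knapsack_step; pt.
by apply: ptime_cheapest; pt.
Qed.

Lemma cheapest_mem z l T : T \in cheapest z l -> T \in l.
Proof.
rewrite /cheapest; elim/last_ind: l T => //= l T' IH T.
rewrite foldl_rcons mem_rcons inE; case F: (foldl _ _ l) IH => [|T0 b] IH.
  by rewrite inE => ->.
by case: ifP => _; [move/IH-> ; rewrite orbT | rewrite inE => ->].
Qed.

Lemma size_cheapest z l : size (cheapest z l) <= 1.
Proof.
rewrite /cheapest; elim/last_ind: l => //= l T'; rewrite foldl_rcons.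
by case: (foldl _ _ l) => // T0 b IH; case: ifP.
Qed.

Lemma knapsack_mem z A M T : T \in knapsack z A M -> subseq (rev T) M.
Proof.
rewrite /knapsack; elim/last_ind: M T => [|M p IH] T; first by rewrite inE => /eqP->.
rewrite foldl_rcons mem_cat => /orP[/IH sub|].
  exact: subseq_trans sub (subseq_rcons _ _).
case/flattenP=> l /mapP[j _ ->] /cheapest_mem.
rewrite mem_filter => /andP[_ /mapP[T0 /IH sub ->]].
by rewrite rev_cons -!cats1 cat_subseq.
Qed.

(** Since [cheapest] returns at most one choice, the table gains at most one entry per path and
    count instead of doubling. *)
Lemma size_knapsack z A M : size (knapsack z A M) <= 1 + size M * (size A).+1.
Proof.
rewrite /knapsack; elim/last_ind: M => //= M p IH.
rewrite foldl_rcons size_cat size_rcons size_flatten /shape -map_comp mulSn.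
rewrite addnCA [_ + (1 + _)]addnC; apply: leq_add IH _.
rewrite -[X in _ <= X](size_iota 0); elim: (iota _ _) => //= j l IHl.
by have := size_cheapest z [seq T <- [seq p :: T | T <- foldl (knapsack_step z A) [:: [::]] M]
  | served A T == j]; rewrite /=; lia.
Qed.

Lemma esize_subseq {X : eqType} {cX : code X} (s t : seq X) :
  subseq s t -> esize s <= esize t.
Proof.
elim: t s => [|y t IH] [|x s] //=.
by rewrite !esize_cons; case: eqP => [->|_] /IH; rewrite ?esize_cons; lia.
Qed.

Lemma esize_rev {X} {cX : code X} (s : seq X) : esize (rev s) = esize s.
Proof. by elim: s => // x s IH; rewrite rev_cons esize_rcons esize_cons IH addnC. Qed.

Lemma ptime_knapsack {X} {cX : code X} (z : X -> data) (A : X -> seq (nat * nat))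
    (M : X -> forest) :
  ptime z -> ptime A -> ptime M -> ptime (fun x => knapsack (z x) (A x) (M x)).
Proof.
move=> zP AP MP; rewrite /knapsack; apply: (ptime_foldl (q := fun x =>
  (1 + esize (M x) * (esize (A x) + 1)) * (esize (M x) + 1) + 1)); try by pt.
  by apply: ptime_knapsack_step; pt.
move=> x k; rewrite -/(knapsack _ _ _).
have szT T : List.In T (knapsack (z x) (A x) (take k (M x))) -> esize T <= esize (M x).
  move=> /In_mem/knapsack_mem/esize_subseq; rewrite esize_rev => le_T.
  exact: leq_trans le_T (esize_take _ _).
apply: leq_trans (esize_all szT) _; rewrite leq_add2r.
apply: leq_mul; last by lia.
apply: leq_trans (size_knapsack _ _ _) _; rewrite leq_add2l; apply: leq_mul.
  exact: leq_trans (size_le_esize _) (esize_take _ _).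
by pose proof (size_le_esize (A x)); lia.
Qed.

Ltac pt_knapsack :=
  lazymatch goal with
  | |- ptime (fun _ => knapsack _ _ _) => apply: ptime_knapsack
  end.
Ltac pt_user ::= first [pt_lib | pt_num | pt_data | pt_conflict | pt_insert | pt_center
  | pt_cost | pt_knapsack].

Lemma ptime_solutions {X} {cX : code X} (z : X -> data) (M : X -> forest)
    (A : X -> seq (nat * nat)) :
  ptime z -> ptime M -> ptime A -> ptime (fun x => solutions (z x) (M x) (A x)).
Proof. by move=> zP MP AP; rewrite /solutions /mask; pt. Qed.

Lemma ptime_round {X} {cX : code X} (z : X -> data) (s : X -> seq nat * seq (seq bool)) :
  ptime z -> ptime s -> ptime (fun x => round (z x) (s x)).
Proof.
move=> zP sP; rewrite /round /new_load; pt.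
by apply: ptime_solutions; pt.
Qed.

Lemma perm_by_load C l x : perm_eq (by_load C l x) (x :: l).
Proof.
rewrite /by_load perm_catC /= perm_cons perm_catC.
exact: (permEl (perm_filterC (fun y => nth 0 C y < nth 0 C x) l)).
Qed.

Lemma perm_load_order C n : perm_eq (load_order C n) (iota 0 n).
Proof.
rewrite /load_order; elim/last_ind: (iota 0 n) => // l x IH.
rewrite foldl_rcons (perm_trans (perm_by_load _ _ _)) //.
by rewrite perm_sym perm_rcons perm_cons perm_sym.
Qed.

Definition rounds (z : data) (k : nat) : seq nat * seq (seq bool) :=
  iter k (round z) ([::], [::]).

Lemma foldl_nseq {T} (f : T -> T) x k : foldl (fun s (_ : unit) => f s) x (nseq k tt) = iter k f x.
Proof. by elim: k x => //= k IH x; rewrite IH -iterSr. Qed.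

Lemma searchE z :
  search z = (rounds z (points z * points z * points z).+1).2.
Proof. by rewrite /search foldl_nseq. Qed.

(** Loads are stored in unary. They stay polynomial because a round adds at most the number of
    points to each, and the number of rounds is polynomial. *)
Lemma rounds_size z k :
  [/\ size (rounds z k).1 <= points z,
      forall v, nth 0 (rounds z k).1 v <= k * points z,
      size (rounds z k).2 <= 1 &
      forall l, l \in (rounds z k).2 -> size l = points z].
Proof.
elim: k => [|k [IH1 IH2 IH3 IH4]]; first by split=> // v; rewrite nth_nil.
rewrite /rounds iterS -/(rounds z k) /round /=.
have [_ _ _ szA] := clusters_size z (load_order (rounds z k).1 (points z)).
rewrite (perm_size (perm_load_order _ _)) size_iota in szA.
split.
- by rewrite size_map size_iota.
- move=> v; have [lt_v|ge_v] := ltnP v (points z); last first.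
    by rewrite nth_default // size_map size_iota.
  rewrite (nth_map 0) ?size_iota // nth_iota // add0n mulSn addnC.
  by apply: leq_add (IH2 v); rewrite -[X in _ <= X]szA count_size.
- case: (rounds z k).2 IH3 => // _; rewrite size_take_min geq_minl //.
- move=> l; case: (rounds z k).2 IH4 => [_ /mem_take|a s]; last by apply.
  by case/mapP=> T _ ->; rewrite size_map size_iota.
Qed.

Lemma ptime_search {X} {cX : code X} (z : X -> data) :
  ptime z -> ptime (fun x => search (z x)).
Proof.
move=> zP; rewrite /search; apply: ptime_snd; pose (n := fun x => points (z x)).
have nP : ptime n by rewrite /n; pt.
apply: (ptime_foldl (q := fun x => esize (n x) * (2 * ((esize (n x) * esize (n x) *
  esize (n x) + 1) * esize (n x)) + 2) + 1 + (4 * esize (n x) + 6) + 1)); try by pt.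
  by apply: ptime_round; pt.
move=> x k; rewrite -/(n x).
have [j le_j ->] : exists2 j, j <= (n x * n x * n x).+1 &
    take k (nseq (n x * n x * n x).+1 tt) = nseq j tt.
  exists (minn k (n x * n x * n x).+1); first exact: geq_minr.
  by case: leqP => [le|/ltnW le]; [rewrite take_nseq | rewrite take_oversize ?size_nseq].
rewrite foldl_nseq -/(rounds (z x) j).
have [] := rounds_size (z x) j; case: (rounds _ _) => C sols /= H1 H2 H3 H4.
have szC : esize C <= size C * (2 * (j * n x) + 2) + 1.
  rewrite addn2; apply: esize_all => y /In_mem /(nthP 0)[i _ <-].
  by rewrite esize_nat ltnS -mul2n leq_mul2l H2.
have szS : esize sols <= size sols * (4 * n x + 4).+1 + 1.
  apply: esize_all => y /In_mem /H4 sz_y.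
  by apply: leq_trans (esize_num y) _; rewrite sz_y /n; lia.
have le_n : n x <= esize (n x) by rewrite esize_nat; lia.
rewrite esize_pair addn1 ltnS; apply: leq_add.
  apply: leq_trans szC _; rewrite leq_add2r; apply: leq_mul.
    by apply: leq_trans H1 _.
  rewrite leq_add2r leq_mul2l; apply: leq_mul => //.
  apply: leq_trans le_j _; rewrite addn1 ltnS; do ![apply: leq_mul => //].
apply: leq_trans szS _.
have : size sols * (4 * n x + 4).+1 <= 1 * (4 * n x + 4).+1 by rewrite leq_mul2r H3 orbT.
lia.
Qed.

Ltac pt_search :=
  lazymatch goal with
  | |- ptime (fun _ => search _) => apply: ptime_search
  end.
Ltac pt_user ::= first [pt_lib | pt_num | pt_data | pt_conflict | pt_insert | pt_center
  | pt_cost | pt_knapsack | pt_search].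

Lemma ptime_scale {X} {cX : code X} (z : X -> data) (u v : X -> nat) :
  ptime z -> ptime u -> ptime v -> ptime (fun x => scale (z x) (u x) (v x)).
Proof. by move=> zP uP vP; rewrite /scale; pt. Qed.

Lemma ptime_better {X} {cX : code X} (z : X -> data) (b : X -> seq (num * num * seq bool))
    (u v : X -> nat) :
  ptime z -> ptime b -> ptime u -> ptime v ->
  ptime (fun x => better (z x) (b x) (u x) (v x)).
Proof. by move=> zP bP uP vP; rewrite /better; pt; apply: ptime_scale; pt. Qed.

Lemma ptime_solve {X} {cX : code X} (z : X -> data) :
  ptime z -> ptime (fun x => solve (z x)).
Proof.
move=> zP; rewrite /solve /all_pairs; pt.
apply: (ptime_foldl_add (q := fun w =>
  esize (search (scale (z w.1) w.2.1 w.2.2)) + esize (dst (z w.1) w.2.1 w.2.2)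
  + esize (rad (z w.1) w.2.2) + 4)); try by pt.
- by apply: ptime_better; pt.
- by pt; apply: ptime_scale; pt.
move=> x b p; rewrite /better; case: (search _) => [|sol l] /=; first by lia.
rewrite esize_cons.
have sz1 : esize [:: (dst (z x) p.1 p.2, rad (z x) p.2, sol)] =
   esize sol + esize (dst (z x) p.1 p.2) + esize (rad (z x) p.2) + 4.
  by rewrite esize_cons esize_nil !esize_pair; lia.
case: b => [|a b]; first by rewrite sz1; lia.
by case: ifP => _; rewrite ?sz1; lia.
Qed.

Lemma ptime_omatch {X Y Z} {cX : code X} {cY : code Y} {cZ : code Z}
    (o : X -> option Y) (f : X -> Z) (g : X -> Y -> Z) :
  ptime o -> ptime f -> ptime (fun z : X * Y => g z.1 z.2) ->
  ptime (fun x => match o x with Some y => g x y | None => f x end).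
Proof.
move=> oP fP gP; apply: (ptime_ext (f := fun x =>
    match seq_of_opt (o x) with [::] => f x | y :: _ => g x y end)).
  apply: (ptime_case' (g := fun x y _ => g x y)) => //.
    by apply: ptime_recode oP _ => x; case: (o x).
  by apply: (ptime_comp (f := fun w => (w.1, w.2.1)) gP); pt.
by move=> x; case: (o x).
Qed.

Lemma ptime_split_word {X} {cX : code X} (w : X -> seq symbol) :
  ptime w -> ptime (fun x => split_word (w x)).
Proof.
move=> wP; rewrite /split_word; pt.
apply: (ptime_foldl_add (q := fun=> 6)); try by pt.
  by apply: ptime_omatch; pt.
move=> x [u l] [b|]; rewrite !esize_pair /= ?esize_cons ?esize_rev ?esize_nil; last by lia.
have := esize_bool b; lia.
Qed.

Lemma ptime_unary {X} {cX : code X} (s : X -> num) (k : X -> nat) :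
  ptime s -> ptime k -> ptime (fun x => unary (s x) (k x)).
Proof.
move=> sP kP; apply: (ptime_foldl_add (q := fun z => esize (k z.1))); try by pt.
by move=> x m b; rewrite !esize_nat; have := geq_minr (if b then (m + m).+1 else m + m) (k x);
  rewrite /=; lia.
Qed.

Lemma ptime_cleared {X} {cX : code X} (l : X -> seq num) (m k : X -> nat) :
  ptime l -> ptime m -> ptime k -> ptime (fun x => cleared (l x) (m x) (k x)).
Proof. by move=> lP mP kP; rewrite /cleared; pt. Qed.

Ltac pt_parse :=
  lazymatch goal with
  | |- ptime (fun _ => split_word _) => apply: ptime_split_word
  | |- ptime (fun _ => unary _ _) => apply: ptime_unary
  | |- ptime (fun _ => cleared _ _ _) => apply: ptime_cleared
  end.
Ltac pt_user ::= first [pt_lib | pt_num | pt_parse].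

Lemma ptime_parse {X} {cX : code X} (w : X -> seq symbol) :
  ptime w -> ptime (fun x => parse (w x)).
Proof. by move=> wP; rewrite /parse; pt. Qed.

Lemma ptime_algorithm : ptime algorithm.
Proof. by apply: ptime_solve; apply: ptime_parse; pt. Qed.

(** * Correctness of the algorithm *)

(* The perceptron argument: the loads move along a direction that correlates
   with the indicator of the covered points, yet their squared norm grows only
   linearly. The last step bounds [(C v - k) ^ 2] from below by its tangent at
   [n ^ 2], so that no Cauchy-Schwarz inequality is needed. *)
Lemma perceptron n K m (cov : nat -> bool) (C g : nat -> nat -> nat) :
  (forall v, C 0 v = 0) ->
  (forall k v, k < K -> v < n -> C k.+1 v = C k v + g k v) ->
  (forall k, k < K -> \sum_(v <- iota 0 n) g k v = n) ->
  (forall k, k < K ->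
     \sum_(v <- iota 0 n) g k v * C k v <= \sum_(v <- iota 0 n) C k v) ->
  (forall k, k < K -> \sum_(v <- iota 0 n) cov v * g k v < m) ->
  m <= \sum_(v <- iota 0 n) cov v ->
  K <= n * n * n.
Proof.
move=> C0 CS sumg sumgC lt_m le_m; set s := iota 0 n.
have ltn v : v \in s -> v < n by rewrite mem_iota.
(* The mean load is k. Centred by it, the loads have squared norm at most n^2 k by the second bound,
   and by the third the covered points together fall short of the mean by at least k. *)
have inv k : k <= K -> [/\ \sum_(v <- s) C k v = n * k,
    \sum_(v <- s) C k v * C k v <= n * k * k + n * n * k &
    \sum_(v <- s) cov v * C k v + k <= (\sum_(v <- s) cov v) * k].
  elim: k => [_|k IH lt_k].
    by split; rewrite ?muln0 big1 // => v _; rewrite C0 ?muln0.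
  have [I1 I2 I3] := IH (ltnW lt_k).
  have sg2 : \sum_(v <- s) g k v * g k v <= n * n.
    rewrite -{2}(sumg k lt_k) big_distrr /= big_seq [X in _ <= X]big_seq.
    apply: leq_sum => v vs; rewrite leq_mul2r -{1}(sumg k lt_k).
    by rewrite (big_rem v) //= leq_addr orbT.
  have := sumg k lt_k; have := sumgC k lt_k; have := lt_m k lt_k.
  rewrite -/s; set G := \sum_(v <- s) g k v; set GC := \sum_(v <- s) g k v * C k v.
  set VG := \sum_(v <- s) cov v * g k v => ltV leGC eG.
  split.
  - rewrite big_seq (eq_bigr (fun v => C k v + g k v)) -?big_seq.
      by rewrite big_split /= I1 -/G eG mulnS addnC.
    by move=> v vs; rewrite CS // ltn.
  - rewrite big_seq (eq_bigr (fun v => C k v * C k v + (2 * (g k v * C k v) + g k v * g k v)))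
      -?big_seq; last first.
      by move=> v vs; rewrite CS ?ltn //; move: (C k v) (g k v) => x y; nia.
    rewrite big_split big_split /= -big_distrr /= -/GC; move: I1 I2 leGC sg2.
    set a := \sum_(v <- s) C k v; set b := \sum_(v <- s) C k v * _.
    set c := \sum_(v <- s) g k v * g k v; nia.
  - have -> : \sum_(v <- s) cov v * C k.+1 v =
        \sum_(v <- s) (cov v * C k v + cov v * g k v).
      by rewrite big_seq [RHS]big_seq; apply: eq_bigr => v vs; rewrite CS ?ltn // mulnDr.
    rewrite big_split /= -/VG; move: I3 le_m ltV; rewrite -/s.
    move: VG (\sum_(v <- s) cov v * C k v) (\sum_(v <- s) cov v) => {}VG a c.
    rewrite mulnS; nia.
have [I1 I2 I3] := inv K (leqnn K).
(* For a covered point this expands the square of C + n^2 - K, for any other point that of C - K. *)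
have key : \sum_(v <- s) (2 * K * C K v + 2 * (n * n) * K * cov v) <=
    \sum_(v <- s) (C K v * C K v + K * K + (n * n) * (n * n) * cov v
      + 2 * (n * n) * (cov v * C K v)).
  apply: leq_sum => v _; case: (cov v); rewrite ?muln1 ?muln0 ?mul1n ?mul0n ?addn0.
    by have := (nat_Cauchy K (C K v + n * n)).1; rewrite !expnS !expn0; nia.
  by have := (nat_Cauchy K (C K v)).1; rewrite !expnS !expn0; nia.
have cst k : \sum_(v <- s) k = n * k.
  by rewrite big_const_seq count_predT iter_addn_0 size_iota mulnC.
rewrite !big_split /= -!big_distrr /= I1 cst in key.
have le_c : \sum_(v <- s) cov v <= n.
  rewrite -[X in _ <= X](size_iota 0) -/s -sum1_size.
  by apply: leq_sum => v _; case: (cov v).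
move: I2 I3 key le_c; move: (\sum_(v <- s) cov v) (\sum_(v <- s) cov v * C K v)
  (\sum_(v <- s) C K v * C K v) => c a b.
clear; case: n => [|n]; first by nia.
move: n.+1 (ltn0Sn n) => {}n n_gt0 I2 I3 key le_c.
(* With c covered points of total load a, [key] and [I2] give 2 n^2 (c K - a) <= n^2 K + n^4 c.
   Since c K - a >= K and c <= n, what remains is n^2 K <= n^5. *)
have : n * n * K <= (n * n) * (n * n * n).
  have : (n * n) * (n * n) * c <= (n * n) * (n * n) * n by rewrite leq_mul2l le_c orbT.
  have : 2 * (n * n) * (a + K) <= 2 * (n * n) * (c * K) by rewrite leq_mul2l I3 orbT.
  move: I2 key; rewrite !mulnDr !mulnA; lia.
by rewrite leq_pmul2l ?muln_gt0 ?n_gt0.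
Qed.

Lemma subseq_cons_nth (T : eqType) (d x : T) s M :
  subseq (x :: s) M ->
  exists i, [/\ i < size M, nth d M i = x & subseq s (drop i.+1 M)].
Proof.
elim: M => //= y M IH; case: eqP => [->|_] sub; first by exists 0; rewrite drop0.
by have [i [lt_i <- sub']] := IH sub; exists i.+1.
Qed.

Lemma sub_in_count (T : eqType) (a b : pred T) s :
  {in s, forall x, a x -> b x} -> count a s <= count b s.
Proof.
elim: s => //= x s IH sub; apply: leq_add.
  by have := sub x (mem_head _ _); case: (a x) => // ->.
by apply: IH => y ys; apply: sub; rewrite inE ys orbT.
Qed.

Lemma subseq_rcons2 (T : eqType) (x y : T) s t :
  subseq (rcons s x) (rcons t y) -> x = y /\ subseq s t \/ subseq (rcons s x) t.
Proof.
rewrite -subseq_rev !rev_rcons /=; case: eqP => [->|_].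
  by rewrite subseq_rev; left.
by rewrite -rev_rcons subseq_rev; right.
Qed.

(** * Geometry of the clusters and the forest *)

Section Correctness.
Variable z : data.
Let n := points z.
Let d u v := num_val (dst z u v).
Let r v := num_val (rad z v).
Let w v := num_val (wgt z v).
Hypothesis d_refl : forall u, u < n -> d u u = 0.
Hypothesis d_sym : forall u v, u < n -> v < n -> d u v = d v u.
Hypothesis d_tri : forall u v x, u < n -> v < n -> x < n -> d u x <= d u v + d v x.

Lemma conflictE u v :
  conflict z u v = (d u v <= 2 * r u + r v) && (d u v <= r u + 2 * r v).
Proof. by rewrite /conflict !num_leE !val_num_add !mulSn !mul0n !addn0. Qed.

Lemma absorbsE u v : absorbs z u v = conflict z u v && (r u <= 4 * r v).
Proof.
rewrite /absorbs num_leE !val_num_add -/(r u) -/(r v); congr (_ && (_ <= _)); lia.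
Qed.

Lemma conflict_sym u v : u < n -> v < n -> conflict z u v = conflict z v u.
Proof. by move=> un vn; rewrite !conflictE d_sym // andbC; congr (_ && _); rewrite addnC. Qed.

Notation hd := (head 0).

(** A path contains [e] when its first node is [e] or a descendant of [e]. The last two fields
    express reverse preorder: the entries of a subtree are contiguous, and its root comes last among
    them. *)
Record forest_ok (M : forest) (done : seq nat) : Prop := ForestOk {
  fo_cons : forall p, p \in M -> p != [::];
  fo_done : forall p, p \in M -> {subset p <= done};
  fo_lt : forall x, x \in done -> x < n;
  fo_uniq : uniq (map hd M);
  fo_ratio : forall p q, p \in M -> q \in M -> hd p != hd q ->
    conflict z (hd p) (hd q) -> 4 * r (hd p) < r (hd q) \/ 4 * r (hd q) < r (hd p);
  fo_parent : forall p, p \in M -> behead p = [::] \/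
    [/\ behead p \in M, conflict z (hd p) (hd (behead p)) &
        4 * r (hd p) < r (hd (behead p))];
  fo_anc : forall p q, p \in M -> q \in M -> conflict z (hd p) (hd q) ->
    4 * r (hd p) < r (hd q) -> hd q \in p;
  fo_between : forall i j k e, i <= j <= k -> e \in nth [::] M i ->
    e \in nth [::] M k -> e \in nth [::] M j;
  fo_order : forall i j, j < size M -> hd (nth [::] M j) \in nth [::] M i -> i <= j
}.

Lemma hd_mem (p : seq nat) : p != [::] -> hd p \in p.
Proof. by case: p => // x p _; rewrite mem_head. Qed.

Lemma nth_insert (M : forest) k X i : k <= size M ->
  nth [::] (take k M ++ X :: drop k M) i =
  if i == k then X else nth [::] M (if i <= k then i else i.-1).
Proof.
move=> le_k; rewrite nth_cat size_takel //.
case: (ltngtP i k) => [lt|gt|->]; first by rewrite nth_take.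
  by rewrite -[i - k]prednK ?subn_gt0 //= nth_drop; congr nth; lia.
by rewrite subnn.
Qed.

(** As no node absorbs [x], every node in conflict with [x] has more than 4 times its radius; hence
    [x] enters as a leaf. The delicate point is that all these nodes lie on the path of the first of
    them. *)
Lemma insert_ok M done x : forest_ok M done -> x \notin done -> x < n ->
  (forall p, p \in M -> ~~ absorbs z (hd p) x) ->
  forest_ok (insert z x M) (x :: done).
Proof.
case=> fc fd fl fu fr fp fa fb fo xN xn nabs.
rewrite /insert; set k := find _ M; set X := x :: nth _ _ _.
have le_k : k <= size M by exact: find_size.
have memM p : (p \in take k M ++ X :: drop k M) = (p == X) || (p \in M).
  by rewrite -[in RHS](cat_take_drop k M) !mem_cat inE orbCA.
have hdn p : p \in M -> hd p < n by move=> pM; apply/fl/(fd _ pM)/hd_mem/fc.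
have xNp p : p \in M -> x \notin p by move=> pM; apply: contra xN; apply: fd.
have big p : p \in M -> conflict z x (hd p) -> 4 * r x < r (hd p).
  move=> pM; rewrite conflict_sym ?hdn // => c; have := nabs p pM.
  by rewrite absorbsE c /= ltnNge.
have xNhd p : p \in M -> hd p != x.
  by move=> pM; apply: contra (xNp p pM) => /eqP <-; apply: hd_mem; apply: fc.
have par : nth [::] M k = [::] \/ [/\ nth [::] M k \in M &
    conflict z x (hd (nth [::] M k))].
  have [lt_k|ge_k] := ltnP k (size M); last by left; rewrite nth_default.
  right; split; first exact: mem_nth.
  have hasP : has (fun p => conflict z x (hd p)) M by rewrite has_find.
  exact: (nth_find [::] hasP).
have subX : {subset nth [::] M k <= X} by move=> e eM; rewrite /X in_cons eM orbT.
split.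
- by move=> p; rewrite memM => /orP[/eqP->|/fc].
- move=> p; rewrite memM => /orP[/eqP->|pM] e; last first.
    by move=> /(fd _ pM) ed; rewrite inE ed orbT.
  rewrite /X !in_cons => /orP[->//|eM]; case: par => [E|[kM _]]; first by rewrite E in eM.
  by rewrite (fd _ kM e eM) orbT.
- by move=> y; rewrite inE => /orP[/eqP->|/fl].
- have pM : perm_eq (take k M ++ X :: drop k M) (X :: M).
    by rewrite perm_catC /= perm_cons perm_catC cat_take_drop.
  rewrite (perm_uniq (perm_map hd pM)) /= fu andbT.
  by apply/mapP => -[p pM' xE]; have := xNhd p pM'; rewrite -xE eqxx.
- move=> p q; rewrite !memM => /orP[/eqP->|pM] /orP[/eqP->|qM] //=.
  + by rewrite eqxx.
  + by move=> _ /(big _ qM); left.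
  + by rewrite conflict_sym ?hdn // => _ /(big _ pM); right.
  + exact: fr.
- move=> p; rewrite memM => /orP[/eqP->|pM] /=; last first.
    by case: (fp _ pM) => [->|[pM' ? ?]]; [left | right; rewrite memM pM' orbT].
  case: par => [->|[kM c]]; first by left.
  by right; rewrite memM kM orbT; split=> //; apply: big.
- move=> p q; rewrite !memM => /orP[/eqP->|pM] /orP[/eqP->|qM] //=.
  + by rewrite mem_head.
  + move=> c lt_q; case: par => [E|[kM ck]].
      have := nth_default [::] (leqnn (size M)).
      have: ~~ has (fun p => conflict z x (hd p)) M.
        rewrite has_find -leqNgt leqNgt; apply/negP => lt_k.
        by have := fc _ (mem_nth [::] lt_k); rewrite -/k E.
      by move/hasPn/(_ q qM); rewrite c.
    have [/eqP hq|neq] := boolP (hd (nth [::] M k) == hd q).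
      by rewrite -hq; apply/subX/hd_mem/fc.
    (* Going through [x] costs 4 r(x) beyond the two radii, which is less than either radius. *)
    have ckq : conflict z (hd (nth [::] M k)) (hd q).
      have := big _ kM ck; have := big _ qM c; move: ck c.
      rewrite !conflictE; have := d_tri (hdn _ kM) xn (hdn _ qM).
      rewrite (d_sym (hdn _ kM) xn); lia.
    case: (fr _ _ kM qM neq ckq) => lt.
      exact/subX/fa.
    (* In the remaining case the chosen parent would be a proper ancestor of [q]. Then [q] is listed
       before it by [fo_order], although the parent is the first conflicting entry. *)
    have hk : hd (nth [::] M k) \in q.
      by apply: fa => //; rewrite conflict_sym ?hdn.
    have [lt_k|ge_k] := ltnP k (size M); last by have := fc _ kM; rewrite nth_default.
    have [j lt_j qE] := nthP [::] qM.
    have := fo j k lt_k; rewrite qE => /(_ hk) le_j.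
    have : ~~ conflict z x (hd (nth [::] M j)) \/ j = k.
      case: (ltngtP j k) le_j => // [lt_jk _|->]; last by right.
      left; apply/negbT; exact: (before_find [::] lt_jk).
    rewrite qE c => -[//|jk]; by rewrite -qE jk eqxx in neq.
  + rewrite conflict_sym ?hdn // => /(big _ pM) lt1 lt2; lia.
  + exact: fa.
(* The point [x] occurs only in the new path. For any other [e] the new path behaves like a second
   copy of entry [k], so the claim reduces to the old list with shifted indices. *)
- move=> i j l e le_ijl; rewrite !nth_insert //.
  have [->|neq] := eqVneq e x.
    have F i' : (x \in if i' == k then X else nth [::] M (if i' <= k then i' else i'.-1)) = (i' == k).
      case: ifP => _; first by rewrite mem_head.
      set i2 := if _ then _ else _.
      have [lt|ge] := ltnP i2 (size M); last by rewrite nth_default.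
      exact/negbTE/xNp/mem_nth.
    rewrite !F => /eqP ei /eqP el; apply/eqP; lia.
  have F i' : (e \in if i' == k then X else nth [::] M (if i' <= k then i' else i'.-1)) =
      (e \in nth [::] M (if i' <= k then i' else i'.-1)).
    by case: eqP => // ->; rewrite leqnn /X in_cons (negbTE neq).
  rewrite !F; apply: fb; case: (leqP i k); case: (leqP j k); case: (leqP l k); lia.
- move=> i j; rewrite size_cat /= addnS -size_cat cat_take_drop => lt_j.
  rewrite !nth_insert //.
  case: (eqVneq j k) => [->|neq_j] /=.
    case: eqP => [->//|_]; set i2 := if _ then _ else _.
    have [lt|ge] := ltnP i2 (size M); last by rewrite nth_default.
    by move=> /(negP (xNp _ (mem_nth [::] lt))).
  set j2 := if j <= k then _ else _.
  have lt_j2 : j2 < size M by rewrite /j2; case: (leqP j k); lia.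
  have neq : hd (nth [::] M j2) != x by apply/xNhd/mem_nth.
  have -> : (hd (nth [::] M j2) \in if i == k then X else
      nth [::] M (if i <= k then i else i.-1)) =
      (hd (nth [::] M j2) \in nth [::] M (if i <= k then i else i.-1)).
    by case: eqP => // ->; rewrite leqnn /X in_cons (negbTE neq).
  move=> /(fo _ _ lt_j2); rewrite /j2; case: (leqP i k); case: (leqP j k); lia.
Qed.

Lemma forest_ok_sub M done done' : forest_ok M done -> {subset done <= done'} ->
  (forall x, x \in done' -> x < n) -> forest_ok M done'.
Proof.
case=> fc fd fl fu fr fp fa fb fo sub lt; split=> // p pM e /(fd _ pM).
exact: sub.
Qed.

Lemma forest_ok_nil : forest_ok [::] [::].
Proof. by split=> // i j k e _; rewrite nth_nil. Qed.

Lemma mem_insert x M p :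
  (p \in insert z x M) = (p == x :: nth [::] M (find (fun p => conflict z x (hd p)) M))
    || (p \in M).
Proof.
rewrite /insert; set k := find _ M.
by rewrite -[M in _ || (p \in M)](cat_take_drop k) !mem_cat inE orbCA.
Qed.

(** The order by load enters only here: a representative comes no later than the points it absorbs,
    so its load is at most theirs. *)
Lemma clusters_ok (C : nat -> nat) l :
  uniq l -> (forall x, x \in l -> x < n) -> pairwise (fun y x => C y <= C x) l ->
  let s := clusters z l in
  [/\ forest_ok s.1 l, map fst s.2 = rev l &
      forall a, a \in s.2 -> [/\ a.2 \in map hd s.1,
         a.1 = a.2 \/ absorbs z a.2 a.1 & C a.2 <= C a.1]].
Proof.
rewrite /clusters /=; elim/last_ind: l => [|l x IH].
  by move=> _ _ _; split=> //; apply: forest_ok_nil.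
rewrite rcons_uniq pairwise_rcons foldl_rcons => /andP[xN ul] lt /andP[allC pw].
have lt' y : y \in l -> y < n by move=> yl; apply: lt; rewrite mem_rcons inE yl orbT.
have xn : x < n by apply: lt; rewrite mem_rcons mem_head.
have [fM defA inA] := IH ul lt' pw; set s := foldl _ _ l in fM defA inA *.
have sub : {subset l <= rcons l x} by move=> y yl; rewrite mem_rcons inE yl orbT.
rewrite /cluster_step rev_rcons.
case F: [seq p <- s.1 | _] => [|p t] /=; split=> /=.
- apply: (forest_ok_sub (done := x :: l)) => //; last first.
    by move=> y; rewrite mem_rcons.
  apply: insert_ok => // p pM; apply/negP => ab.
  have pF : p \in [seq p <- s.1 | absorbs z (hd p) x] by rewrite mem_filter ab.
  by rewrite F in pF.
- by rewrite defA.
- move=> a; rewrite inE => /orP[/eqP->|/inA[hM eqa leC]] /=.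
    split=> //; last by left.
    apply/mapP; exists (x :: nth [::] s.1 (find (fun p => conflict z x (hd p)) s.1)) => //.
    by rewrite mem_insert eqxx.
  split=> //; case/mapP: hM => q qM ->; apply/mapP; exists q => //.
  by rewrite mem_insert qM orbT.
- exact: (forest_ok_sub fM).
- by rewrite defA.
- have : p \in [seq p <- s.1 | absorbs z (hd p) x] by rewrite F mem_head.
  rewrite mem_filter => /andP[ab pM].
  move=> a; rewrite inE => /orP[/eqP->|/inA//] /=; split.
  + by apply/mapP; exists p.
  + by right.
  + case: fM => fc fd _ _ _ _ _ _ _; move/allP: allC; apply.
    exact/(fd _ pM)/hd_mem/fc.
Qed.

(** One step up from [x] to its parent y gives d(s, y) <= 2 r(x) + (2 r(x) + r(y)) <= 2 r(y), as 4
    r(x) < r(y). *)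
Lemma path_dist M done s p : forest_ok M done -> s < n -> p \in M ->
  d s (hd p) <= 2 * r (hd p) -> forall u, u \in p -> d s u <= 2 * r u.
Proof.
move=> fM sn; have [fc fd fl _ _ fp _ _ _] := fM.
have lt_n q u : q \in M -> u \in q -> u < n by move=> qM uq; apply/fl/(fd _ qM).
elim: p => // x p IH pM le_x u; rewrite inE => /orP[/eqP->//|up].
case: (fp _ pM) => /= [E|[p'M c lt_r]]; first by rewrite E in up.
apply: IH => //; have xn : x < n by apply: lt_n pM _; rewrite mem_head.
have yn : hd p < n := lt_n _ _ p'M (hd_mem (fc _ p'M)).
move: c le_x lt_r; rewrite conflictE /=; have := d_tri sn xn yn; lia.
Qed.

Lemma centerP v : v < n ->
  [/\ center z v < n, d (center z v) v <= r v &
      forall s, s < n -> d s v <= r v -> w (center z v) <= w s].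
Proof.
move=> vn; rewrite /center -/n; set F := fun b s => _.
have main l : (forall s, s \in l -> s < n) ->
    [/\ foldl F v l < n, d (foldl F v l) v <= r v &
      forall s, s \in l -> d s v <= r v -> w (foldl F v l) <= w s].
  elim/last_ind: l => [|l s IH] lt; first by rewrite /= d_refl.
  have [|H1 H2 H3] := IH; first by move=> t tl; apply: lt; rewrite mem_rcons inE tl orbT.
  rewrite foldl_rcons; move: H1 H2 H3; set b := foldl _ _ _ => H1 H2 H3.
  have sn : s < n by apply: lt; rewrite mem_rcons mem_head.
  rewrite /F !num_leE -/(d s v) -/(r v) -/(w b) -/(w s).
  case: ifP => [/andP[le_s lt_w]|nle]; split=> // t; rewrite mem_rcons inE.
    by move=> /orP[/eqP->//|tl] le_t; have := H3 t tl le_t; lia.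
  by move=> /orP[/eqP->|tl] le_t; [move: nle; rewrite le_t /= => /negbFE | apply: H3].
have [|H1 H2 H3] := main (iota 0 n); first by move=> s; rewrite mem_iota.
by split=> // s sn; apply: H3; rewrite mem_iota.
Qed.

(** * Optimality of the knapsack over the forest *)

Notation cost T := (num_val (total_cost z T)).

Lemma costE T : cost T = \sum_(p <- T) w (center z (hd p)).
Proof. by rewrite /total_cost val_num_sum big_map. Qed.

Lemma cheapestP l T : T \in l -> exists2 T', T' \in cheapest z l & cost T' <= cost T.
Proof.
rewrite /cheapest; elim/last_ind: l T => // l T1 IH T.
rewrite mem_rcons inE foldl_rcons => /orP[/eqP->|Tl].
  case: (foldl _ _ _) => [|T' b]; first by exists T1; rewrite ?mem_head.
  by rewrite num_leE; case: ifP => le; [exists T'; rewrite ?mem_head | exists T1; rewrite ?mem_head].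
have [T' memT' le_T'] := IH _ Tl; move: memT'.
have := size_cheapest z l; rewrite /cheapest; case: (foldl _ _ _) => // T2 [|//] _.
rewrite inE => /eqP ET; rewrite num_leE -ET; case: ifP => le.
  by exists T'; rewrite ?mem_head.
by exists T1; rewrite ?mem_head //; lia.
Qed.

(** Contiguity of subtrees, phrased on subsequences so that it passes to prefixes of [M] in
    inductions. *)
Definition between (M : forest) : Prop :=
  forall q t p, subseq [:: q; t; p] M -> forall e : nat, e \in q -> e \in p -> e \in t.

Lemma forest_between M done : forest_ok M done -> between M.
Proof.
case=> _ _ _ _ _ _ _ fb _ q t p.
move=> /(subseq_cons_nth [::])[i [_ <-]] /(subseq_cons_nth [::])[j [_ <-]].
move=> /(subseq_cons_nth [::])[k [_ <- _]] e; rewrite !nth_drop => ei ek.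
by apply: (fb i (i.+1 + j) (i.+1 + (j.+1 + k))) => //; lia.
Qed.

Lemma between_head M p T : between (rcons M p) -> subseq (rev T) M ->
  forall e, e \in p -> has (fun q : seq nat => e \in q) T -> e \in head [::] T.
Proof.
case: T => // t T bM; rewrite rev_cons => sub e ep /= /orP[//|/hasP[q qT eq]].
apply: (bM q t p) => //; rewrite -cats1 -[[:: q; t; p]]/([:: q; t] ++ [:: p]).
apply: cat_subseq => //; apply: subseq_trans sub.
by rewrite -cats1 -cat1s cat_subseq // sub1seq mem_rev.
Qed.

(** A node of [p] on some earlier chosen path is also on the latest one, which lies between. So the
    gain from [p] depends on the earlier choice only through its latest path. *)
Lemma served_cons A M p T : between (rcons M p) -> subseq (rev T) M ->
  served A (p :: T) =
  served A T + count (fun a => (a.2 \in p) && (a.2 \notin head [::] T)) A.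
Proof.
move=> bM sub; rewrite /served -count_predUI [X in _ = _ + X](_ : _ = 0); last first.
  rewrite -(count_pred0 A); apply: eq_count => a /=; apply/negP => /and3P[h ap /negP].
  by apply; apply: between_head bM sub _ ap h.
rewrite addn0; apply: eq_count => a /=; have [ap|_] := boolP (a.2 \in p); last by rewrite orbF.
case: (boolP (a.2 \in head [::] T)) => h /=; last by rewrite orbT.
by rewrite orbF; apply/esym; case: (T) h => //= t T' ->.
Qed.

(** Exchange argument: a partial choice may be replaced by a cheaper one in the same state. Keeping
    the head is part of the invariant because the next gain reads it. *)
Lemma knapsackP A M T : between M -> subseq (rev T) M ->
  exists T', [/\ T' \in knapsack z A M, head [::] T' = head [::] T,
    served A T' = served A T & cost T' <= cost T].
Proof.
rewrite /knapsack; elim/last_ind: M T => [|M p IH] T bM sub.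
  exists [::]; rewrite mem_head; case: T sub => // t T.
  by rewrite subseq0 rev_cons; case: (rev T).
have bM' : between M.
  by move=> q t p' sub'; apply: bM; apply: subseq_trans sub' (subseq_rcons _ _).
rewrite foldl_rcons /knapsack_step; set E := foldl _ _ M.
have [sub'|nsub] := boolP (subseq (rev T) M).
  have [T' [T'E h1 h2 h3]] := IH T bM' sub'; exists T'; split=> //.
  by rewrite mem_cat T'E.
have [T0 defT sub0] : exists2 T0, T = p :: T0 & subseq (rev T0) M.
  case: T sub nsub => [|t T]; first by move=> _ /negP[]; apply: sub0seq.
  rewrite rev_cons => /subseq_rcons2[[-> sub'] _|sub' /negP//].
  by exists T.
have [T1 [T1E h1 h2 h3]] := IH T0 bM' sub0.
have sub1 := knapsack_mem T1E.
have srv : served A (p :: T1) = served A T.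
  by rewrite defT !(served_cons _ bM) // h1 h2.
have [|T2] := @cheapestP
    [seq T' <- [seq p :: T' | T' <- E] | served A T' == served A T] (p :: T1).
  by rewrite mem_filter srv eqxx map_f.
move=> T2c le2; have := cheapest_mem T2c; rewrite mem_filter => /andP[/eqP srv2].
case/mapP=> T3 _ defT2; exists T2; split=> //.
- rewrite mem_cat; apply/orP; right; apply/flattenP.
  exists (cheapest z [seq T' <- [seq p :: T' | T' <- E] | served A T' == served A T]) => //.
  apply/mapP; exists (served A T) => //.
  by rewrite mem_iota ltnS count_size.
- by rewrite defT2 defT.
- by apply: leq_trans le2 _; rewrite defT !costE !big_cons -!costE leq_add2l.
Qed.

(** Representatives whose balls contain [s] conflict pairwise, so the first of them in [M] is the
    deepest and its path contains the others. The center of that node is no heavier than [s], since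
    [s] lies in its ball. *)
Lemma cover_chains M done S : forest_ok M done -> (forall s, s \in S -> s < n) ->
  exists T, [/\ subseq (rev T) M, cost T <= \sum_(s <- S) w s &
    forall u, u \in map hd M -> has (fun s => d s u <= r u) S ->
      has (fun p : seq nat => u \in p) T].
Proof.
move=> fM Sn; have [fc fd fl fu fr fp fa _ fo] := fM.
have hdn p : p \in M -> hd p < n by move=> pM; apply/fl/(fd _ pM)/hd_mem/fc.
pose first s := find (fun p => d s (hd p) <= r (hd p)) M.
pose picks s p := (first s < size M) && (nth [::] M (first s) == p).
pose T := [seq p <- M | has (fun s => picks s p) S].
have pick_near s p : picks s p -> p \in M /\ d s (hd p) <= r (hd p).
  move=> /andP[lt /eqP <-]; split; first exact: mem_nth.
  by apply: (nth_find [::] (a := fun p => d s (hd p) <= r (hd p))); rewrite has_find.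
exists (rev T); split.
- by rewrite revK filter_subseq.
- rewrite costE (perm_big _ (permEl (perm_rev T))) /= big_filter.
  apply: (@leq_trans (\sum_(p <- M) \sum_(s <- S | picks s p) w s)).
    rewrite big_mkcond /= big_seq [X in _ <= X]big_seq; apply: leq_sum => p pM.
    case: hasP => // -[s sS ps]; rewrite (big_rem s) //= ps.
    apply: leq_trans (leq_addr _ _); have [_ near] := pick_near _ _ ps.
    by have [_ _] := centerP (hdn p pM); apply=> //; apply: Sn.
  rewrite (exchange_big_dep xpredT) //=; apply: leq_sum => s _.
  rewrite big_const_seq iter_addn_0 -[X in _ <= X]muln1 leq_mul2l; apply/orP; right.
  apply: (@leq_trans (count_mem (nth [::] M (first s)) M)).
    by apply: sub_count => p /andP[_ /eqP ->]; rewrite /= eqxx.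
  by rewrite count_uniq_mem ?leq_b1 //; apply: map_uniq fu.
- move=> u /mapP[q qM ->] /hasP[s sS near].
  rewrite has_rev; set k := first s.
  have lt_k : k < size M by rewrite -has_find; apply/hasP; exists q.
  have pk : picks s (nth [::] M k) by rewrite /picks lt_k eqxx.
  have [kM near_k] := pick_near _ _ pk.
  apply/hasP; exists (nth [::] M k).
    by rewrite mem_filter kM andbT; apply/hasP; exists s.
  have [<-|neq] := eqVneq (hd (nth [::] M k)) (hd q); first exact/hd_mem/fc.
  have c : conflict z (hd (nth [::] M k)) (hd q).
    rewrite conflictE; have := d_tri (hdn _ kM) (Sn _ sS) (hdn _ qM).
    rewrite (d_sym (hdn _ kM) (Sn _ sS)); lia.
  case: (fr _ _ kM qM neq c) => lt; first exact: fa.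
  have hk : hd (nth [::] M k) \in q by apply: fa => //; rewrite conflict_sym ?hdn.
  have [j lt_j qE] := nthP [::] qM.
  have := fo j k lt_k; rewrite qE => /(_ hk); case: (ltngtP j k) => // [lt_jk _|jk].
    have := before_find [::] lt_jk; rewrite qE /= near //.
  by rewrite -qE jk eqxx in neq.
Qed.

(** Otherwise the knapsack would hold a choice that serves as many points as the paths derived from
    [S] and costs no more, and its mask would be a solution. *)
Lemma solutions_nil M A done S : forest_ok M done ->
  (forall a, a \in A -> a.2 \in map hd M) -> (forall s, s \in S -> s < n) ->
  \sum_(s <- S) w s <= num_val (bound z) -> solutions z M A = [::] ->
  count (fun a => has (fun s => d s a.2 <= r a.2) S) A < num_val (goal z).
Proof.
move=> fM AM Sn le_B sol0; have [T [sub le_c cov]] := cover_chains fM Sn.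
have [T' [T'E _ srv le_T']] := knapsackP A (forest_between fM) sub.
rewrite ltnNge; apply/negP => le_g.
have : mask z T' \in solutions z M A; last by rewrite sol0.
apply: map_f; rewrite mem_filter T'E andbT !num_leE val_num_of_nat srv.
apply/andP; split; last by lia.
apply: leq_trans le_g _; apply: sub_in_count => a aA; apply: cov.
exact: AM.
Qed.

(** * Load orders and the search over rounds *)

Lemma by_load_sorted C l x :
  pairwise (fun y x => nth 0 C y <= nth 0 C x) l ->
  pairwise (fun y x => nth 0 C y <= nth 0 C x) (by_load C l x).
Proof.
move=> pw; rewrite /by_load pairwise_cat /= !pairwise_filter // !andbT.
apply/andP; split.
  apply/allrelP => y u; rewrite mem_filter inE => /andP[lt_y _] /orP[/eqP->|].
    exact: ltnW.
  by rewrite mem_filter -leqNgt => /andP[le_u _]; apply: leq_trans (ltnW lt_y) le_u.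
by apply/allP => y; rewrite mem_filter -leqNgt => /andP[].
Qed.

Lemma load_order_sorted C k :
  pairwise (fun y x => nth 0 C y <= nth 0 C x) (load_order C k).
Proof.
rewrite /load_order; elim/last_ind: (iota 0 k) => //= l x IH.
by rewrite foldl_rcons; apply: by_load_sorted.
Qed.

Lemma load_clusters_ok C :
  let s := clusters z (load_order C n) in
  [/\ forest_ok s.1 (load_order C n), perm_eq (map fst s.2) (iota 0 n) &
      forall a, a \in s.2 -> [/\ a.2 \in map hd s.1,
         a.1 = a.2 \/ absorbs z a.2 a.1 & nth 0 C a.2 <= nth 0 C a.1]].
Proof.
have perm := perm_load_order C n.
have [|x|H1 H2 H3] := @clusters_ok (nth 0 C) (load_order C n) _ _ (load_order_sorted C n).
- by rewrite (perm_uniq perm) iota_uniq.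
- by rewrite (perm_mem perm) mem_iota.
- by split=> //; rewrite H2 perm_rev; exact: perm.
Qed.

Lemma forest_hd_lt M done u : forest_ok M done -> u \in map hd M -> u < n.
Proof.
by case=> fc fd fl _ _ _ _ _ _ /mapP[p pM ->]; apply/fl/(fd _ pM)/hd_mem/fc.
Qed.

(** Passes from load increments, indexed by representatives, to sums over the points that caused
    them. *)
Lemma sum_count (l : seq nat) (F : nat -> nat) : (forall v, v \in l -> v < n) ->
  \sum_(v <- iota 0 n) F v * count_mem v l = \sum_(v <- l) F v.
Proof.
move=> ln; under eq_bigr => v _ do rewrite -sum1_count big_distrr /=.
rewrite (exchange_big_dep xpredT) //= big_seq [RHS]big_seq.
apply: eq_bigr => u ul; rewrite (big_rem u) ?mem_iota ?ln //= eqxx muln1.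
rewrite big_seq_cond big1 ?addn0 // => v /andP[vr /eqP uv].
by move: vr; rewrite mem_rem_uniq ?iota_uniq // inE -uv eqxx.
Qed.

Lemma rounds_keep k j : (rounds z k).2 != [::] -> (rounds z (j + k)).2 != [::].
Proof.
move=> ne; elim: j => // j; rewrite addSn /rounds iterS -/(rounds z (j + k)) /round /=.
by case: (rounds z (j + k)).2.
Qed.

Lemma rounds_solutions k l : l \in (rounds z k).2 ->
  exists C, l \in solutions z (clusters z (load_order C n)).1 (clusters z (load_order C n)).2.
Proof.
elim: k => // k IH; rewrite /rounds iterS -/(rounds z k) /round /=.
case: (rounds z k).2 IH => [_ /mem_take lC|a s]; last by apply.
by exists (rounds z k).1.
Qed.

Lemma sum_nat_of_bool (T : Type) (s : seq T) (b : pred T) :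
  \sum_(x <- s) b x = count b s.
Proof. by elim: s => [|x s IH]; rewrite ?big_nil ?big_cons //= IH. Qed.

Theorem search_complete S :
  (forall s, s \in S -> s < n) -> \sum_(s <- S) w s <= num_val (bound z) ->
  num_val (goal z) <= count (fun v => has (fun s => d s v <= r v) S) (iota 0 n) ->
  search z != [::].
Proof.
move=> Sn le_B le_g; rewrite searchE -/n; set K := (n * n * n).+1.
apply/negP => /eqP none; pose cov v := has (fun s => d s v <= r v) S.
pose C k := (rounds z k).1; pose A k := (clusters z (load_order (C k) n)).2.
have none_k k : k <= K -> (rounds z k).2 = [::].
  move=> le_k; apply/eqP; apply: contraTT isT => /(rounds_keep (K - k)).
  by rewrite subnK // none.
have okA k := load_clusters_ok (C k).
have szA k : size (A k) = n.
  by have [_ /perm_size + _] := okA k; rewrite size_map size_iota.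
have Alt k u : u \in map snd (A k) -> u < n.
  have [fM _ inA] := okA k; move=> /mapP[a aA ->].
  by have [aM _ _] := inA _ aA; apply: forest_hd_lt fM aM.
suff : K <= n * n * n by rewrite ltnn.
apply: (@perceptron n K (num_val (goal z)) cov (fun k v => nth 0 (C k) v)
  (fun k v => count_mem v (map snd (A k)))).
- by move=> v; rewrite nth_nil.
- move=> k v lt_k lt_v; rewrite /C /rounds iterS -/(rounds z k) /round /= -/n /new_load.
  by rewrite (nth_map 0) ?size_iota // nth_iota // add0n count_map.
- move=> k _; rewrite -[RHS](szA k) -(size_map snd) -sum1_size.
  rewrite -(sum_count (fun=> 1) (@Alt k)); by apply: eq_bigr => v _; rewrite mul1n.
(* The left side adds the loads of the representatives, one per point, and the right side the loads
   of the points themselves; they are compared point by point. *)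
- move=> k _; have [_ perm inA] := okA k.
  under eq_bigr => v _ do rewrite mulnC.
  rewrite (sum_count (fun v => nth 0 (C k) v) (@Alt k)) -(perm_big _ perm) /= !big_map.
  rewrite big_seq [X in _ <= X]big_seq; apply: leq_sum => a aA.
  by have [] := inA _ aA.
(* The round found nothing, so fewer points than the goal have a representative covered by [S]. *)
- move=> k lt_k; rewrite (sum_count (fun v => nat_of_bool (cov v)) (@Alt k)) big_map.
  rewrite sum_nat_of_bool; have [fM _ inA] := okA k.
  apply: (solutions_nil (S := S) fM) => //; first by move=> a /inA[].
  have := none_k k.+1 lt_k; rewrite /rounds iterS -/(rounds z k) /round /=.
  rewrite (none_k k (ltnW lt_k)) -/n -/(C k); by case: (solutions _ _ _).
- by rewrite sum_nat_of_bool.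
Qed.

Theorem search_sound l : l \in search z ->
  [/\ size l = n, \sum_(v <- iota 0 n | nth false l v) w v <= num_val (bound z) &
    num_val (goal z) <=
    count (fun x => has (fun v => nth false l v && (d v x <= 14 * r x)) (iota 0 n))
      (iota 0 n)].
Proof.
rewrite searchE => /rounds_solutions[C].
have := load_clusters_ok C; case: (clusters _ _) => M A /= [fM permA inA].
case/mapP=> T; rewrite mem_filter !num_leE val_num_of_nat => /andP[/andP[le_g le_B] TE] ->.
set cs := [seq center z (hd p) | p <- T].
have TM p : p \in T -> p \in M.
  by move=> pT; apply: (mem_subseq (knapsack_mem TE)); rewrite mem_rev.
have hdn p : p \in M -> hd p < n.
  by move=> pM; apply: forest_hd_lt fM _; apply: map_f.
have nthE v : v < n -> nth false (mask z T) v = (v \in cs).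
  by move=> vn; rewrite (nth_map 0) ?size_iota // nth_iota.
have csn v : v \in cs -> v < n.
  by move=> /mapP[p /TM/hdn pn ->]; have [] := centerP pn.
split; first by rewrite size_map size_iota.
(* Several paths may share a center, which the cost counts repeatedly and the mask only once. *)
- apply: leq_trans le_B; rewrite costE -(big_map (fun p => center z (hd p)) xpredT) -/cs.
  rewrite -(sum_count w csn) big_mkcond /= big_seq [X in _ <= X]big_seq.
  apply: leq_sum => v; rewrite mem_iota => /= vn; rewrite nthE //.
  case: ifP => // vcs; rewrite -[X in X <= _]muln1 leq_mul2l.
  by rewrite -has_count has_pred1 vcs orbT.
- apply: leq_trans le_g _; rewrite -(permP permA) count_map; apply: sub_in_count => a aA.
  case/hasP=> p pT ap /=; have pM := TM _ pT.
  have [aM abs _] := inA _ aA; have un := forest_hd_lt fM aM.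
  have [cn near _] := centerP (hdn _ pM).
  apply/hasP; exists (center z (hd p)); first by rewrite mem_iota.
  have -> /= : nth false (mask z T) (center z (hd p)).
    by rewrite nthE //; apply/mapP; exists p.
  have du : d (center z (hd p)) a.2 <= 2 * r a.2.
    by apply: path_dist fM cn pM _ _ ap; apply: leq_trans near _; rewrite leq_pmull.
  case: abs => [->|]; first by apply: leq_trans du _; rewrite leq_mul2r orbT.
  have xn : a.1 < n.
    by have := map_f fst aA; rewrite (perm_mem permA) mem_iota.
  (* The constant: 2 r(u) + (r(u) + 2 r(x)) with r(u) <= 4 r(x) is at most 14 r(x). *)
  rewrite absorbsE conflictE; move: du (d_tri cn un xn).
  move=> le1 le2 /andP[/andP[_ le3] le4].
  apply: leq_trans le2 _; apply: leq_trans (leq_add le1 le3) _; move: le4.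
  by move: (r a.2) (r a.1) => r1 r2; lia.
Qed.

End Correctness.

Import Order.TTheory GRing.Theory Num.Theory.

(** * Input and output conversion *)

Definition is_top (a : symbol) : test := fun b => b == Some a.

Definition by_symbol (X : reg) (push : symbol -> cmd) : cmd :=
  If X (is_top None) (push None)
    (If X (is_top (Some true)) (push (Some true)) (push (Some false))).

Lemma runs_by_symbol X push a l s n s' :
  get s X = a :: l -> runs (push a) s n s' -> runs (by_symbol X push) s (n + 4) s'.
Proof.
move=> top_a run; rewrite -[4]/(2 + 2) addnA.
case: a top_a run => [b|] top_a run; last first.
  apply: (runs_weaken (n := n + 2)); last by lia.
  by apply: runs_if_true run; rewrite /top top_a.
apply: runs_if_false; first by rewrite /top top_a.
by case: b top_a run => top_a run; [apply: runs_if_true | apply: runs_if_false];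
  rewrite /top ?top_a.
Qed.

(** The word is first reversed into register A, so that its encoding as a list can be built from the
    end by pushing. *)
Definition read_input : cmd :=
  Seq (While Main nonempty (Seq (by_symbol Main (Push RegA)) (Pop Main)))
  (Seq (Push Main (Some false))
  (While RegA nonempty (Seq
    (by_symbol RegA (fun a => push_word (true :: tree_bits (encode a))))
    (Pop RegA)))).

Lemma runs_read_input (w : seq symbol) :
  runs read_input (st w) (28 * size w + 4) (st (word w)).
Proof.
apply: (runs_weaken (n := 9 * size w + 1 + (2 + (19 * size w + 1)))); last by lia.
apply: (runs_seq (s2 := Store [::] (rev w) [::] [::])).
  set L := While _ _ _; suff loop v :
      runs L (Store w v [::] [::]) (9 * size w + 1) (Store [::] (catrev w v) [::] [::]).
    exact: loop.
  elim: w v => [|a w IH] v; first exact: runs_while_false.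
  apply: (runs_weaken (n := 9 * size w + 1 + (2 + 4 + 1) + 2)); last by rewrite /=; lia.
  apply: runs_while_true (IH _) => //.
  apply: (runs_seq (s2 := Store (a :: w) (a :: v) [::] [::])); last exact: runs_pop.
  by apply: (@runs_by_symbol _ _ a w) => //; apply: runs_push.
apply: runs_seq (runs_push _ _ _) _; rewrite /= -size_rev.
set L := While _ _ _; have loop v s :
    runs L (Store (word s) v [::] [::]) (19 * size v + 1) (st (word (catrev v s))).
  2: by rewrite -{3}[w]revK; apply: (loop (rev w) [::]).
elim: v s => [|a v IH] s; first exact: runs_while_false.
apply: (runs_weaken (n := 19 * size v + 1 + (2 * 6 + 4 + 1) + 2)); last by rewrite /=; lia.
apply: runs_while_true (IH (a :: s)) => //.
apply: (runs_seq (s2 := Store (word (a :: s)) (a :: v) [::] [::])); last exact: runs_pop.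
have -> : word (a :: s) = map Some (true :: tree_bits (encode a)) ++ word s.
  exact: (word_pair a s).
apply: (@runs_by_symbol _ _ a v) => //.
(* An encoded symbol has at most five bits, and one more bit marks the list cell. *)
have push_a (u : seq bool) m : size u <= 6 ->
    runs (push_word u) (Store m (a :: v) [::] [::]) (2 * 6)
         (Store (map Some u ++ m) (a :: v) [::] [::]).
  move=> le6; apply: (runs_weaken (n := 2 * size u)); last by lia.
  elim: u {le6} => [|b u IHu]; first by exists 0 => //; apply: exec_skip.
  by rewrite /= mulnS addnC; apply: runs_seq IHu _; apply: runs_push.
by apply: (push_a (true :: tree_bits (encode a)) (word s)); case: (a) => [[]|].
Qed.

Definition write_output : cmd :=
  Seq (While Main is_true_top (Seq (Pop Main) (If Main is_true_top
     (Seq (Pop Main) (Seq (Pop Main) (Seq (Pop Main) (Push RegA (Some true)))))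
     (Seq (Pop Main) (Push RegA (Some false))))))
  (Seq (Pop Main) (unmove true)).

Lemma runs_write_output (s : seq bool) :
  runs write_output (st (word s)) (17 * size s + 3) (st (map Some s)).
Proof.
apply: (runs_weaken (n := 10 * size s + 1 + (1 + (size s * 7 + 1)))); last by lia.
apply: (runs_seq (s2 := Store (word ([::] : seq bool)) (rev (map Some s)) [::] [::])).
  set L := While _ _ _; have loop v : runs L (Store (word s) v [::] [::])
      (10 * size s + 1) (Store (word ([::] : seq bool)) (catrev (map Some s) v) [::] [::]).
    2: exact: loop.
  elim: s v => [|a s IH] v; first exact: runs_while_false.
  apply: (runs_weaken (n := 10 * size s + 1 + (1 + (5 + 2)) + 2)); last by rewrite /=; lia.
  have -> : word (a :: s) = Some true :: word a ++ word s by exact: (word_pair a s).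
  apply: runs_while_true (IH _) => //; apply: runs_seq (runs_pop _ _) _ => /=.
  case: a; [apply: runs_if_true => // | apply: runs_if_false => //].
    apply: (runs_weaken (n := 1 + (1 + (1 + 2)))) => //.
    apply: runs_seq (runs_pop _ _) _; apply: runs_seq (runs_pop _ _) _.
    by apply: runs_seq (runs_pop _ _) _; apply: runs_push.
  apply: (runs_weaken (n := 1 + 2)) => //.
  by apply: runs_seq (runs_pop _ _) _; apply: runs_push.
apply: runs_seq (runs_pop _ _) _ => /=.
by have := runs_unmove true s [::] [::]; rewrite cats0.
Qed.

Lemma esize_word (w : seq symbol) : esize w <= 6 * size w + 1.
Proof.
elim: w => // a w IH; rewrite esize_cons /=.
have le5 : esize a <= 5 by case: a => [[]|].
by apply: (@leq_trans (5 + (6 * size w + 1)).+1); [rewrite ltnS leq_add | move: (size w) => b; lia].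
Qed.

(** The time bound holds on every word, valid encoding or not, hence for every [enc]. *)
Lemma ptime_machine (f : seq symbol -> seq bool) : ptime f ->
  exists M : machine,
    (forall T (enc : T -> seq symbol), polynomial_time M enc) /\
    forall w, outputs M w (map Some (f w)).
Proof.
move=> fP; have [c [n nP run]] := fP.
have [k sP] : polyb (fun w : seq symbol =>
    28 * esize w + 4 + (n w + (17 * esize (f w) + 3))).
  by repeat first [apply: polyb_add | apply: polyb_mul | apply: polyb_const
    | apply: polyb_esize | apply: polyb_size fP | done].
pose M := machine_of (Seq read_input (Seq c write_output)).
have runM w : runs (Seq read_input (Seq c write_output)) (st w)
    ((6 * size w + 3) ^ k) (st (map Some (f w))).
  have le_k : (esize w + 2) ^ k <= (6 * size w + 3) ^ k.
    have := esize_word w; case: (k) => // k1; rewrite leq_exp2r //.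
    by move: (esize w) (size w) => a b; lia.
  apply: runs_weaken (leq_trans (sP w) le_k).
  apply: (runs_weaken (n := 28 * size w + 4 + (n w + (17 * size (f w) + 3)))).
    apply: runs_seq (runs_read_input w) _; apply: runs_seq (runs_write_output _).
    by have := run w [::]; rewrite !cats0.
  by apply: leq_add; [|apply: leq_add; [|apply: leq_add]];
    rewrite // ?leq_add2r leq_mul2l size_le_esize orbT.
exists M; split=> [T enc|w]; last first.
  have [t _ /machine_of_run[hM tapeM]] := runM w; exists t.
  by split=> // i _; rewrite tapeM.
exists (((polyC 6%N * 'X + polyC 3%N)%R : {poly nat}) ^+ k)%R => x.
have [t le_t /machine_of_run[hM _]] := runM (enc x).
apply: run_halted hM; apply: leq_trans le_t _.
rewrite horner_exp !hornerE /=.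
by apply/eq_leq; elim: (k) => // k1 IH; rewrite exprS expnS IH.
Qed.

(** * Decoding an instance and clearing its denominators *)

Definition nat_bits (n : nat) : num :=
  if bin_of_nat n is BinNums.Npos p then bits_of_pos p else [::].

Lemma num_val_nat_bits n : num_val (nat_bits n) = n.
Proof.
rewrite -[RHS]bin_of_natK /nat_bits; case: (bin_of_nat n) => //= p.
by elim: p => //= p ->; rewrite ?NatTrec.doubleE.
Qed.

Definition numeral (s : num) : seq symbol := rcons (map Some s) None.

Lemma encode_natE n : encode_nat n = numeral (nat_bits n).
Proof. by rewrite /encode_nat /numeral /nat_bits; case: (bin_of_nat n). Qed.

Lemma split_word_numerals l : split_word (flatten (map numeral l)) = l.
Proof.
rewrite /split_word; set F := fun s a => _.
have loop_num s (c : num) out :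
    foldl F (c, out) (numeral s) = ([::], rev (catrev s c) :: out).
  by rewrite /numeral; elim: s c => //= b s IH c; rewrite IH.
suff loop out : foldl F ([::], out) (flatten (map numeral l)) = ([::], catrev l out).
  by rewrite loop -/(rev l) revK.
elim: l out => //= s l IH out.
by rewrite foldl_cat loop_num -/(rev s) revK IH.
Qed.

Definition ratio_bits (q : rat) : seq num := [:: nat_bits `|numq q|; nat_bits `|denq q|].

Definition ratios (I : instance) : seq rat :=
  let pts := enum 'I_(npoints I) in
  budget I :: [seq weight v | v <- pts] ++ [seq radius v | v <- pts] ++
  [seq dist u v | u <- pts, v <- pts].

Lemma encode_instanceE I : encode_instance I = flatten (map numeral
  (nat_bits (npoints I) :: nat_bits (quota I) :: flatten (map ratio_bits (ratios I)))).
Proof.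
have E l : flatten (map numeral (flatten (map ratio_bits l))) = flatten (map encode_rat l).
  elim: l => //= q l <-; rewrite /encode_rat !encode_natE -!catA //.
have eb : encode_rat (budget I) =
    numeral (nat_bits `|numq (budget I)|) ++ numeral (nat_bits `|denq (budget I)|).
  by rewrite /encode_rat !encode_natE.
have mc (f : 'I_(npoints I) -> rat) t :
    [seq encode_rat q | q <- [seq f v | v <- t]] = [seq encode_rat (f v) | v <- t].
  by rewrite -map_comp.
rewrite /encode_instance /= E !encode_natE /ratios eb !map_cat !flatten_cat -!catA !mc.
by rewrite map_allpairs.
Qed.

Lemma size_ratios I :
  size (ratios I) = (npoints I + npoints I + npoints I * npoints I).+1.
Proof. by rewrite /= !size_cat !size_map size_allpairs -enumT !size_enum_ord addnA. Qed.

Lemma nth_ratio_bits l k : k < size l ->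
  (nth [::] (flatten (map ratio_bits l)) (k * 2) = nat_bits `|numq (nth 0%R l k)|) *
  (nth [::] (flatten (map ratio_bits l)) (k * 2 + 1) = nat_bits `|denq (nth 0%R l k)|).
Proof. by elim: l k => // q l IH [|k] //= /IH. Qed.

Lemma unaryE s cap : num_val s <= cap -> unary s cap = num_val s.
Proof.
rewrite /unary foldl_rev; elim: s => [|b s IH] //= le.
rewrite IH; last by lia.
by case: b le => /= le; rewrite addnn ?add1n ?add0n; apply/minn_idPl; lia.
Qed.

Lemma nth_allpairs {S T R : Type} (f : S -> T -> R) x0 s0 t0 s t i j :
  i < size s -> j < size t ->
  nth x0 [seq f x y | x <- s, y <- t] (i * size t + j) = f (nth s0 s i) (nth t0 t j).
Proof.
elim: s i => //= x s IH [|i] lt_i lt_j; rewrite nth_cat size_map.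
  by rewrite lt_j (nth_map t0).
by rewrite mulSn -addnA ltnNge leq_addr /= addKn IH.
Qed.

Section Parse.
Variable I : instance.
Let n := npoints I.
Let l := nat_bits (npoints I) :: nat_bits (quota I) :: flatten (map ratio_bits (ratios I)).
Let m := (n + n + n * n).+1.

Definition clearing : nat := \prod_(i <- iota 0 m) `|denq (nth 0%R (ratios I) i)|.

Lemma clearing_gt0 : 0 < clearing.
Proof. by apply: prodn_gt0 => i; rewrite absz_gt0 denq_neq0. Qed.

(** The product in [cleared] omits the denominator of the fraction itself, which its numerator has
    already cancelled. *)
Lemma clearedE k : k < m -> (0 <= nth 0 (ratios I) k)%R ->
  ((num_val (cleared l m k))%:R = nth 0 (ratios I) k * clearing%:R :> rat)%R.
Proof.
move=> lt_k ge0; rewrite /cleared val_num_mul val_num_prod big_map big_filter.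
have den i : i < m -> num_val (nth [::] l (i * 2 + 3)) = `|denq (nth 0%R (ratios I) i)|.
  move=> lt_i; rewrite (_ : i * 2 + 3 = (i * 2 + 1).+2); last by lia.
  by rewrite [LHS]/= (nth_ratio_bits (l := ratios I)) ?size_ratios // num_val_nat_bits.
rewrite (_ : k * 2 + 2 = (k * 2).+2); last by lia.
rewrite [nth _ _ _.+2]/= (nth_ratio_bits (l := ratios I)) ?size_ratios // num_val_nat_bits.
have -> : \prod_(i <- iota 0 m | ~~ (i == k)) num_val (nth [::] l (i * 2 + 3)) =
    \prod_(i <- iota 0 m | i != k) `|denq (nth 0%R (ratios I) i)|.
  rewrite big_seq_cond [RHS]big_seq_cond; apply: eq_bigr => i /andP[].
  by rewrite mem_iota => /den.
rewrite /clearing (bigD1_seq k) ?iota_uniq ?mem_iota //=.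
rewrite !natrM mulrA; congr (_ * _)%R.
set q := nth _ _ _ in ge0 *.
by rewrite !natr_absz ger0_norm ?numq_ge0 // ger0_norm ?denq_ge0 // numqE.
Qed.

Let z := parse (encode_instance I).

Lemma nth_weights (v : 'I_n) : nth 0%R (ratios I) v.+1 = weight v.
Proof.
rewrite /= nth_cat size_map size_enum_ord ltn_ord (nth_map v) ?size_enum_ord //.
by rewrite nth_ord_enum.
Qed.

Lemma nth_radii (v : 'I_n) : nth 0%R (ratios I) (n + v).+1 = radius v.
Proof.
rewrite /= nth_cat size_map size_enum_ord ltnNge leq_addr /= addKn.
by rewrite nth_cat size_map size_enum_ord ltn_ord (nth_map v) ?size_enum_ord // nth_ord_enum.
Qed.

Lemma nth_dists (u v : 'I_n) : nth 0%R (ratios I) (n + n + (u * n + v)).+1 = dist u v.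
Proof.
rewrite /= nth_cat size_map size_enum_ord -addnA ltnNge leq_addr /= addKn.
rewrite nth_cat size_map size_enum_ord ltnNge leq_addr /= addKn.
have := @nth_allpairs _ _ _ (@dist I) 0%R u v (enum 'I_n) (enum 'I_n) u v.
by rewrite !size_enum_ord !nth_ord_enum => ->.
Qed.

Lemma parseE : z = (n, nat_bits (quota I), cleared l m 0,
   [seq cleared l m v.+1 | v <- iota 0 n],
   [seq cleared l m (n + v).+1 | v <- iota 0 n],
   [seq cleared l m (n + n + i).+1 | i <- iota 0 (n * n)]).
Proof.
rewrite /z /parse encode_instanceE split_word_numerals -/l /=.
rewrite unaryE num_val_nat_bits -/n //.
have le_size (t : seq rat) : size t <= size (flatten (map ratio_bits t)).
  by elim: t => //= q t IH; rewrite ltnS ltnW.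
apply: leq_trans (leqW (leqW (le_size (ratios I)))); rewrite size_ratios -/n.
by rewrite ltnW // ltnS -addnA leq_addr.
Qed.

Lemma parse_points : points z = n.
Proof. by rewrite parseE. Qed.

Lemma parse_goal : num_val (goal z) = quota I.
Proof. by rewrite parseE /goal /= num_val_nat_bits. Qed.

Lemma parse_bound : ((num_val (bound z))%:R = budget I * clearing%:R :> rat)%R.
Proof. by rewrite parseE /bound /= clearedE //=; apply/ltW/budget_gt0. Qed.

Lemma parse_wgt (v : 'I_n) : ((num_val (wgt z v))%:R = weight v * clearing%:R :> rat)%R.
Proof.
rewrite parseE /wgt /= (nth_map 0) ?size_iota // nth_iota // add0n clearedE ?nth_weights //.
  by have := ltn_ord v; rewrite /m; lia.
exact: weight_ge0.
Qed.

Lemma parse_rad (v : 'I_n) : ((num_val (rad z v))%:R = radius v * clearing%:R :> rat)%R.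
Proof.
rewrite parseE /rad /= (nth_map 0) ?size_iota // nth_iota // add0n clearedE ?nth_radii //.
  by have := ltn_ord v; rewrite /m; lia.
exact/ltW/radius_gt0.
Qed.

Lemma pair_index_lt (u v : 'I_n) : u * n + v < n * n.
Proof.
apply: (@leq_trans (u.+1 * n)); first by rewrite mulSn addnC ltn_add2r.
by rewrite leq_mul2r ltn_ord orbT.
Qed.

Lemma parse_dst (u v : 'I_n) : ((num_val (dst z u v))%:R = dist u v * clearing%:R :> rat)%R.
Proof.
have lt := pair_index_lt u v.
rewrite /dst parse_points parseE /= (nth_map 0) ?size_iota // nth_iota // add0n.
rewrite clearedE ?nth_dists //; last exact: dist_ge0.
by rewrite /m; lia.
Qed.

Lemma scale_rad x y (v : 'I_n) :
  num_val (rad (scale z x y) v) = num_val (dst z x y) * num_val (rad z v).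
Proof.
have sz : size z.1.2 = n by rewrite parseE /= size_map size_iota.
by rewrite -val_num_mul; congr num_val; apply: (nth_map [::]); rewrite sz.
Qed.

Lemma scale_dst x y (u v : 'I_n) :
  num_val (dst (scale z x y) u v) = num_val (rad z y) * num_val (dst z u v).
Proof.
have lt := pair_index_lt u v.
have sz : size z.2 = n * n by rewrite parseE /= size_map size_iota.
rewrite -val_num_mul; congr num_val; apply: (nth_map [::]).
by rewrite -[points _]/(points z) parse_points sz.
Qed.

End Parse.

(** The ratios are compared by cross multiplication, and the positive radii make this comparison
    transitive. *)
Lemma better_foldl z (l : seq (nat * nat)) :
  (forall p, p \in l -> 0 < num_val (rad z p.2)) ->
  let b := foldl (fun b p => better z b p.1 p.2) [::] l in
  match b with
  | [::] => forall p, p \in l -> search (scale z p.1 p.2) = [::]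
  | a :: _ => exists p, [/\ p \in l, a.1 = (dst z p.1 p.2, rad z p.2),
      a.2 \in search (scale z p.1 p.2) &
      forall p', p' \in l -> search (scale z p'.1 p'.2) != [::] ->
        num_val (dst z p.1 p.2) * num_val (rad z p'.2) <=
        num_val (dst z p'.1 p'.2) * num_val (rad z p.2)]
  end.
Proof.
elim/last_ind: l => [|l q IH] //= rpos.
have rpos' p : p \in l -> 0 < num_val (rad z p.2).
  by move=> pl; apply: rpos; rewrite mem_rcons inE pl orbT.
have qpos : 0 < num_val (rad z q.2) by apply: rpos; rewrite mem_rcons mem_head.
rewrite foldl_rcons; move: (IH rpos'); rewrite /better.
case: (foldl _ _ l) => [|a b]; case E: (search _) => [|sol t] /=.
- by move=> H p; rewrite mem_rcons inE => /orP[/eqP->|/H].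
- move=> H; exists q; rewrite mem_rcons mem_head E mem_head; split=> // p.
  by rewrite mem_rcons inE => /orP[/eqP->//|/H->].
- move=> [p [pl H1 H2 H3]]; exists p; split=> //.
    by rewrite mem_rcons inE pl orbT.
  by move=> p'; rewrite mem_rcons inE => /orP[/eqP->|/H3//]; rewrite E.
- move=> [p [pl H1 H2 H3]]; rewrite num_leE !val_num_mul H1 /=.
  case: ifP => [le|/negbT]; last rewrite -ltnNge => lt.
    exists p; split=> //; first by rewrite mem_rcons inE pl orbT.
    by move=> p'; rewrite mem_rcons inE => /orP[/eqP->|/H3].
  exists q; rewrite mem_rcons mem_head E mem_head; split=> // p'.
  rewrite mem_rcons inE => /orP[/eqP->//|p'l ne].
  have := H3 p' p'l ne; have := rpos' p pl; move: lt.
  move: (num_val _) (num_val _) (num_val _) (num_val _) (num_val _) (num_val _).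
  move=> d' r' rq dp rp dq lt rp_gt0 le; rewrite -(leq_pmul2l rp_gt0).
  have := leq_mul (leqnn r') (ltnW lt); have := leq_mul (leqnn rq) le; nia.
Qed.

(** * From the integer search back to rational values *)

Section Approximation.
Variable I : instance.
Let n := npoints I.
Implicit Type S : {set 'I_n}.
Local Open Scope ring_scope.

Lemma dist_set_le (v : 'I_n) S (c : rat) :
  (dist_set v S <= c%:E)%O = [exists s in S, dist v s <= c].
Proof.
apply/idP/exists_inP => [|[s sS le_s]]; last first.
  by apply: (le_trans (bigmin_le_cond _ _ sS)); rewrite lee_fin.
move=> le; apply/exists_inP; apply: contraLR le; rewrite negb_exists_in => /forall_inP H.
rewrite -ltNge; apply: lt_bigmin; first exact: ltry.
by move=> s sS; rewrite lte_fin ltNge H.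
Qed.

Definition coverage S (a : rat) : {set 'I_n} :=
  [set v | [exists s in S, dist v s <= a * radius v]].

Lemma achievesE S a : achieves S a <-> 0 <= a /\ (quota I <= #|coverage S a|)%N.
Proof.
have -> : coverage S a = [set v | (dist_set v S <= (a * radius v)%:E)%O].
  by apply/setP => v; rewrite !inE dist_set_le.
by [].
Qed.

Definition ratio (p : 'I_n * 'I_n) : rat := dist p.1 p.2 / radius p.2.

Lemma ratio_ge0 p : 0 <= ratio p.
Proof. by rewrite divr_ge0 ?dist_ge0 // ltW ?radius_gt0. Qed.

(* Only finitely many values matter: [coverage S] is constant between
   consecutive ratios. *)
Lemma coverage_ratio S a : 0 <= a -> (0 < n)%N ->
  exists2 p, ratio p <= a & coverage S a \subset coverage S (ratio p).
Proof.
(* A point paired with itself has ratio 0, so some ratio is at most [a] and a largest such one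
   exists. *)
move=> a_ge0 n_gt0; pose v0 := Ordinal n_gt0.
have v0P : ratio (v0, v0) <= a.
  by rewrite /ratio (proj2 (dist_eq0 v0 v0)) // mul0r.
case: (@arg_maxP _ _ _ (v0, v0) (fun p => ratio p <= a) ratio v0P) => p le_p max_p; exists p => //.
apply/subsetP => v; rewrite !inE => /exists_inP[s sS le].
apply/exists_inP; exists s => //.
have rv := radius_gt0 v.
rewrite -ler_pdivrMr // dist_sym; apply: (max_p (s, v)).
by rewrite /ratio /= ler_pdivrMr // dist_sym.
Qed.

(** The minimum is attained among the finitely many ratios. For quota 0 it is 0 and is treated
    apart, since there may be no point and hence no ratio. *)
Lemma achieves_value S b : achieves S b -> exists2 a, is_value S a & a <= b.
Proof.
move=> /achievesE[b_ge0 le_b]; have [q0|q_gt0] := posnP (quota I).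
  exists 0 => //; split=> [|c [//]]; by apply/achievesE; rewrite q0.
have n_gt0 : (0 < n)%N.
  have := max_card (coverage S b); rewrite card_ord.
  exact/leq_trans/(leq_trans q_gt0).
have [p0 le_p0 sub0] := coverage_ratio S b_ge0 n_gt0.
have Pp0 : (quota I <= #|coverage S (ratio p0)|)%N.
  exact: leq_trans le_b (subset_leq_card sub0).
case: (@arg_minP _ _ _ p0 (fun p => (quota I <= #|coverage S (ratio p)|)%N) ratio Pp0).
move=> p Pp min_p; exists (ratio p); last exact: le_trans (min_p _ Pp0) le_p0.
split; first by apply/achievesE; rewrite ratio_ge0.
move=> c /achievesE[c_ge0 le_c]; have [p1 le_p1 sub1] := coverage_ratio S c_ge0 n_gt0.
apply: le_trans le_p1; apply: min_p.
exact: leq_trans le_c (subset_leq_card sub1).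
Qed.

Let z := parse (encode_instance I).
Let Q : rat := (clearing I)%:R.

Lemma Q_gt0 : 0 < Q.
Proof. by rewrite ltr0n clearing_gt0. Qed.

(** Used with factor 1 for completeness of the search and 14 for its soundness. Both sides carry [Q]
    twice, once from the data and once from the candidate. *)
Lemma scale_le (k : nat) (x y s v : 'I_n) :
  (num_val (dst (scale z x y) s v) <= k * num_val (rad (scale z x y) v))%N =
  (dist v s <= k%:R * ratio (x, y) * radius v).
Proof.
have ry := radius_gt0 y; have Qg := Q_gt0.
rewrite scale_dst scale_rad -(ler_nat rat) !natrM !parse_dst !parse_rad -/Q /ratio /=.
have -> : k%:R * (dist x y / radius y) * radius v = k%:R * dist x y * radius v / radius y.
  by rewrite mulrA mulrAC.
rewrite ler_pdivlMr // (dist_sym v s) -[RHS](ler_pM2r (mulr_gt0 Qg Qg)).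
by congr (_ <= _); ring.
Qed.

Lemma ltn_points u : (u < points z)%N -> exists u' : 'I_n, u = u'.
Proof. by rewrite parse_points => lt; exists (Ordinal lt). Qed.

Lemma scale_dst_refl (x y : 'I_n) u : (u < points z)%N ->
  num_val (dst (scale z x y) u u) = 0%N.
Proof.
move=> /ltn_points[{}u ->]; apply/eqP; rewrite scale_dst muln_eq0 -(eqr_nat rat) orbC.
by rewrite -(eqr_nat rat) parse_dst (proj2 (dist_eq0 u u)) // mul0r eqxx.
Qed.

Lemma scale_dst_sym (x y : 'I_n) u v : (u < points z)%N -> (v < points z)%N ->
  num_val (dst (scale z x y) u v) = num_val (dst (scale z x y) v u).
Proof.
move=> /ltn_points[{}u ->] /ltn_points[{}v ->]; rewrite !scale_dst; congr (_ * _)%N.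
by apply/eqP; rewrite -(eqr_nat rat) !parse_dst dist_sym.
Qed.

Lemma scale_dst_triangle (x y : 'I_n) u v t :
  (u < points z)%N -> (v < points z)%N -> (t < points z)%N ->
  (num_val (dst (scale z x y) u t) <=
   num_val (dst (scale z x y) u v) + num_val (dst (scale z x y) v t))%N.
Proof.
move=> /ltn_points[{}u ->] /ltn_points[{}v ->] /ltn_points[{}t ->].
rewrite !scale_dst -mulnDr leq_mul2l -(ler_nat rat) natrD !parse_dst -mulrDl.
by rewrite (ler_pM2r Q_gt0) dist_triangle orbT.
Qed.

Lemma count_iota (P : pred nat) : count P (iota 0 n) = #|[set v : 'I_n | P v]|.
Proof.
rewrite -val_enum_ord count_map -sum1_count big_enum_cond /= -sum1_card.
by apply: eq_bigl => i; rewrite inE.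
Qed.

Lemma search_scale_complete S (x y : 'I_n) : feasible S ->
  (quota I <= #|coverage S (ratio (x, y))|)%N -> search (scale z x y) != [::].
Proof.
move=> feas cov; apply: (@search_complete (scale z x y) (@scale_dst_refl x y) (@scale_dst_sym x y)
  (@scale_dst_triangle x y) (map val (enum S))).
- by move=> s /mapP[s' _ ->]; rewrite -[points _]/(points z) parse_points ltn_ord.
- rewrite big_map -[bound _]/(bound z) -(ler_nat rat) parse_bound natr_sum big_enum /=.
  rewrite (eq_bigr (fun u => weight u * Q)) => [|u _]; last exact: parse_wgt.
  by rewrite -mulr_suml ler_pM2r // Q_gt0.
- rewrite -[goal _]/(goal z) -[points _]/(points z) parse_goal parse_points count_iota.
  apply: leq_trans cov _; apply/subset_leq_card/subsetP => v; rewrite !inE.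
  move=> /exists_inP[s sS le]; apply/hasP; exists (val s); first by rewrite map_f ?mem_enum.
  by have := scale_le 1 x y s v; rewrite mul1n mul1r le.
Qed.

Lemma search_scale_sound l (x y : 'I_n) : l \in search (scale z x y) ->
  let S := [set i : 'I_n | nth false l i] in
  [/\ size l = n, feasible S & (quota I <= #|coverage S (14%:R * ratio (x, y))|)%N].
Proof.
move=> /(@search_sound (scale z x y) (@scale_dst_refl x y) (@scale_dst_sym x y) (@scale_dst_triangle x y)).
rewrite -[goal _]/(goal z) -[points _]/(points z) -[bound _]/(bound z) parse_goal parse_points.
move=> [sz le_B le_g] S; split=> //.
- move: le_B; rewrite -(ler_nat rat) parse_bound natr_sum -val_enum_ord big_map big_enum_cond.
  rewrite (eq_bigr (fun u : 'I_n => weight u * Q)) => [|u _]; last exact: parse_wgt.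
  rewrite -mulr_suml ler_pM2r ?Q_gt0 // => le; rewrite /feasible.
  by rewrite (eq_bigl (fun u : 'I_n => nth false l u)) // => u; rewrite inE.
- apply: leq_trans le_g _; rewrite count_iota.
  apply/subset_leq_card/subsetP => v; rewrite !inE => /hasP[s].
  rewrite mem_iota /= => sn /andP[ls le].
  apply/exists_inP; exists (Ordinal sn); first by rewrite inE.
  by rewrite -(scale_le 14 x y (Ordinal sn) v).
Qed.

(** Some ratio below the optimum covers as many points, so the search succeeds on it. The smallest
    successful candidate is therefore at most the optimum, and its solution loses a factor of at
    most 14. *)
Lemma solve_approx : let S := [set i : 'I_n | nth false (solve z) i] in
  size (solve z) = n /\ approx_solution 14 S.
Proof.
have mem_pairs (x y : 'I_n) : (val x, val y) \in all_pairs (points z).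
  apply/flattenP; exists [seq (val x, y') | y' <- iota 0 (points z)].
    by apply/mapP; exists (val x) => //; rewrite mem_iota parse_points ltn_ord.
  by apply/mapP; exists (val y) => //; rewrite mem_iota parse_points ltn_ord.
have pairs_mem p : p \in all_pairs (points z) -> exists x y : 'I_n, p = (val x, val y).
  case/flattenP=> t /mapP[x xn ->] /mapP[y yn ->]; move: xn yn; rewrite !mem_iota /=.
  by move=> /ltn_points[x' ->] /ltn_points[y' ->]; exists x', y'.
have radpos (y : 'I_n) : (0 < num_val (rad z y))%N.
  by rewrite -(ltr_nat rat) parse_rad mulr_gt0 ?radius_gt0 ?Q_gt0.
have opt_pair (opt : rat) : is_optimum I opt -> (0 < quota I)%N ->
    exists2 p : 'I_n * 'I_n, ratio p <= opt & search (scale z p.1 p.2) != [::].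
  move=> [[S [feas [/achievesE[opt_ge0 le_q] _]]] _] q_gt0.
  have n_gt0 : (0 < n)%N.
    have := max_card (coverage S opt); rewrite card_ord.
    exact/leq_trans/(leq_trans q_gt0).
  have [[x y] le_p sub] := coverage_ratio S opt_ge0 n_gt0; exists (x, y) => //.
  exact: search_scale_complete feas (leq_trans le_q (subset_leq_card sub)).
have quota0 S (opt : rat) : is_optimum I opt -> quota I = 0%N ->
    exists2 a, is_value S a & a <= 14%:R * opt.
  move=> [[S' [_ [[opt_ge0 _] _]]] _] q0.
  have [|a aP le_a] := @achieves_value S 0; first by apply/achievesE; rewrite q0.
  by exists a => //; apply: le_trans le_a _; rewrite mulr_ge0.
have pos p : p \in all_pairs (points z) -> (0 < num_val (rad z p.2))%N.
  by move=> /pairs_mem[x [y ->]]; apply: radpos.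
have := better_foldl pos; rewrite /solve; case: (foldl _ _ _) => [none|a b].
  split; first by rewrite size_map size_iota parse_points.
  (* No candidate succeeded and the empty set is returned. It is feasible, and for a positive quota
     an optimum would have produced a successful candidate. *)
  split=> [|opt optP].
    rewrite /feasible big1 ?(ltW (budget_gt0 I)) // => u; rewrite inE.
    by rewrite (nth_map 0%N) // size_iota parse_points.
  have [|q_gt0] := posnP (quota I); first exact: quota0 optP.
  have [[x y] _] := opt_pair opt optP q_gt0.
  by rewrite (none (val x, val y)) ?mem_pairs.
case=> p [/pairs_mem[x [y ->]] /= H1 H2 H3].
have [sz feas cov] := search_scale_sound H2; split=> //; split=> // opt optP.
have [|q_gt0] := posnP (quota I); first exact: quota0 optP.
have [[x' y'] le_opt ne] := opt_pair opt optP q_gt0.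
have le_ratio : ratio (x, y) <= ratio (x', y').
  have := H3 (val x', val y') (mem_pairs x' y') ne.
  rewrite -(ler_nat rat) !natrM !parse_dst !parse_rad -/Q /= /ratio /=.
  have ry := radius_gt0 y; have ry' := radius_gt0 y'; have Qg := Q_gt0 => le.
  rewrite ler_pdivrMr // [X in _ <= X]mulrAC ler_pdivlMr //.
  rewrite -(ler_pM2r (mulr_gt0 Qg Qg)); move: le.
  by congr (_ <= _); ring.
have [|v vP le_v] := @achieves_value [set i : 'I_n | nth false a.2 i] (14%:R * ratio (x, y)).
  by apply/achievesE; rewrite mulr_ge0 ?ratio_ge0.
exists v => //; apply: le_trans le_v _; rewrite ler_pM2l //.
exact: le_trans le_ratio le_opt.
Qed.

Lemma encode_solution : let S := [set i : 'I_n | nth false (solve z) i] in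
  map Some (solve z) = encode_set S.
Proof.
have [sz _] := solve_approx; rewrite /encode_set; set l := solve z in sz *.
apply: (@eq_from_nth _ None) => [|i]; first by rewrite 2!size_map size_enum_ord.
rewrite size_map sz => lt_i.
rewrite (nth_map false) ?sz // (nth_map (Ordinal lt_i)) ?size_enum_ord // inE.
by rewrite (nth_enum_ord _ lt_i).
Qed.

End Approximation.

Local Open Scope ring_scope.

Theorem theorem5p2 :
  exists M : machine,
    polynomial_time M encode_instance /\ approximation_algorithm 14 M.
Proof.
have [M [polyM outM]] := ptime_machine ptime_algorithm.
exists M; split=> [|I]; first exact: polyM.
have [_ approx] := solve_approx I.
exists [set i : 'I_(npoints I) | nth false (algorithm (encode_instance I)) i] => //.
by rewrite -encode_solution; apply: outM.
Qed.
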